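(* Let $0<a\le1/4$ be given, and let $b>1$ and $\delta>0$ with $b\gg1$. Then the initial value problem for the positions $q_1,q_2$ and the momenta $p_1,p_2$, with $q=q_2-q_1$, $$\begin{aligned} q_1'&=\cosh^2\pi\,(p_1+p_2E(q))^2, & q_1(0)&=-a,\\ q_2'&=\cosh^2\pi\,(p_1E(q)+p_2)^2, & q_2(0)&=a,\\ p_1'&=\cosh^2\pi\;p_1p_2(p_1+p_2E(q))E'(q), & p_1(0)&=-(b+\delta),\\ p_2'&=-\cosh^2\pi\;p_1p_2(p_1E(q)+p_2)E'(q), & p_2(0)&=b, \end{aligned}$$ has a unique smooth solution $(q_1(t),q_2(t),p_1(t),p_2(t))$ with a finite lifespan $T$, which is the zero of $q=q_2-q_1$, satisfying the estimate $$T\lesssim\frac{1}{\delta\sqrt{2b(b+\delta)}},$$ and such that: (1) $p_1=\frac{w-p}{2}<0$ is decreasing, $\lim_{t\to T^-}p_1(t)=-\infty$, and $-p_1\simeq p\simeq q^{-1/4}$; (2) $p_2=\frac{w+p}{2}>0$ is increasing, $\lim_{t\to T^-}p_2(t)=\infty$, and $p_2\simeq p\simeq q^{-1/4}$; here $p=p_2-p_1$ and $w=p_1+p_2$ are given by $$p=\Big(p_0^2+2z_1\Big[\tfrac{1+E(q)}{\sqrt{1-E^2(q)}}-\tfrac{1+E(q_0)}{\sqrt{1-E^2(q_0)}}\Big]\Big)^{1/2},\qquad w=-\Big(w_0^2+2z_1\Big[\tfrac{\sqrt{1-E^2(q_0)}}{1+E(q_0)}-\tfrac{\sqrt{1-E^2(q)}}{1+E(q)}\Big]\Big)^{1/2},$$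 with $q_0=2a$, $p_0=2b+\delta$, $w_0=-\delta$ and $z_1=b(b+\delta)(1-E^2(q_0))^{1/2}$. (3) $w=p_1+p_2$ is decreasing from $w_0<0$ to $w_T$, where $$w_T:=\lim_{t\to T^-}w(t)=-\Big(\delta^2+2b(b+\delta)(1-E(2a))\Big)^{1/2}.$$ Finally, the 2-peakon $$u(x,t)=p_1(t)\cosh([x-q_1(t)]_p-\pi)+p_2(t)\cosh([x-q_2(t)]_p-\pi),\quad x\in\mathbb{T},\ 0<t<T,$$ is a solution of the Novikov equation with the asymmetric antipeakon-peakon initial profile $$u(x,0)=-(b+\delta)\cosh([x+a]_p-\pi)+b\cosh([x-a]_p-\pi).$$
   Context: $\mathbb{T}=\mathbb{R}/2\pi\mathbb{Z}$; $[x]_p=x-2\pi\lfloor x/(2\pi)\rfloor$; $E(x)=\frac{1}{\cosh\pi}\cosh([x]_p-\pi)$ and $E'(x)=\frac{1}{\cosh\pi}\sinh([x]_p-\pi)$. The Novikov equation is $u_t+u^2u_x+\partial_x(1-\partial_x^2)^{-1}[u^3+\frac32uu_x^2]+(1-\partial_x^2)^{-1}[\frac12u_x^3]=0$. The condition $b\gg1$ means that $b$ is large. The symbol $\lesssim$ means $\le$ up to a positive multiplicative constant, and $\simeq$ means two-sided bounds up to positive multiplicative constants independent of $t$.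
   Formalization: ''p_2 is increasing'' is false in general (a=1/4, δ=1/10, b=100 gives p_2'(0)<0); it is replaced by: p_2 is increasing on [t0,T) for some t0, and on all of [0,T) if and only if b(1−E(2a)) ≤ δE(2a). ''Solution of the Novikov equation'' is read in the distributional sense. *)

(* Defs.v *)
From Stdlib Require Export Reals Lra.
From Coquelicot Require Export Coquelicot.
Open Scope R_scope.

(* Functions on the circle R/2piZ are functions on R of period 2pi. *)
Definition periodic (f : R -> R) : Prop := forall x, f (x + 2 * PI) = f x.

(* [Int_part] is the floor function. *)
Definition wrap (x : R) : R := x - 2 * PI * IZR (Int_part (x / (2 * PI))).

Definition E (x : R) : R := / cosh PI * cosh (wrap x - PI).

Definition E' (x : R) : R := / cosh PI * sinh (wrap x - PI).

Definition Ico (T t : R) : Prop := 0 <= t < T.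

(* Derivative relative to D: one-sided at an endpoint of D that belongs to D. *)
Definition is_derive_on (D : R -> Prop) (f : R -> R) (t l : R) : Prop :=
  filterlim (fun s => (f s - f t) / (s - t))
            (within (fun s => D s /\ s <> t) (locally t)) (locally l).

(* [F n] is the n-th derivative of f relative to D. *)
Definition smooth_on (D : R -> Prop) (f : R -> R) : Prop :=
  exists F : nat -> R -> R,
    (forall t, D t -> F 0%nat t = f t) /\
    (forall n t, D t -> is_derive_on D (F n) t (F (S n) t)).

Definition increasing_on (D : R -> Prop) (f : R -> R) : Prop :=
  forall s t, D s -> D t -> s < t -> f s < f t.

Definition decreasing_on (D : R -> Prop) (f : R -> R) : Prop :=
  forall s t, D s -> D t -> s < t -> f t < f s.

Definition comparable_on (D : R -> Prop) (f g : R -> R) : Prop :=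
  exists c C : R, 0 < c /\ 0 < C /\
    forall t, D t -> c * g t <= f t <= C * g t.

Definition peakon_ivp (a b delta T : R) (q1 q2 p1 p2 : R -> R) : Prop :=
  (q1 0 = - a /\ q2 0 = a /\ p1 0 = - (b + delta) /\ p2 0 = b) /\
  forall t, Ico T t ->
    let q := q2 t - q1 t in
    is_derive_on (Ico T) q1 t ((cosh PI)^2 * (p1 t + p2 t * E q)^2) /\
    is_derive_on (Ico T) q2 t ((cosh PI)^2 * (p1 t * E q + p2 t)^2) /\
    is_derive_on (Ico T) p1 t
      ((cosh PI)^2 * (p1 t * p2 t * (p1 t + p2 t * E q) * E' q)) /\
    is_derive_on (Ico T) p2 t
      (- ((cosh PI)^2 * (p1 t * p2 t * (p1 t * E q + p2 t) * E' q))).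

Definition z1 (a b delta : R) : R :=
  b * (b + delta) * sqrt (1 - E (2 * a) ^ 2).

Definition p_formula (a b delta q : R) : R :=
  sqrt ((2 * b + delta)^2 + 2 * z1 a b delta *
          ((1 + E q) / sqrt (1 - E q ^ 2)
           - (1 + E (2 * a)) / sqrt (1 - E (2 * a) ^ 2))).

Definition w_formula (a b delta q : R) : R :=
  - sqrt ((- delta)^2 + 2 * z1 a b delta *
            (sqrt (1 - E (2 * a) ^ 2) / (1 + E (2 * a))
             - sqrt (1 - E q ^ 2) / (1 + E q))).

Definition two_peakon (q1 q2 p1 p2 : R -> R) (t x : R) : R :=
  p1 t * cosh (wrap (x - q1 t) - PI) + p2 t * cosh (wrap (x - q2 t) - PI).

(* (1 - d^2/dx^2)^{-1} on the circle is convolution with the Green function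
   cosh ([x]_p - pi) / (2 sinh pi), whose derivative jumps by -1 at 0. *)
Definition helmholtz_inv (f : R -> R) (x : R) : R :=
  / (2 * sinh PI) *
  RInt (fun y => cosh (wrap (x - y) - PI) * f y) 0 (2 * PI).

Definition smooth (f : R -> R) : Prop := forall n x, ex_derive_n f n x.

(* [F m n] is the mixed partial derivative of order m in the first variable
   and n in the second. *)
Definition smooth2 (f : R -> R -> R) : Prop :=
  exists F : nat -> nat -> R -> R -> R,
    (forall t x, F 0%nat 0%nat t x = f t x) /\
    (forall m n t x,
       continuity_2d_pt (F m n) t x /\
       is_derive (fun s => F m n s x) t (F (S m) n t x) /\
       is_derive (fun y => F m n t y) x (F m (S n) t x)).

Definition weak_derivative (f g : R -> R) : Prop :=
  ex_RInt f 0 (2 * PI) /\ ex_RInt g 0 (2 * PI) /\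
  forall psi, smooth psi -> periodic psi ->
    RInt (fun x => f x * Derive psi x) 0 (2 * PI)
    = - RInt (fun x => g x * psi x) 0 (2 * PI).

(* Smooth functions on R x (R/2piZ) whose restriction to t >= 0 has compact
   support in [0, T) x (R/2piZ). *)
Definition test_function (T : R) (phi : R -> R -> R) : Prop :=
  smooth2 phi /\ (forall t, periodic (phi t)) /\
  exists t1, t1 < T /\ forall t x, t1 <= t -> phi t x = 0.

(* Distributional solution on [0, T) x (R/2piZ), with initial data u0, of
     u_t + u^2 u_x + d_x (1 - d_x^2)^{-1} [u^3 + 3/2 u u_x^2]
         + (1 - d_x^2)^{-1} [1/2 u_x^3] = 0,
   where u_x is the weak derivative v: multiply by phi and move d_t and the
   outer d_x onto phi. *)
Definition novikov_solution (T : R) (u0 : R -> R) (u : R -> R -> R) : Prop :=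
  (forall x, u 0 x = u0 x) /\
  (forall t, 0 < t < T -> periodic (u t)) /\
  exists v : R -> R -> R,
    (forall t, 0 < t < T -> weak_derivative (u t) (v t)) /\
    forall phi, test_function T phi ->
      is_RInt (fun t => RInt (fun x =>
          - (u t x * Derive (fun s => phi s x) t)
          + (u t x)^2 * v t x * phi t x
          - helmholtz_inv (fun y => (u t y)^3 + 3 / 2 * u t y * (v t y)^2) x
              * Derive (phi t) x
          + helmholtz_inv (fun y => 1 / 2 * (v t y)^3) x * phi t x)
        0 (2 * PI)) 0 T
      (RInt (fun x => u0 x * phi 0 x) 0 (2 * PI)).

(* Main.v *)
Require Import Defs.
From Stdlib Require Import Ranalysis5 Classical ClassicalEpsilon.

(* p1 p2 sqrt (1 - E(q)^2) is conserved, and this makes p^2 and w^2 explicit functions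
   of q alone. Hence q solves q' = - G(q) with G > 0 explicit, so q is the inverse of
   the primitive of 1/G, and the extinction time is finite because 1/G = O(q^(-3/4)).
   Solving slightly beyond t = 0 backwards makes all derivatives two-sided.
   The variables (p1, p2, E(q), E'(q)) satisfy a polynomial system, which gives
   smoothness, and uniqueness by Gronwall's lemma.
   For the Novikov equation, u'' = u holds between the peaks, so that for every kernel
   g with g'' = g the function - (u^3 + 3/2 u u_x^2) g' + 1/2 u_x^3 g is the derivative of
   - u^2 u_x g' + 1/2 u u_x^2 g. Taking for g the Green function evaluates the nonlocal
   terms through the jumps at the peaks, and these jumps are q_i' = u(q_i)^2 and p_i'.
   The space integral of the weak formulation is then - d/dt of the pairing of u
   with the test function. *)

(** * Polynomial differential systems and one-sided derivatives *)

(** The equations give q' = cosh(pi)^2 p w (1 - E(q)^2), negative since p > 0 > w. Here p is of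
    order q^(-1/4), 1 - E^2 of order q, and |w| stays at least delta; this is where the exponent 3/4
    and the factor delta in the bound on T come from. The sign of p2' is not settled by p1 < 0 < p2:
    it is opposite to that of p1 E(q) + p2, where the two terms compete. As a function of q this
    quantity is increasing, and it is negative for q near 0. Hence p2 increases from some time on,
    and it increases on all of [0, T) exactly when the quantity is nonpositive at t = 0, that is,
    when b (1 - E(2a)) <= delta E(2a). The periodic E has a corner at 0, so the construction uses
    the entire functions [Ec] and [Es] on 0 < q <= 1. That a competing solution also stays where
    these agree with E and E' needs an induction along time. *)

Lemma is_derive_is_derive_on (D : R -> Prop) (f : R -> R) (t l : R) :
  is_derive f t l -> is_derive_on D f t l.
Proof.
  intros Hf; apply is_derive_Reals in Hf.
  apply filterlim_locally; intros eps.
  destruct (Hf eps (cond_pos eps)) as [d Hd].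
  exists d; intros s Hs [_ Hne].
  replace (f s) with (f (t + (s - t))) by (f_equal; ring).
  apply (Hd (s - t)); [lra | exact Hs].
Qed.

(* A function given on [0, S) is continued to t < 0 by its tangent at 0, which
   turns one-sided derivatives into two-sided ones. *)
Definition tangent_ext (l : R) (f : R -> R) (t : R) : R :=
  if Rle_dec 0 t then f t else f 0 + l * t.

Lemma tangent_ext_ge0 (l : R) (f : R -> R) (t : R) :
  0 <= t -> tangent_ext l f t = f t.
Proof. intros H; unfold tangent_ext; destruct (Rle_dec 0 t); tauto. Qed.

Lemma is_derive_tangent_ext (S : R) (f g : R -> R) :
  (forall t, Ico S t -> is_derive_on (Ico S) f t (g t)) ->
  forall t, Ico S t -> is_derive (tangent_ext (g 0) f) t (g t).
Proof.
  intros Hf t Ht.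
  apply is_derive_Reals; intros eps Heps.
  destruct (proj1 (filterlim_locally _ _) (Hf t Ht) (mkposreal eps Heps))
    as [d Hd].
  destruct (Rlt_dec 0 t) as [Ht0 | Ht0].
  - assert (Hm : 0 < Rmin d (Rmin t (S - t))).
    { unfold Ico in Ht; repeat apply Rmin_pos; try lra; apply cond_pos. }
    exists (mkposreal _ Hm); simpl; intros h Hh Hlt.
    pose proof (Rmin_l d (Rmin t (S - t))).
    pose proof (Rmin_r d (Rmin t (S - t))).
    pose proof (Rmin_l t (S - t)). pose proof (Rmin_r t (S - t)).
    apply Rabs_lt_between in Hlt.
    rewrite !tangent_ext_ge0 by lra.
    assert (Hb : Rabs ((f (t + h) - f t) / (t + h - t) - g t) < eps).
    { apply Hd; [| unfold Ico in *; split; lra].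
      change (Rabs (t + h - t) < d).
      replace (t + h - t) with h by ring; apply Rabs_lt_between; lra. }
    replace (t + h - t) with h in Hb by ring; exact Hb.
  - assert (t = 0) by (unfold Ico in Ht; lra); subst t.
    assert (Hm : 0 < Rmin d S).
    { unfold Ico in Ht; apply Rmin_pos; try lra; apply cond_pos. }
    exists (mkposreal _ Hm); simpl; intros h Hh Hlt.
    pose proof (Rmin_l d S). pose proof (Rmin_r d S).
    apply Rabs_lt_between in Hlt.
    rewrite Rplus_0_l, (tangent_ext_ge0 _ _ 0) by lra.
    destruct (Rle_dec 0 h) as [Hp | Hn].
    + rewrite tangent_ext_ge0 by lra.
      assert (Hb : Rabs ((f h - f 0) / (h - 0) - g 0) < eps).
      { apply Hd; [| unfold Ico in *; split; lra].
        change (Rabs (h - 0) < d).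
        rewrite Rminus_0_r; apply Rabs_lt_between; lra. }
      rewrite Rminus_0_r in Hb; exact Hb.
    + unfold tangent_ext; destruct (Rle_dec 0 h); [lra |].
      replace ((f 0 + g 0 * h - f 0) / h - g 0) with 0 by (field; lra).
      rewrite Rabs_R0; exact Heps.
Qed.

Lemma is_derive_cont (f : R -> R) (t l : R) :
  is_derive f t l -> continuous f t.
Proof. intros H; apply @ex_derive_continuous; exists l; exact H. Qed.

Lemma is_derive_increasing (f g : R -> R) (s t : R) :
  s < t -> (forall x, s <= x <= t -> is_derive f x (g x)) ->
  (forall x, s < x < t -> 0 < g x) -> f s < f t.
Proof.
  intros Hst Hf Hg.
  assert (Hd : forall x, s < x < t -> derivable_pt f x).
  { intros x Hx; exists (g x); apply is_derive_Reals, Hf; lra. }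
  destruct (MVT f id s t Hd (fun x _ => derivable_pt_id x) Hst)
    as [x [Hx Heq]].
  - intros x Hx; apply continuity_pt_filterlim.
    exact (is_derive_cont _ _ _ (Hf x Hx)).
  - intros x _; apply derivable_continuous_pt, derivable_pt_id.
  - rewrite (derive_pt_eq_0 f x (g x)) in Heq by (apply is_derive_Reals, Hf; lra).
    rewrite (derive_pt_eq_0 id x 1) in Heq by apply derivable_pt_lim_id.
    specialize (Hg x Hx); unfold id in Heq; nra.
Qed.

Lemma is_derive_nonincreasing (f g : R -> R) (s t : R) :
  s <= t -> (forall x, s <= x <= t -> is_derive f x (g x)) ->
  (forall x, s <= x <= t -> g x <= 0) -> f t <= f s.
Proof.
  intros Hst Hf Hg.
  destruct (MVT_gen f s t g) as [x [Hx Heq]].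
  - intros x; rewrite Rmin_left, Rmax_right by lra; intros Hx; apply Hf; lra.
  - intros x; rewrite Rmin_left, Rmax_right by lra; intros Hx.
    apply continuity_pt_filterlim; exact (is_derive_cont _ _ _ (Hf x Hx)).
  - rewrite Rmin_left, Rmax_right in Hx by lra.
    specialize (Hg x Hx); nra.
Qed.

(** No continuity of [q] is assumed: [H] is strictly decreasing, so [q s] is trapped between [x - e]
    and [x + e] as soon as [s] lies between [H (x + e)] and [H (x - e)]. The difference quotient of
    [q] is then the reciprocal of that of [H]. *)
Lemma is_derive_inverse (H h q : R -> R) (lo hi s0 s1 : R) :
  (forall x, lo < x < hi -> is_derive H x (- h x)) ->
  (forall x, lo < x < hi -> 0 < h x) ->
  (forall t, s0 < t < s1 -> lo < q t < hi /\ H (q t) = t) ->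
  forall t, s0 < t < s1 -> is_derive q t (- / h (q t)).
Proof.
  intros HH Hh Hq t Ht.
  assert (Hdec : forall x y, lo < x -> x < y -> y < hi -> H y < H x).
  { intros x y Hx Hxy Hy.
    enough (- H x < - H y) by lra.
    apply (is_derive_increasing (fun z => - H z) h x y Hxy).
    - intros z Hz.
      evar_last; [apply @is_derive_opp, HH; lra |].
      unfold opp; simpl; ring.
    - intros z Hz; apply Hh; lra. }
  destruct (Hq t Ht) as [Hx HHx]. set (x := q t) in *.
  pose proof (Hh x Hx) as Hhx.
  assert (Hcont : forall eps, 0 < eps -> exists d, 0 < d /\ forall s,
            Rabs (s - t) < d -> s0 < s < s1 /\ Rabs (q s - x) < eps).
  { intros eps Heps.
    set (e := Rmin eps (Rmin ((x - lo) / 2) ((hi - x) / 2))).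
    assert (He : 0 < e) by (unfold e; repeat apply Rmin_pos; lra).
    assert (He1 : e <= eps) by apply Rmin_l.
    assert (He2 : e <= (x - lo) / 2).
    { unfold e; eapply Rle_trans; [apply Rmin_r | apply Rmin_l]. }
    assert (He3 : e <= (hi - x) / 2).
    { unfold e; eapply Rle_trans; [apply Rmin_r | apply Rmin_r]. }
    pose proof (Hdec (x - e) x ltac:(lra) ltac:(lra) ltac:(lra)).
    pose proof (Hdec x (x + e) ltac:(lra) ltac:(lra) ltac:(lra)).
    set (d := Rmin (Rmin (H (x - e) - t) (t - H (x + e)))
                   (Rmin (t - s0) (s1 - t))).
    exists d; split; [unfold d; repeat apply Rmin_pos; lra |].
    assert (Hd1 : d <= H (x - e) - t).
    { unfold d; eapply Rle_trans; [apply Rmin_l | apply Rmin_l]. }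
    assert (Hd2 : d <= t - H (x + e)).
    { unfold d; eapply Rle_trans; [apply Rmin_l | apply Rmin_r]. }
    assert (Hd3 : d <= t - s0).
    { unfold d; eapply Rle_trans; [apply Rmin_r | apply Rmin_l]. }
    assert (Hd4 : d <= s1 - t).
    { unfold d; eapply Rle_trans; [apply Rmin_r | apply Rmin_r]. }
    intros s Hs; apply Rabs_lt_between in Hs.
    split; [lra |].
    destruct (Hq s ltac:(lra)) as [Hy HHy].
    apply Rabs_lt_between; split.
    - destruct (Rlt_dec (x - e) (q s)) as [|Hn]; [lra |].
      destruct (Req_dec (q s) (x - e)) as [E0 | E0]; [rewrite E0 in HHy; lra |].
      pose proof (Hdec (q s) (x - e) ltac:(lra) ltac:(lra) ltac:(lra)); lra.
    - destruct (Rlt_dec (q s) (x + e)) as [|Hn]; [lra |].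
      destruct (Req_dec (q s) (x + e)) as [E0 | E0]; [rewrite E0 in HHy; lra |].
      pose proof (Hdec (x + e) (q s) ltac:(lra) ltac:(lra) ltac:(lra)); lra. }
  apply is_derive_Reals; intros eps Heps.
  pose proof (proj1 (is_derive_Reals _ _ _) (HH x Hx)) as HD.
  set (l := h x) in *.
  (* The bound [l / 2] keeps the quotient [v] of [H] away from 0, with [- v > l / 2]; the other one
     makes [Rabs (v + l) / Rabs (v * l)] smaller than [eps]. *)
  set (e1 := Rmin (l / 2) (eps * l * l / 4)).
  assert (He1 : 0 < e1).
  { unfold e1; apply Rmin_pos; [lra |].
    apply Rdiv_lt_0_compat; [| lra]. repeat apply Rmult_lt_0_compat; lra. }
  assert (He1a : e1 <= l / 2) by apply Rmin_l.
  assert (He1b : e1 <= eps * l * l / 4) by apply Rmin_r.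
  destruct (HD e1 He1) as [d Hd].
  destruct (Hcont d (cond_pos d)) as [d2 [Hd2 Hc]].
  exists (mkposreal d2 Hd2); simpl; intros k Hk Hlt.
  destruct (Hc (t + k)) as [Hin Hclose].
  { replace (t + k - t) with k by ring; exact Hlt. }
  destruct (Hq (t + k) Hin) as [Hy HHy].
  set (y := q (t + k)) in *.
  assert (Hne : y - x <> 0).
  { intros E0. assert (E1 : y = x) by lra. rewrite E1, HHx in HHy; lra. }
  specialize (Hd (y - x) Hne Hclose).
  replace (x + (y - x)) with y in Hd by ring.
  rewrite HHy, HHx in Hd. replace (t + k - t) with k in Hd by ring.
  fold x.
  set (v := k / (y - x)) in *.
  apply Rabs_lt_between in Hd.
  assert (Hv : l / 2 < - v) by lra.
  assert (Ek : (y - x) / k = / v) by (unfold v; field; split; assumption).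
  rewrite Ek.
  replace (/ v - - / l) with ((v + l) / (v * l)) by (field; split; nra).
  rewrite Rabs_div by nra.
  apply Rlt_div_l; [apply Rabs_pos_lt; nra |].
  assert (Hvl : l * l / 2 <= Rabs (v * l)).
  { rewrite Rabs_left by nra. nra. }
  assert (Rabs (v + l) < e1) by (apply Rabs_lt_between; lra).
  assert (eps * (l * l / 2) <= eps * Rabs (v * l)) by (apply Rmult_le_compat_l; lra).
  assert (0 < eps * (l * l)) by (apply Rmult_lt_0_compat; nra).
  lra.
Qed.

(** Continuous induction, by the supremum of the times up to which [A] holds throughout. It serves
    in [flow_unique], where [A] says that the two peaks are properly separated. *)
Lemma real_induction (t0 : R) (A : R -> Prop) :
  0 <= t0 ->
  (forall t, 0 <= t <= t0 -> (forall s, 0 <= s < t -> A s) -> A t) ->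
  (forall t, 0 <= t <= t0 -> A t -> locally t A) ->
  forall t, 0 <= t <= t0 -> A t.
Proof.
  intros Ht0 Hstep Hopen.
  set (G := fun t => 0 <= t <= t0 /\ forall s, 0 <= s <= t -> A s).
  assert (HA0 : A 0) by (apply Hstep; [lra | intros; lra]).
  assert (HG0 : G 0).
  { split; [lra |]; intros s Hs; replace s with 0 by lra; exact HA0. }
  destruct (completeness G) as [m [Hub Hlub]].
  - exists t0; intros x [Hx _]; lra.
  - exists 0; exact HG0.
  - assert (Hm : 0 <= m <= t0).
    { split; [apply Hub, HG0 | apply Hlub; intros x [Hx _]; lra]. }
    assert (Hlt : forall s, 0 <= s < m -> A s).
    { intros s Hs.
      destruct (classic (exists t, G t /\ s < t)) as [[t [[_ Ht] Hst]] | Hn].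
      - apply Ht; lra.
      - exfalso. assert (m <= s); [| lra].
        apply Hlub; intros x Hx.
        destruct (Rle_dec x s); [assumption |].
        exfalso; apply Hn; exists x; split; [exact Hx | lra]. }
    assert (HAm : A m) by (apply Hstep; assumption).
    destruct (Hopen m Hm HAm) as [d Hd].
    assert (HG : forall x, m <= x -> x < m + d -> x <= t0 -> G x).
    { intros x Hx1 Hx2 Hx3; split; [lra |]; intros s Hs.
      destruct (Rlt_dec s m); [apply Hlt; lra |].
      apply Hd; change (Rabs (s - m) < d); apply Rabs_lt_between.
      pose proof (cond_pos d); lra. }
    destruct (Req_dec m t0) as [E0 | E0].
    + intros t Ht; destruct (Req_dec t m) as [-> | ]; [exact HAm | apply Hlt; lra].
    + exfalso.
      set (x := Rmin t0 (m + d / 2)).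
      pose proof (cond_pos d).
      assert (x <= t0) by apply Rmin_l.
      assert (x <= m + d / 2) by apply Rmin_r.
      assert (m < x) by (unfold x; apply Rmin_glb_lt; lra).
      assert (x <= m); [| lra].
      apply Hub, HG; lra.
Qed.

Lemma continuous_bounded (f : R -> R) (a b : R) :
  a <= b -> (forall x, a <= x <= b -> continuous f x) ->
  exists M, forall x, a <= x <= b -> Rabs (f x) <= M.
Proof.
  intros Hab Hf.
  destruct (continuity_ab_maj (fun x => Rabs (f x)) a b Hab) as [m [Hm _]].
  - intros x Hx; apply continuity_pt_filterlim.
    apply (continuous_comp f Rabs); [apply Hf, Hx |].
    exact (continuous_Rabs (f x)).
  - exists (Rabs (f m)); exact Hm.
Qed.

(** * Polynomial vector fields *)

Inductive var := X1 | X2 | X3 | X4.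

(** Polynomials are kept as syntax so that differentiation along a solution becomes the map [pder]
    on expressions; iterating it yields the derivatives of all orders. *)
Inductive pexp :=
  | PV (i : var)
  | PC (c : R)
  | PA (e f : pexp)
  | PM (e f : pexp).

Fixpoint peval (x : var -> R) (e : pexp) : R :=
  match e with
  | PV i => x i
  | PC c => c
  | PA e f => peval x e + peval x f
  | PM e f => peval x e * peval x f
  end.

Fixpoint pder (V : var -> pexp) (e : pexp) : pexp :=
  match e with
  | PV i => V i
  | PC c => PC 0
  | PA e f => PA (pder V e) (pder V f)
  | PM e f => PA (PM (pder V e) f) (PM e (pder V f))
  end.

Definition psolves (V : var -> pexp) (y : var -> R -> R) (t : R) : Prop :=
  forall i, is_derive (y i) t (peval (fun j => y j t) (V i)).

Lemma is_derive_peval (V : var -> pexp) (y : var -> R -> R) (t : R) (e : pexp) :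
  psolves V y t ->
  is_derive (fun s => peval (fun j => y j s) e) t
            (peval (fun j => y j t) (pder V e)).
Proof.
  intros Hy; induction e as [i | c | e IHe f IHf | e IHe f IHf]; simpl.
  - apply Hy.
  - apply @is_derive_const.
  - exact (is_derive_plus _ _ _ _ _ IHe IHf).
  - evar_last; [apply (is_derive_mult _ _ _ _ _ IHe IHf); intros; apply Rmult_comm |].
    unfold plus, mult; simpl; ring.
Qed.

(** Only the derivative of [f] has to be a polynomial in the state, not [f] itself: the positions
    [q1] and [q2] enter the state through [q2 - q1] alone. *)
Lemma smooth_on_antiderivative (D : R -> Prop) (V : var -> pexp)
    (y : var -> R -> R) (f : R -> R) (e : pexp) :
  (forall t, D t -> psolves V y t) ->
  (forall t, D t -> is_derive f t (peval (fun j => y j t) e)) ->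
  smooth_on D f.
Proof.
  intros Hy Hf.
  exists (fun n => match n with
    | O => f
    | S n => fun t => peval (fun j => y j t) (Nat.iter n (pder V) e)
    end); split; [reflexivity |].
  intros [| n] t Ht; apply is_derive_is_derive_on.
  - exact (Hf t Ht).
  - exact (is_derive_peval V y t _ (Hy t Ht)).
Qed.

Definition vdist (x y : var -> R) : R :=
  Rabs (x X1 - y X1) + Rabs (x X2 - y X2) + Rabs (x X3 - y X3) + Rabs (x X4 - y X4).

Lemma vdist_ge (x y : var -> R) (i : var) : Rabs (x i - y i) <= vdist x y.
Proof.
  unfold vdist.
  pose proof (Rabs_pos (x X1 - y X1)). pose proof (Rabs_pos (x X2 - y X2)).
  pose proof (Rabs_pos (x X3 - y X3)). pose proof (Rabs_pos (x X4 - y X4)).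
  destruct i; lra.
Qed.

Lemma peval_bounded (M : R) (e : pexp) :
  exists B, forall x, (forall i, Rabs (x i) <= M) -> Rabs (peval x e) <= B.
Proof.
  induction e as [i | c | e [B1 H1] f [B2 H2] | e [B1 H1] f [B2 H2]]; simpl.
  - exists M; intros x Hx; apply Hx.
  - exists (Rabs c); intros; lra.
  - exists (B1 + B2); intros x Hx.
    pose proof (Rabs_triang (peval x e) (peval x f)).
    specialize (H1 x Hx). specialize (H2 x Hx). lra.
  - exists (B1 * B2); intros x Hx; rewrite Rabs_mult.
    apply Rmult_le_compat; auto using Rabs_pos.
Qed.

Lemma peval_lipschitz (M : R) (e : pexp) :
  exists L, 0 <= L /\ forall x y, (forall i, Rabs (x i) <= M) ->
    (forall i, Rabs (y i) <= M) ->
    Rabs (peval x e - peval y e) <= L * vdist x y.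
Proof.
  induction e as [i | c | e [L1 [P1 H1]] f [L2 [P2 H2]]
                 | e [L1 [P1 H1]] f [L2 [P2 H2]]]; simpl.
  - exists 1; split; [lra |]; intros x y _ _.
    rewrite Rmult_1_l; apply vdist_ge.
  - exists 0; split; [lra |]; intros x y _ _.
    replace (c - c) with 0 by ring; rewrite Rabs_R0; lra.
  - exists (L1 + L2); split; [lra |]; intros x y Hx Hy.
    specialize (H1 x y Hx Hy). specialize (H2 x y Hx Hy).
    replace (peval x e + peval x f - (peval y e + peval y f))
      with ((peval x e - peval y e) + (peval x f - peval y f)) by ring.
    eapply Rle_trans; [apply Rabs_triang | lra].
  - destruct (peval_bounded M e) as [B1 K1].
    destruct (peval_bounded M f) as [B2 K2].
    exists (L1 * Rabs B2 + Rabs B1 * L2); split.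
    { pose proof (Rabs_pos B1). pose proof (Rabs_pos B2). nra. }
    intros x y Hx Hy.
    specialize (H1 x y Hx Hy). specialize (H2 x y Hx Hy).
    specialize (K2 x Hx). specialize (K1 y Hy).
    replace (peval x e * peval x f - peval y e * peval y f)
      with ((peval x e - peval y e) * peval x f
            + peval y e * (peval x f - peval y f)) by ring.
    eapply Rle_trans; [apply Rabs_triang |].
    rewrite !Rabs_mult.
    pose proof (Rle_abs B1). pose proof (Rle_abs B2).
    assert (Rabs (peval x e - peval y e) * Rabs (peval x f)
            <= (L1 * vdist x y) * Rabs B2).
    { apply Rmult_le_compat; auto using Rabs_pos; lra. }
    assert (Rabs (peval y e) * Rabs (peval x f - peval y f)
            <= Rabs B1 * (L2 * vdist x y)).
    { apply Rmult_le_compat; auto using Rabs_pos; lra. }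
    lra.
Qed.

(** The field is Lipschitz only on bounded sets, which is enough because both solutions, being
    continuous, are bounded on [[0, t1]]. The quantity in Gronwall's lemma is the sum [e] of the
    squared differences. *)
Lemma psolves_unique (V : var -> pexp) (y z : var -> R -> R) (t1 : R) :
  0 <= t1 ->
  (forall t, 0 <= t <= t1 -> psolves V y t) ->
  (forall t, 0 <= t <= t1 -> psolves V z t) ->
  (forall i, y i 0 = z i 0) ->
  forall t, 0 <= t <= t1 -> forall i, y i t = z i t.
Proof.
  intros Ht1 Hy Hz H0.
  assert (Hbd : forall u, (forall t, 0 <= t <= t1 -> psolves V u t) ->
            exists M, forall t, 0 <= t <= t1 -> forall i, Rabs (u i t) <= M).
  { intros u Hu.
    assert (Hb : forall i, exists M, forall t, 0 <= t <= t1 -> Rabs (u i t) <= M).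
    { intros i; apply continuous_bounded; [exact Ht1 |].
      intros t Ht; exact (is_derive_cont _ _ _ (Hu t Ht i)). }
    destruct (Hb X1) as [M1 B1]. destruct (Hb X2) as [M2 B2].
    destruct (Hb X3) as [M3 B3]. destruct (Hb X4) as [M4 B4].
    exists (Rmax (Rmax M1 M2) (Rmax M3 M4)).
    pose proof (Rmax_l (Rmax M1 M2) (Rmax M3 M4)).
    pose proof (Rmax_r (Rmax M1 M2) (Rmax M3 M4)).
    pose proof (Rmax_l M1 M2). pose proof (Rmax_r M1 M2).
    pose proof (Rmax_l M3 M4). pose proof (Rmax_r M3 M4).
    intros t Ht i; specialize (B1 t Ht); specialize (B2 t Ht);
      specialize (B3 t Ht); specialize (B4 t Ht); destruct i; lra. }
  destruct (Hbd y Hy) as [My By]. destruct (Hbd z Hz) as [Mz Bz].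
  set (M := Rmax My Mz).
  pose proof (Rmax_l My Mz). pose proof (Rmax_r My Mz). fold M in H, H1.
  assert (HL : exists L, 0 <= L /\ forall i x x', (forall i, Rabs (x i) <= M) ->
    (forall i, Rabs (x' i) <= M) ->
    Rabs (peval x (V i) - peval x' (V i)) <= L * vdist x x').
  { destruct (peval_lipschitz M (V X1)) as [L1 [P1 Q1]].
    destruct (peval_lipschitz M (V X2)) as [L2 [P2 Q2]].
    destruct (peval_lipschitz M (V X3)) as [L3 [P3 Q3]].
    destruct (peval_lipschitz M (V X4)) as [L4 [P4 Q4]].
    exists (L1 + L2 + L3 + L4); split; [lra |]. intros i x x' Hx Hx'.
    assert (0 <= vdist x x') by (eapply Rle_trans; [apply Rabs_pos | apply (vdist_ge _ _ X1)]).
    specialize (Q1 x x' Hx Hx'). specialize (Q2 x x' Hx Hx').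
    specialize (Q3 x x' Hx Hx'). specialize (Q4 x x' Hx Hx').
    destruct i; nra. }
  destruct HL as [L [HL0 HL]].
  set (d := fun i t => y i t - z i t).
  set (dd := fun i t => peval (fun j => y j t) (V i) - peval (fun j => z j t) (V i)).
  assert (Hd : forall i t, 0 <= t <= t1 -> is_derive (d i) t (dd i t)).
  { intros i t Ht. exact (is_derive_minus _ _ _ _ _ (Hy t Ht i) (Hz t Ht i)). }
  set (e := fun t => (d X1 t)^2 + (d X2 t)^2 + (d X3 t)^2 + (d X4 t)^2).
  set (e' := fun t => 2 * d X1 t * dd X1 t + 2 * d X2 t * dd X2 t
                    + 2 * d X3 t * dd X3 t + 2 * d X4 t * dd X4 t).
  (* Each product [d i t * dd i t] is at most [Rabs (d i t) * (L * D)], with [D] the sum of the four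
     distances, so e' <= 2 L D^2; and D^2 <= 4 e by Cauchy-Schwarz. *)
  set (K := 8 * L).
  assert (He' : forall t, 0 <= t <= t1 -> e' t <= K * e t).
  { intros t Ht.
    set (D := vdist (fun j => y j t) (fun j => z j t)).
    assert (HD : D = Rabs (d X1 t) + Rabs (d X2 t) + Rabs (d X3 t) + Rabs (d X4 t))
      by reflexivity.
    assert (Hi : forall i, d i t * dd i t <= Rabs (d i t) * (L * D)).
    { intros i. eapply Rle_trans; [apply Rle_abs |]. rewrite Rabs_mult.
      apply Rmult_le_compat_l; [apply Rabs_pos |].
      apply HL; intros j; [specialize (By t Ht j) | specialize (Bz t Ht j)]; lra. }
    pose proof (Hi X1). pose proof (Hi X2). pose proof (Hi X3). pose proof (Hi X4).
    assert (e' t <= 2 * L * D ^ 2).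
    { assert (e' t <= 2 * ((Rabs (d X1 t) + Rabs (d X2 t) + Rabs (d X3 t)
        + Rabs (d X4 t)) * (L * D))) by (unfold e'; lra).
      rewrite <- HD in *; lra. }
    assert (D ^ 2 <= 4 * e t).
    { unfold e. rewrite HD, <- !(pow2_abs (d _ t)).
      generalize (Rabs (d X1 t)) (Rabs (d X2 t)) (Rabs (d X3 t)) (Rabs (d X4 t)).
      intros a1 a2 a3 a4.
      pose proof (pow2_ge_0 (a1 - a2)). pose proof (pow2_ge_0 (a1 - a3)).
      pose proof (pow2_ge_0 (a1 - a4)). pose proof (pow2_ge_0 (a2 - a3)).
      pose proof (pow2_ge_0 (a2 - a4)). pose proof (pow2_ge_0 (a3 - a4)). lra. }
    unfold K; nra. }
  intros t Ht i.
  assert (Hg : e t * exp (- K * t) <= e 0 * exp (- K * 0)).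
  { apply (is_derive_nonincreasing (fun t => e t * exp (- K * t))
      (fun t => (e' t - K * e t) * exp (- K * t)) 0 t); [lra | |].
    - intros s Hs.
      assert (Hs1 : 0 <= s <= t1) by lra.
      unfold e, e'.
      auto_derive.
      { repeat split; eexists; exact (Hd _ s Hs1). }
      assert (HD : forall i, Derive (fun x => d i x) s = dd i s).
      { intros j; exact (is_derive_unique _ _ _ (Hd j s Hs1)). }
      rewrite !HD.
      ring.
    - intros s Hs. specialize (He' s ltac:(lra)).
      pose proof (exp_pos (- K * s)). nra. }
  assert (e 0 = 0).
  { unfold e, d. rewrite !H0. ring. }
  pose proof (exp_pos (- K * t)).
  assert (Hs : forall x, 0 <= x ^ 2) by apply pow2_ge_0.
  pose proof (Hs (d X1 t)). pose proof (Hs (d X2 t)).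
  pose proof (Hs (d X3 t)). pose proof (Hs (d X4 t)).
  assert (e t <= 0) by nra.
  assert ((d i t) ^ 2 = 0).
  { unfold e in *; destruct i; lra. }
  assert (d i t = 0) by (apply Rsqr_0_uniq; unfold Rsqr; nra).
  unfold d in *; lra.
Qed.

(** Separation of variables: [H x], the integral of 1 / [G] from [x] to [q0], is the time at which
    the solution reaches [x]. Since [H + Phi] is nondecreasing, [H x <= Phi q0], so the total time
    is finite. The room between [q0] and [beta] allows times before 0. *)
Lemma autonomous_extinction (G Phi phi : R -> R) (q0 beta : R) :
  0 < q0 < beta ->
  (forall x, 0 < x < beta -> 0 < G x /\ continuous G x) ->
  (forall x, 0 < x <= q0 ->
     is_derive Phi x (phi x) /\ / G x <= phi x /\ 0 <= Phi x) ->
  exists (alpha T : R) (q : R -> R),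
    alpha < 0 < T /\ T <= Phi q0 /\ q 0 = q0 /\
    (forall t, alpha < t < T -> 0 < q t < beta /\ is_derive q t (- G (q t))) /\
    (forall t, 0 <= t < T -> q t <= q0) /\
    filterlim q (at_left T) (locally 0).
Proof.
  intros Hq0 HG HPhi.
  set (h := fun x => / G x).
  assert (Hh : forall x, 0 < x < beta -> 0 < h x).
  { intros x Hx; apply Rinv_0_lt_compat, HG, Hx. }
  assert (Hhc : forall x, 0 < x < beta -> continuous h x).
  { intros x Hx; destruct (HG x Hx) as [Hp Hc].
    apply (continuous_comp G Rinv); [exact Hc |].
    apply continuity_pt_filterlim, continuity_pt_inv.
    - apply derivable_continuous_pt, derivable_pt_id.
    - unfold id; lra. }
  set (H := fun x => RInt h x q0).
  assert (HH : forall x, 0 < x < beta -> is_derive H x (- h x)).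
  { intros x Hx.
    apply (is_derive_RInt' h H x q0); [| apply Hhc, Hx].
    assert (Hd : 0 < Rmin x (beta - x)) by (apply Rmin_pos; lra).
    exists (mkposreal _ Hd); intros y Hy.
    apply @RInt_correct, @ex_RInt_continuous.
    intros z Hz; apply Hhc.
    change (Rabs (y - x) < Rmin x (beta - x)) in Hy.
    pose proof (Rmin_l x (beta - x)). pose proof (Rmin_r x (beta - x)).
    apply Rabs_lt_between in Hy.
    assert (0 < y < beta) by lra.
    split; [eapply Rlt_le_trans; [| apply Hz]; apply Rmin_glb_lt; lra
           | eapply Rle_lt_trans; [apply Hz |]; apply Rmax_lub_lt; lra]. }
  assert (Hdec : forall x y, 0 < x -> x < y -> y < beta -> H y < H x).
  { intros x y Hx Hxy Hy.
    enough (- H x < - H y) by lra.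
    apply (is_derive_increasing (fun z => - H z) h x y Hxy).
    - intros z Hz.
      evar_last; [apply @is_derive_opp, HH; lra |].
      unfold opp; simpl; ring.
    - intros z Hz; apply Hh; lra. }
  assert (Hq00 : H q0 = 0) by (unfold H; apply @RInt_point).
  assert (Hbound : forall x, 0 < x <= q0 -> H x <= Phi q0).
  { intros x Hx.
    assert (- (H q0 + Phi q0) <= - (H x + Phi x)).
    { apply (is_derive_nonincreasing (fun z => - (H z + Phi z))
        (fun z => - (- h z + phi z))); [lra | |].
      - intros z Hz; apply @is_derive_opp, @is_derive_plus.
        + apply HH; lra.
        + apply HPhi; lra.
      - intros z Hz; destruct (HPhi z ltac:(lra)) as [_ [Hz1 _]].
        unfold h; lra. }
    destruct (HPhi x Hx) as [_ [_ Hp]]. lra. }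
  (* The extinction time is the supremum of the times at which the levels below [q0] are reached. *)
  destruct (completeness (fun y => exists x, 0 < x <= q0 /\ y = H x)) as [T [Hub Hlub]].
  { exists (Phi q0); intros y [x [Hx ->]]; apply Hbound, Hx. }
  { exists 0, q0; split; [lra | symmetry; exact Hq00]. }
  assert (HltT : forall x, 0 < x < beta -> H x < T).
  { intros x Hx.
    destruct (Rle_dec x q0) as [Hxq | Hxq].
    - apply Rlt_le_trans with (H (x / 2)).
      + apply Hdec; lra.
      + apply Hub; exists (x / 2); split; [lra | reflexivity].
    - apply Rlt_le_trans with (H q0); [apply Hdec; lra |].
      apply Hub; exists q0; split; [lra | reflexivity]. }
  (* Any level strictly between [q0] and [beta] would do: [H] is negative there, which gives the
     starting time [alpha < 0]. *)
  set (beta1 := (q0 + beta) / 2).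
  set (alpha := H beta1).
  assert (Hb1 : q0 < beta1 < beta) by (unfold beta1; lra).
  assert (Halpha : alpha < 0).
  { unfold alpha; rewrite <- Hq00; apply Hdec; lra. }
  assert (Hex : forall t, alpha < t < T -> exists x, 0 < x < beta /\ H x = t).
  { intros t Ht.
    destruct (classic (exists y, 0 < y <= q0 /\ t < H y)) as [[y [Hy Hty]] | Hn].
    - destruct (IVT_interv (fun x => t - H x) y beta1) as [x [Hx Hx0]].
      + intros x Hx. apply continuity_pt_minus.
        * apply continuity_pt_const; intros ? ?; reflexivity.
        * apply continuity_pt_filterlim, (is_derive_cont _ _ (- h x)), HH; lra.
      + lra.
      + lra.
      + unfold alpha in Ht; lra.
      + exists x; split; lra.
    - exfalso. assert (T <= t); [| lra].
      apply Hlub; intros y [x [Hx ->]].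
      destruct (Rle_dec (H x) t); [assumption |].
      exfalso; apply Hn; exists x; split; [assumption | lra]. }
  (* Where no preimage exists the value is arbitrary; on [(alpha, T)] one exists and, [H] being
     injective, only one. *)
  set (q := fun t => epsilon (inhabits 0) (fun x => 0 < x < beta /\ H x = t)).
  assert (Hq : forall t, alpha < t < T -> 0 < q t < beta /\ H (q t) = t).
  { intros t Ht; apply epsilon_spec, Hex, Ht. }
  assert (HT : 0 < T) by (rewrite <- Hq00; apply HltT; lra).
  assert (Hle : forall t x, alpha < t < T -> 0 < x < beta -> H x <= t -> q t <= x).
  { intros t x Ht Hx Hxt. destruct (Hq t Ht) as [Hqt Heq].
    destruct (Rle_dec (q t) x); [assumption | exfalso].
    pose proof (Hdec x (q t) ltac:(lra) ltac:(lra) ltac:(lra)); lra. }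
  exists alpha, T, q.
  split; [lra |]. split.
  { apply Hlub; intros y [x [Hx ->]]; apply Hbound, Hx. }
  split.
  { destruct (Hq 0 ltac:(lra)) as [H1 H2].
    apply Rle_antisym; [apply Hle; lra |].
    destruct (Rle_dec q0 (q 0)); [assumption | exfalso].
    pose proof (Hdec (q 0) q0 ltac:(lra) ltac:(lra) ltac:(lra)); lra. }
  split.
  { intros t Ht; split; [apply Hq, Ht |].
    replace (G (q t)) with (/ h (q t)) by (unfold h; apply Rinv_inv).
    apply (is_derive_inverse H h q 0 beta alpha T); assumption. }
  split.
  { intros t Ht; apply Hle; lra. }
  apply filterlim_locally; intros eps.
  set (x := Rmin q0 (eps / 2)).
  pose proof (cond_pos eps).
  assert (x <= q0) by apply Rmin_l.
  assert (x <= eps / 2) by apply Rmin_r.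
  assert (0 < x) by (apply Rmin_pos; lra).
  assert (Hx : 0 <= H x < T).
  { split; [| apply HltT; lra].
    destruct (Req_dec x q0) as [-> | Hne]; [lra |].
    rewrite <- Hq00; apply Rlt_le, Hdec; lra. }
  assert (Hd : 0 < T - H x) by lra.
  exists (mkposreal _ Hd); simpl; intros t Ht HtT.
  change (Rabs (t - T) < T - H x) in Ht; apply Rabs_lt_between in Ht.
  change (Rabs (q t - 0) < eps).
  pose proof (Hle t x ltac:(lra) ltac:(lra) ltac:(lra)).
  destruct (Hq t ltac:(lra)) as [Hqt _].
  apply Rabs_lt_between; lra.
Qed.

(** * The profile E and the momenta as functions of q *)

Lemma PI_gt_3 : 3 < PI.
Proof. pose proof PI2_3_2; lra. Qed.

Lemma cosh_opp (x : R) : cosh (- x) = cosh x.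
Proof. unfold cosh; rewrite Ropp_involutive; lra. Qed.

Lemma sinh_opp (x : R) : sinh (- x) = - sinh x.
Proof. unfold sinh; rewrite Ropp_involutive; lra. Qed.

Lemma cosh_pos (x : R) : 0 < cosh x.
Proof. unfold cosh; pose proof (exp_pos x); pose proof (exp_pos (- x)); lra. Qed.

Lemma sinh_lt_cosh (x : R) : sinh x < cosh x.
Proof. unfold cosh, sinh; pose proof (exp_pos (- x)); lra. Qed.

Lemma sinh_pos (x : R) : 0 < x -> 0 < sinh x.
Proof. intros H; rewrite <- sinh_0; apply sinh_lt, H. Qed.

Lemma is_derive_cosh (x : R) : is_derive cosh x (sinh x).
Proof. apply is_derive_Reals, derivable_pt_lim_cosh. Qed.

Lemma is_derive_sinh (x : R) : is_derive sinh x (cosh x).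
Proof. apply is_derive_Reals, derivable_pt_lim_sinh. Qed.

Lemma is_derive_cosh_comp (f : R -> R) (x l : R) :
  is_derive f x l -> is_derive (fun y => cosh (f y)) x (l * sinh (f x)).
Proof. intros H; apply (is_derive_comp cosh f); [apply is_derive_cosh | exact H]. Qed.

Lemma is_derive_sinh_comp (f : R -> R) (x l : R) :
  is_derive f x l -> is_derive (fun y => sinh (f y)) x (l * cosh (f x)).
Proof. intros H; apply (is_derive_comp sinh f); [apply is_derive_sinh | exact H]. Qed.

Lemma wrap_eq (x : R) (k : Z) :
  2 * PI * IZR k <= x < 2 * PI * (IZR k + 1) -> wrap x = x - 2 * PI * IZR k.
Proof.
  intros Hx; unfold wrap; pose proof PI_gt_3.
  assert (Hk : Int_part (x / (2 * PI)) = k).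
  { symmetry; apply Int_part_spec.
    assert (x / (2 * PI) * (2 * PI) = x) by (field; lra).
    nra. }
  rewrite Hk; reflexivity.
Qed.

Lemma wrap_id (x : R) : 0 <= x < 2 * PI -> wrap x = x.
Proof. intros Hx; rewrite (wrap_eq x 0); lra. Qed.

(* The restrictions of E and E' to one period, as entire functions. *)
Definition Ec (x : R) : R := cosh (x - PI) / cosh PI.
Definition Es (x : R) : R := sinh (x - PI) / cosh PI.

Lemma E_Ec (x : R) : 0 <= x < 2 * PI -> E x = Ec x.
Proof. intros Hx; unfold E, Ec; rewrite wrap_id by exact Hx; unfold Rdiv; ring. Qed.

Lemma E'_Es (x : R) : 0 <= x < 2 * PI -> E' x = Es x.
Proof. intros Hx; unfold E', Es; rewrite wrap_id by exact Hx; unfold Rdiv; ring. Qed.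

Lemma is_derive_Ec (x : R) : is_derive Ec x (Es x).
Proof.
  unfold Ec, Es.
  apply (is_derive_ext (fun y => / cosh PI * cosh (y - PI))).
  { intros t; apply Rmult_comm. }
  evar_last.
  { apply is_derive_scal, (is_derive_cosh_comp (fun y => y - PI) x 1).
    auto_derive; [exact I | ring]. }
  unfold Rdiv; simpl; ring.
Qed.

Lemma is_derive_Es (x : R) : is_derive Es x (Ec x).
Proof.
  unfold Ec, Es.
  apply (is_derive_ext (fun y => / cosh PI * sinh (y - PI))).
  { intros t; apply Rmult_comm. }
  evar_last.
  { apply is_derive_scal, (is_derive_sinh_comp (fun y => y - PI) x 1).
    auto_derive; [exact I | ring]. }
  unfold Rdiv; simpl; ring.
Qed.

Lemma Ec_0 : Ec 0 = 1.
Proof.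
  unfold Ec; replace (0 - PI) with (- PI) by ring; rewrite cosh_opp.
  pose proof (cosh_pos PI); field; lra.
Qed.

Lemma Ec_pos (x : R) : 0 < Ec x.
Proof. apply Rdiv_lt_0_compat; apply cosh_pos. Qed.

(** A lower bound for [- Es] on [0, 1], where [x - PI < -1]. It makes [1 - Ec x] comparable to [x]
    and ends up in the constant of the bound on [T]. *)
Definition slope : R := sinh 1 / cosh PI.

Lemma slope_pos : 0 < slope.
Proof. apply Rdiv_lt_0_compat; [apply sinh_pos; lra | apply cosh_pos]. Qed.

Lemma Es_bounds (x : R) : 0 <= x <= 1 -> -1 <= Es x <= - slope.
Proof.
  intros Hx; pose proof PI_gt_3; pose proof (cosh_pos PI).
  unfold Es, slope.
  assert (sinh (x - PI) <= - sinh 1).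
  { rewrite <- sinh_opp; apply Rlt_le, sinh_lt; lra. }
  assert (- sinh PI <= sinh (x - PI)).
  { rewrite <- sinh_opp. destruct (Req_dec x 0) as [-> | Hn].
    - right; f_equal; ring.
    - apply Rlt_le, sinh_lt; lra. }
  pose proof (sinh_lt_cosh PI).
  split.
  - apply Rle_div_r; lra.
  - replace (- (sinh 1 / cosh PI)) with (- sinh 1 * / cosh PI) by (unfold Rdiv; ring).
    apply Rmult_le_compat_r; [apply Rlt_le, Rinv_0_lt_compat; lra | lra].
Qed.

Lemma Ec_bounds (x : R) : 0 <= x <= 1 -> slope * x <= 1 - Ec x <= x.
Proof.
  intros Hx; split.
  - assert (Ec x + slope * x <= Ec 0 + slope * 0).
    { apply (is_derive_nonincreasing (fun y => Ec y + slope * y)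
               (fun y => Es y + slope)); [lra | |].
      - intros y _; apply @is_derive_plus; [apply is_derive_Ec |].
        auto_derive; [exact I | ring].
      - intros y Hy; pose proof (Es_bounds y ltac:(lra)); lra. }
    rewrite Ec_0 in *; lra.
  - assert (- (Ec x + x) <= - (Ec 0 + 0)).
    { apply (is_derive_nonincreasing (fun y => - (Ec y + y))
               (fun y => - (Es y + 1))); [lra | |].
      - intros y _; apply @is_derive_opp, @is_derive_plus; [apply is_derive_Ec |].
        apply @is_derive_id.
      - intros y Hy; pose proof (Es_bounds y ltac:(lra)); lra. }
    rewrite Ec_0 in *; lra.
Qed.

Lemma Ec_lt_1 (x : R) : 0 < x <= 1 -> Ec x < 1.
Proof.
  intros Hx; pose proof (Ec_bounds x ltac:(lra)); pose proof slope_pos; nra.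
Qed.

Lemma Ec_decreasing (x y : R) : 0 <= x -> x < y -> y <= 1 -> Ec y < Ec x.
Proof.
  intros Hx Hxy Hy.
  enough (- Ec x < - Ec y) by lra.
  apply (is_derive_increasing (fun y => - Ec y) (fun y => - Es y)); [lra | |].
  - intros z _; apply @is_derive_opp, is_derive_Ec.
  - intros z Hz; pose proof (Es_bounds z ltac:(lra)); pose proof slope_pos; lra.
Qed.

Definition root (x : R) : R := sqrt (1 - Ec x ^ 2).

Lemma root_arg_pos (x : R) : 0 < x <= 1 -> 0 < 1 - Ec x ^ 2.
Proof. intros Hx; pose proof (Ec_lt_1 x Hx); pose proof (Ec_pos x); nra. Qed.

Lemma root_pos (x : R) : 0 < x <= 1 -> 0 < root x.
Proof. intros Hx; apply sqrt_lt_R0, root_arg_pos, Hx. Qed.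

Lemma root_sq (x : R) : 0 < x <= 1 -> root x ^ 2 = 1 - Ec x ^ 2.
Proof.
  intros Hx; unfold root; apply pow2_sqrt, Rlt_le, root_arg_pos, Hx.
Qed.

Lemma root_increasing (x y : R) : 0 < x -> x < y -> y <= 1 -> root x < root y.
Proof.
  intros Hx Hxy Hy; apply sqrt_lt_1_alt.
  pose proof (root_arg_pos x ltac:(lra)).
  pose proof (Ec_decreasing x y ltac:(lra) Hxy Hy).
  pose proof (Ec_pos x); pose proof (Ec_pos y); nra.
Qed.

Lemma is_derive_root (x : R) :
  0 < x <= 1 -> is_derive root x (- Ec x * Es x / root x).
Proof.
  intros Hx; pose proof (root_arg_pos x Hx); pose proof (root_pos x Hx) as Hr.
  pose proof (is_derive_Ec x) as HE.
  unfold root in *.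
  auto_derive.
  - split; [eexists; exact HE |]; split; [simpl in *; lra | exact I].
  - replace (Derive (fun x => Ec x) x) with (Es x)
      by (symmetry; exact (is_derive_unique _ _ _ HE)).
    replace (1 + - (Ec x * (Ec x * 1))) with (1 - Ec x ^ 2) by ring.
    field; lra.
Qed.

(** [Pq] is p and [Wq] is - w as functions of the distance. One constant [K] serves both: as (1 + E)
    / root + root / (1 + E) = 2 / root, the squares differ by 4 z / root, which is - 4 p1 p2.
    Letting the distance tend to 0 in [Wq] identifies [K] as w_T^2. *)
Definition Pq (K z x : R) : R := sqrt (K + 2 * z * ((1 + Ec x) / root x)).
Definition Wq (K z x : R) : R := sqrt (K - 2 * z * (root x / (1 + Ec x))).

Lemma Pq_arg_pos (K z x : R) : 0 < K -> 0 < z -> 0 < x <= 1 ->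
  0 < K + 2 * z * ((1 + Ec x) / root x).
Proof.
  intros HK Hz Hx; pose proof (root_pos x Hx); pose proof (Ec_pos x).
  assert (0 < (1 + Ec x) / root x) by (apply Rdiv_lt_0_compat; lra).
  nra.
Qed.

Lemma Pq_pos (K z x : R) : 0 < K -> 0 < z -> 0 < x <= 1 -> 0 < Pq K z x.
Proof. intros; apply sqrt_lt_R0, Pq_arg_pos; assumption. Qed.

Lemma Pq_sq (K z x : R) : 0 < K -> 0 < z -> 0 < x <= 1 ->
  Pq K z x ^ 2 = K + 2 * z * ((1 + Ec x) / root x).
Proof. intros; apply pow2_sqrt, Rlt_le, Pq_arg_pos; assumption. Qed.

Lemma is_derive_Pq (K z x : R) : 0 < K -> 0 < z -> 0 < x <= 1 ->
  is_derive (Pq K z) x (z * Es x * (1 + Ec x) / (root x ^ 3 * Pq K z x)).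
Proof.
  intros HK Hz Hx.
  pose proof (Pq_pos K z x HK Hz Hx) as HP.
  pose proof (Pq_arg_pos K z x HK Hz Hx) as HA.
  pose proof (root_pos x Hx) as Hr. pose proof (root_sq x Hx) as Hs.
  pose proof (is_derive_Ec x) as HE. pose proof (is_derive_root x Hx) as HR.
  unfold Pq in *; set (P := sqrt _) in HP.
  auto_derive.
  - repeat split; try lra; try (eexists; eassumption).
  - replace (Derive (fun x => Ec x) x) with (Es x)
      by (symmetry; exact (is_derive_unique _ _ _ HE)).
    replace (Derive (fun x => root x) x) with (- Ec x * Es x / root x)
      by (symmetry; exact (is_derive_unique _ _ _ HR)).
    unfold Rdiv in P; fold P.
    replace (sqrt (K + 2 * z * ((1 + Ec x) / root x))) with P by reflexivity.
    field_simplify; [| lra | lra].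
    replace (root x ^ 2) with (1 - Ec x ^ 2).
    field; lra.
Qed.

Lemma Wq_sq (K z x : R) : 0 < K - 2 * z * (root x / (1 + Ec x)) ->
  Wq K z x ^ 2 = K - 2 * z * (root x / (1 + Ec x)).
Proof. intros; apply pow2_sqrt, Rlt_le; assumption. Qed.

Lemma is_derive_Wq (K z x : R) : 0 < x <= 1 ->
  0 < K - 2 * z * (root x / (1 + Ec x)) ->
  is_derive (Wq K z) x (z * Es x / (root x * (1 + Ec x) * Wq K z x)).
Proof.
  intros Hx HA.
  pose proof (sqrt_lt_R0 _ HA) as HW.
  pose proof (Ec_pos x).
  pose proof (root_pos x Hx) as Hr. pose proof (root_sq x Hx) as Hs.
  pose proof (is_derive_Ec x) as HE. pose proof (is_derive_root x Hx) as HR.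
  unfold Wq in *; set (W := sqrt _) in HW.
  auto_derive.
  - repeat split; try lra; try (eexists; eassumption).
  - replace (Derive (fun x => Ec x) x) with (Es x)
      by (symmetry; exact (is_derive_unique _ _ _ HE)).
    replace (Derive (fun x => root x) x) with (- Ec x * Es x / root x)
      by (symmetry; exact (is_derive_unique _ _ _ HR)).
    change (K + - (2 * z * (root x * / (1 + Ec x))))
      with (K - 2 * z * (root x / (1 + Ec x))).
    fold W.
    field_simplify; [| lra | lra].
    replace (root x ^ 2) with (1 - Ec x ^ 2).
    assert (0 < root x * W) by (apply Rmult_lt_0_compat; assumption).
    assert (0 < Ec x * (root x * W)) by (apply Rmult_lt_0_compat; assumption).
    assert (0 < Ec x ^ 2 * (root x * W)).
    { apply Rmult_lt_0_compat; [apply pow_lt |]; assumption. }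
    field; split; lra.
Qed.

(** Up to a factor 4 this is the primitive of x^(-3/4), the growth rate of the reciprocal speed;
    nested square roots keep its derivative elementary. *)
Definition fourth_root (x : R) : R := sqrt (sqrt x).

Lemma fourth_root_pos (x : R) : 0 < x -> 0 < fourth_root x.
Proof. intros H; apply sqrt_lt_R0, sqrt_lt_R0, H. Qed.

Lemma is_derive_fourth_root (x : R) : 0 < x -> is_derive fourth_root x (/ (4 * fourth_root x ^ 3)).
Proof.
  intros Hx; pose proof (sqrt_lt_R0 x Hx) as H1; pose proof (sqrt_lt_R0 _ H1) as H2.
  assert (Hq : fourth_root x ^ 2 = sqrt x) by (apply pow2_sqrt; lra).
  unfold fourth_root in *; auto_derive.
  - split; [lra | split; [lra | exact I]].
  - replace (sqrt (sqrt x) ^ 3) with (sqrt x * sqrt (sqrt x)).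
    field; lra.
    rewrite <- Hq at 1; ring.
Qed.

Lemma Rpower_quarter (x : R) : 0 < x -> Rpower x (- (1 / 4)) = / fourth_root x.
Proof.
  intros Hx; rewrite Rpower_Ropp; f_equal; unfold fourth_root.
  rewrite <- (Rpower_sqrt (sqrt x)), <- (Rpower_sqrt x), Rpower_mult.
  - f_equal; lra.
  - exact Hx.
  - apply sqrt_lt_R0, Hx.
Qed.

(** Here root^2 = (1 - E) (1 + E) >= 1 - E >= [slope * x]. *)
Lemma root_ge (x : R) : 0 < x <= 1 -> sqrt slope * sqrt x <= root x.
Proof.
  intros Hx; pose proof slope_pos.
  rewrite <- sqrt_mult by lra; apply sqrt_le_1_alt.
  pose proof (Ec_bounds x ltac:(lra)); pose proof (Ec_lt_1 x Hx); pose proof (Ec_pos x).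
  nra.
Qed.

(** The quotient is the square root of (1 - E) / (1 + E). For [z > 0] its growth makes [Wq] larger
    as the peaks approach each other. *)
Lemma root_ratio_increasing (x y : R) : 0 < x -> x < y -> y <= 1 ->
  root x / (1 + Ec x) < root y / (1 + Ec y).
Proof.
  intros Hx Hxy Hy.
  pose proof (root_increasing x y Hx Hxy Hy).
  pose proof (root_pos x ltac:(lra)).
  pose proof (Ec_decreasing x y ltac:(lra) Hxy Hy).
  pose proof (Ec_pos x); pose proof (Ec_pos y).
  apply Rmult_le_0_lt_compat; try lra.
  - apply Rlt_le, Rinv_0_lt_compat; lra.
  - apply Rinv_lt_contravar; nra.
Qed.

(** This is q1' - q2': the squares (p1 + p2 E)^2 and (p1 E + p2)^2 differ by (p1^2 - p2^2) (1 -
    E^2), and p1^2 - p2^2 = - p w. *)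
Definition speed (K z x : R) : R := (cosh PI)^2 * (Pq K z x * Wq K z x * root x ^ 2).

Lemma Pq_ge (K A x y : R) : 0 < K -> 0 < A -> 0 < x <= 1 -> 0 < y <= 1 ->
  A * sqrt (root y) / sqrt (root x) <= Pq K (A ^ 2 / 2 * root y) x.
Proof.
  intros HK HA Hx Hy.
  pose proof (root_pos x Hx). pose proof (root_pos y Hy). pose proof (Ec_pos x).
  replace (A * sqrt (root y) / sqrt (root x)) with (sqrt (A ^ 2 * root y * / root x)).
  - apply sqrt_le_1_alt.
    assert (0 < / root x) by (apply Rinv_0_lt_compat; lra).
    assert (0 < A ^ 2 * root y * / root x).
    { repeat apply Rmult_lt_0_compat; try lra; apply pow_lt; lra. }
    unfold Rdiv.
    replace (K + 2 * (A ^ 2 * / 2 * root y) * ((1 + Ec x) * / root x))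
      with (K + (A ^ 2 * root y * / root x) * (1 + Ec x)) by (field; lra).
    nra.
  - assert (0 < A ^ 2) by (apply pow_lt; lra).
    rewrite sqrt_mult, sqrt_mult, sqrt_inv, sqrt_pow2; try lra.
    + nra.
    + apply Rlt_le, Rinv_0_lt_compat; lra.
Qed.

(** With s = sqrt (root x), [Pq_ge] contributes 1 / s and root^2 is s^4, leaving s^3. By [root_ge],
    sqrt (root y) >= slope^(1/4) y^(1/4), and four such factors give one [slope]. The factor
    [fourth_root q0] is kept because it cancels on integration from 0 to [q0], which frees the bound
    on [T] from [a]. *)
Lemma speed_ge (K A delta x q0 : R) :
  0 < K -> 0 < A -> 0 < delta -> 0 < x -> x <= q0 -> q0 <= 1 ->
  delta <= Wq K (A ^ 2 / 2 * root q0) x ->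
  (cosh PI)^2 * A * delta * slope * fourth_root q0 * fourth_root x ^ 3
    <= speed K (A ^ 2 / 2 * root q0) x.
Proof.
  intros HK HA Hd Hx Hxq Hq0 HW.
  assert (Hx1 : 0 < x <= 1) by lra. assert (Hq1 : 0 < q0 <= 1) by lra.
  pose proof (root_pos x Hx1) as Hrx. pose proof (root_pos q0 Hq1) as Hrq.
  pose proof (Pq_ge K A x q0 HK HA Hx1 Hq1) as HP.
  pose proof slope_pos.
  pose proof (cosh_pos PI). assert (0 < cosh PI ^ 2) by (apply pow_lt; lra).
  set (m := fourth_root slope).
  assert (Hm : 0 < m) by (apply fourth_root_pos; lra).
  assert (Hm4 : slope = m ^ 4).
  { unfold m, fourth_root. replace (sqrt (sqrt slope) ^ 4) with ((sqrt (sqrt slope) ^ 2) ^ 2) by ring.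
    rewrite !pow2_sqrt; try lra. apply sqrt_pos. }
  assert (Hr : forall y, 0 < y <= 1 -> m * fourth_root y <= sqrt (root y)).
  { intros y Hy. unfold m, fourth_root. rewrite <- sqrt_mult by apply sqrt_pos.
    apply sqrt_le_1_alt, root_ge, Hy. }
  pose proof (Hr x Hx1) as Hmx. pose proof (Hr q0 Hq1) as Hmq.
  pose proof (fourth_root_pos x Hx) as Hqx. pose proof (fourth_root_pos q0 ltac:(lra)) as Hqq.
  set (s := sqrt (root x)) in *.
  assert (Hs : 0 < s) by (apply sqrt_lt_R0; lra).
  assert (Hs4 : root x ^ 2 = s ^ 4).
  { unfold s. replace (sqrt (root x) ^ 4) with ((sqrt (root x) ^ 2) ^ 2) by ring.
    rewrite !pow2_sqrt; lra. }
  unfold speed. rewrite Hs4, Hm4.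
  replace (cosh PI ^ 2 * A * delta * m ^ 4 * fourth_root q0 * fourth_root x ^ 3)
    with (cosh PI ^ 2 * (A * (m * fourth_root q0) * delta * (m * fourth_root x) ^ 3)) by ring.
  apply Rmult_le_compat_l; [lra |].
  apply Rle_trans with (A * sqrt (root q0) / s * delta * s ^ 4).
  - replace (A * sqrt (root q0) / s * delta * s ^ 4)
      with (A * sqrt (root q0) * delta * s ^ 3) by (field; lra).
    assert (0 < m * fourth_root x) by nra. assert (0 < m * fourth_root q0) by nra.
    apply Rmult_le_compat.
    + apply Rlt_le; repeat apply Rmult_lt_0_compat; lra.
    + apply pow_le; lra.
    + apply Rmult_le_compat_r; [lra |]. apply Rmult_le_compat_l; lra.
    + apply pow_incr; lra.
  - assert (0 < A * sqrt (root q0) / s).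
    { apply Rdiv_lt_0_compat; [apply Rmult_lt_0_compat |]; try lra.
      apply sqrt_lt_R0; lra. }
    apply Rmult_le_compat_r; [apply pow_le; lra |].
    apply Rmult_le_compat; lra.
Qed.

Lemma Wq_ge (K z x q0 delta : R) :
  0 < z -> 0 < delta -> 0 < x -> x <= q0 -> q0 <= 1 ->
  K - 2 * z * (root q0 / (1 + Ec q0)) = delta ^ 2 ->
  0 < K - 2 * z * (root x / (1 + Ec x)) /\ delta <= Wq K z x.
Proof.
  intros Hz Hd Hx Hxq Hq HK.
  assert (delta ^ 2 <= K - 2 * z * (root x / (1 + Ec x))).
  { destruct (Req_dec x q0) as [-> | Hne]; [lra |].
    pose proof (root_ratio_increasing x q0 Hx ltac:(lra) Hq). nra. }
  split.
  - assert (0 < delta ^ 2) by (apply pow_lt; lra). lra.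
  - unfold Wq. rewrite <- (sqrt_pow2 delta) by lra. apply sqrt_le_1_alt; lra.
Qed.

Lemma distance_solution (K A delta q0 : R) :
  let z := A ^ 2 / 2 * root q0 in
  0 < K -> 0 < A -> 0 < delta -> 0 < q0 <= 1 / 2 ->
  K - 2 * z * (root q0 / (1 + Ec q0)) = delta ^ 2 ->
  exists (alpha T : R) (q : R -> R),
    alpha < 0 < T /\ T <= 4 / ((cosh PI)^2 * slope) / (delta * A) /\ q 0 = q0 /\
    (forall t, alpha < t < T -> 0 < q t <= 1 /\
       0 < K - 2 * z * (root (q t) / (1 + Ec (q t))) /\
       is_derive q t (- speed K z (q t))) /\
    (forall t, 0 <= t < T -> q t <= q0) /\
    filterlim q (at_left T) (locally 0).
Proof.
  intros z HK HA Hd Hq0 Heq.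
  pose proof (root_pos q0 ltac:(lra)) as Hr0.
  assert (HA2 : 0 < A ^ 2) by (apply pow_lt; lra).
  assert (Hz : 0 < z) by (unfold z; nra).
  (* The formula for w needs a positive radicand also slightly beyond [q0]; at [q0] it equals
     [delta ^ 2], so continuity provides the interval. *)
  assert (Hbeta : exists beta, q0 < beta <= 1 /\ forall x, 0 < x < beta ->
            0 < K - 2 * z * (root x / (1 + Ec x))).
  { assert (Hc : continuous (fun x => K - 2 * z * (root x / (1 + Ec x))) q0).
    { apply @ex_derive_continuous.
      pose proof (is_derive_root q0 ltac:(lra)). pose proof (is_derive_Ec q0).
      pose proof (Ec_pos q0).
      auto_derive. repeat split; try (eexists; eassumption); lra. }
    assert (Hd2 : 0 < delta ^ 2) by (apply pow_lt; lra).
    destruct (proj1 (filterlim_locally _ _) Hc (mkposreal _ Hd2)) as [d Hdd].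
    exists (Rmin 1 (q0 + d / 2)).
    pose proof (cond_pos d).
    pose proof (Rmin_l 1 (q0 + d / 2)). pose proof (Rmin_r 1 (q0 + d / 2)).
    split; [split; [apply Rmin_glb_lt; lra | lra] |].
    intros x Hx.
    destruct (Rle_dec x q0) as [Hle | Hgt].
    - apply (Wq_ge K z x q0 delta); lra.
    - assert (Hb : Rabs (K - 2 * z * (root x / (1 + Ec x))
               - (K - 2 * z * (root q0 / (1 + Ec q0)))) < delta ^ 2).
      { apply Hdd. change (Rabs (x - q0) < d). apply Rabs_lt_between; lra. }
      rewrite Heq in Hb. apply Rabs_lt_between in Hb. lra. }
  destruct Hbeta as [beta [Hb HWb]].
  (* Chosen so that the derivative of [c * fourth_root x] is exactly the reciprocal of the lower
     bound in [speed_ge]. *)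
  set (c := 4 / (cosh PI ^ 2 * slope) / (delta * A) / fourth_root q0).
  pose proof slope_pos.
  pose proof (cosh_pos PI). assert (0 < cosh PI ^ 2) by (apply pow_lt; lra).
  pose proof (fourth_root_pos q0 ltac:(lra)) as Hqq.
  assert (Hc : 0 < c).
  { unfold c. repeat apply Rdiv_lt_0_compat; try lra; nra. }
  destruct (autonomous_extinction (speed K z) (fun x => c * fourth_root x)
              (fun x => c * / (4 * fourth_root x ^ 3)) q0 beta)
    as [alpha [T [q [Q1 [Q2 [Q3 [Q4 [Q5 Q6]]]]]]]].
  - lra.
  - intros x Hx.
    specialize (HWb x Hx).
    assert (Hx1 : 0 < x <= 1) by lra.
    split.
    + unfold speed. pose proof (Pq_pos K z x HK Hz Hx1). pose proof (sqrt_lt_R0 _ HWb).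
      pose proof (root_pos x Hx1).
      apply Rmult_lt_0_compat; [lra |].
      repeat apply Rmult_lt_0_compat; try assumption; try lra.
    + apply @ex_derive_continuous.
      pose proof (is_derive_root x Hx1). pose proof (is_derive_Pq K z x HK Hz Hx1).
      pose proof (is_derive_Wq K z x Hx1 HWb).
      unfold speed; auto_derive. repeat split; eexists; eassumption.
  - intros x Hx. pose proof (fourth_root_pos x ltac:(lra)) as Hqx.
    split; [| split].
    + apply @is_derive_scal, is_derive_fourth_root; lra.
    + destruct (Wq_ge K z x q0 delta) as [_ HW]; try lra.
      pose proof (speed_ge K A delta x q0 HK HA Hd ltac:(lra) ltac:(lra) ltac:(lra) HW) as HS.
      fold z in HS.
      apply Rle_trans with (/ (cosh PI ^ 2 * A * delta * slope * fourth_root q0 * fourth_root x ^ 3)).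
      * apply Rinv_le_contravar; [| exact HS].
        assert (0 < fourth_root x ^ 3) by (apply pow_lt; lra).
        repeat (apply Rmult_lt_0_compat; try assumption).
      * right. unfold c. field. repeat split; lra.
    + nra.
  - exists alpha, T, q. split; [exact Q1 |]. split.
    { eapply Rle_trans; [exact Q2 |]. right. unfold c. field. repeat split; lra. }
    split; [exact Q3 |]. split.
    { intros t Ht; destruct (Q4 t Ht) as [Ha Hb']. split; [lra |].
      split; [apply HWb; exact Ha | exact Hb']. }
    split; assumption.
Qed.

(** * The two-peakon flow *)

Lemma Pq_Wq_sq (K z x : R) : 0 < K -> 0 < z -> 0 < x <= 1 ->
  0 < K - 2 * z * (root x / (1 + Ec x)) ->
  Pq K z x ^ 2 - Wq K z x ^ 2 = 4 * (z / root x).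
Proof.
  intros HK Hz Hx HW.
  rewrite Pq_sq, Wq_sq by assumption.
  pose proof (root_pos x Hx); pose proof (Ec_pos x); pose proof (root_sq x Hx).
  apply Rminus_diag_uniq.
  replace (K + 2 * z * ((1 + Ec x) / root x) - (K - 2 * z * (root x / (1 + Ec x)))
           - 4 * (z / root x))
    with (2 * z * ((1 + Ec x) ^ 2 + root x ^ 2 - 2 * (1 + Ec x))
          / (root x * (1 + Ec x))) by (field; lra).
  replace (root x ^ 2) with (1 - Ec x ^ 2). field; lra.
Qed.

(* The variables are p1, p2, E(q), E'(q): E'' = E makes the system polynomial. *)
Definition pmul3 (e f g : pexp) : pexp := PM e (PM f g).
Definition speed1 : pexp :=
  let v := PA (PV X1) (PM (PV X2) (PV X3)) in pmul3 (PC ((cosh PI)^2)) v v.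
Definition speed2 : pexp :=
  let v := PA (PM (PV X1) (PV X3)) (PV X2) in pmul3 (PC ((cosh PI)^2)) v v.
Definition peakon_field (i : var) : pexp :=
  match i with
  | X1 => PM (PC ((cosh PI)^2)) (PM (PM (PV X1) (PV X2))
            (PM (PA (PV X1) (PM (PV X2) (PV X3))) (PV X4)))
  | X2 => PM (PC (- (cosh PI)^2)) (PM (PM (PV X1) (PV X2))
            (PM (PA (PM (PV X1) (PV X3)) (PV X2)) (PV X4)))
  | X3 => PM (PA speed2 (PM (PC (-1)) speed1)) (PV X4)
  | X4 => PM (PA speed2 (PM (PC (-1)) speed1)) (PV X3)
  end.

Definition peakon_state (q1 q2 p1 p2 : R -> R) (i : var) (t : R) : R :=
  match i with
  | X1 => p1 t
  | X2 => p2 t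
  | X3 => Ec (q2 t - q1 t)
  | X4 => Es (q2 t - q1 t)
  end.

Definition peakon_ode (q1 q2 p1 p2 : R -> R) (t : R) : Prop :=
  let q := q2 t - q1 t in
  is_derive q1 t ((cosh PI)^2 * (p1 t + p2 t * Ec q)^2) /\
  is_derive q2 t ((cosh PI)^2 * (p1 t * Ec q + p2 t)^2) /\
  is_derive p1 t ((cosh PI)^2 * (p1 t * p2 t * (p1 t + p2 t * Ec q) * Es q)) /\
  is_derive p2 t (- ((cosh PI)^2 * (p1 t * p2 t * (p1 t * Ec q + p2 t) * Es q))).

Lemma peakon_ode_psolves (q1 q2 p1 p2 : R -> R) (t : R) :
  peakon_ode q1 q2 p1 p2 t -> psolves peakon_field (peakon_state q1 q2 p1 p2) t.
Proof.
  intros [H1 [H2 [H3 H4]]].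
  pose proof (is_derive_minus _ _ _ _ _ H2 H1) as Hq.
  intros [| | |]; simpl.
  - evar_last; [exact H3 | simpl; ring].
  - evar_last; [exact H4 | simpl; ring].
  - evar_last.
    + apply (is_derive_comp Ec (fun s => q2 s - q1 s)); [apply is_derive_Ec | exact Hq].
    + unfold minus, plus, opp, scal; simpl; unfold mult; simpl; ring.
  - evar_last.
    + apply (is_derive_comp Es (fun s => q2 s - q1 s)); [apply is_derive_Es | exact Hq].
    + unfold minus, plus, opp, scal; simpl; unfold mult; simpl; ring.
Qed.

(** [Pq_Wq_sq] says p1 p2 = - z / root, which is the conservation law. With it and root^2 = (1 - E)
    (1 + E), the chain rule along q' = - [speed] puts p' and w' into the form required by the
    system. *)
Lemma momenta_derive (K z : R) (q : R -> R) (t : R) :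
  0 < K -> 0 < z -> 0 < q t <= 1 ->
  0 < K - 2 * z * (root (q t) / (1 + Ec (q t))) ->
  is_derive q t (- speed K z (q t)) ->
  let p1 := fun s => (- Wq K z (q s) - Pq K z (q s)) / 2 in
  let p2 := fun s => (- Wq K z (q s) + Pq K z (q s)) / 2 in
  is_derive p1 t
    ((cosh PI)^2 * (p1 t * p2 t * (p1 t + p2 t * Ec (q t)) * Es (q t))) /\
  is_derive p2 t
    (- ((cosh PI)^2 * (p1 t * p2 t * (p1 t * Ec (q t) + p2 t) * Es (q t)))).
Proof.
  intros HK Hz Hx HW Hq p1 p2.
  pose proof (Pq_Wq_sq K z (q t) HK Hz Hx HW) as Hprod.
  pose proof (Pq_pos K z (q t) HK Hz Hx) as HP.
  pose proof (sqrt_lt_R0 _ HW) as HWp. fold (Wq K z (q t)) in HWp.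
  pose proof (is_derive_comp (Pq K z) q t _ _ (is_derive_Pq K z (q t) HK Hz Hx) Hq) as DP.
  pose proof (is_derive_comp (Wq K z) q t _ _ (is_derive_Wq K z (q t) Hx HW) Hq) as DW.
  pose proof (root_pos _ Hx) as Hr. pose proof (root_sq _ Hx) as Hrs.
  pose proof (Ec_pos (q t)) as He.
  assert (Hpp : p1 t * p2 t = - (z / root (q t))).
  { unfold p1, p2. nra. }
  assert (DP' : is_derive (fun s => Pq K z (q s)) t
            (- ((cosh PI)^2 * (z / root (q t)) * Es (q t) * (1 + Ec (q t)) * Wq K z (q t)))).
  { evar_last; [exact DP |]. unfold scal; simpl; unfold mult, speed; simpl. field. lra. }
  assert (DW' : is_derive (fun s => Wq K z (q s)) t
            (- ((cosh PI)^2 * (z / root (q t)) * Es (q t) * (1 - Ec (q t)) * Pq K z (q t)))).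
  { evar_last; [exact DW |]. unfold scal; simpl; unfold mult, speed; simpl.
    replace (1 - Ec (q t)) with (root (q t) ^ 2 / (1 + Ec (q t))).
    field. lra. rewrite Hrs. field. lra. }
  rewrite !Hpp; unfold p1, p2.
  split.
  - apply (is_derive_ext (fun s => scal (/ 2) (minus (opp (Wq K z (q s))) (Pq K z (q s))))).
    { intros s; unfold scal, minus, plus, opp; simpl; unfold mult; simpl; field. }
    evar_last.
    + apply @is_derive_scal, @is_derive_minus; [apply @is_derive_opp; exact DW' | exact DP'].
    + unfold scal, minus, plus, opp; simpl; unfold mult; simpl; field. lra.
  - apply (is_derive_ext (fun s => scal (/ 2) (plus (opp (Wq K z (q s))) (Pq K z (q s))))).
    { intros s; unfold scal, minus, plus, opp; simpl; unfold mult; simpl; field. }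
    evar_last.
    + apply @is_derive_scal, @is_derive_plus; [apply @is_derive_opp; exact DW' | exact DP'].
    + unfold scal, minus, plus, opp; simpl; unfold mult; simpl; field. lra.
Qed.

(** What the later arguments use about the constructed solution, with [K] and [z] abstract. Since
    [alpha < 0], the time t = 0 is interior. *)
Definition peakon_flow (K z q0 alpha T : R) (q1 q2 p1 p2 : R -> R) : Prop :=
  let q := fun t => q2 t - q1 t in
  alpha < 0 < T /\ q 0 = q0 /\
  (forall t, alpha < t < T ->
     0 < q t <= 1 /\ 0 < K - 2 * z * (root (q t) / (1 + Ec (q t))) /\
     is_derive q t (- speed K z (q t)) /\
     p2 t - p1 t = Pq K z (q t) /\ p1 t + p2 t = - Wq K z (q t) /\
     peakon_ode q1 q2 p1 p2 t) /\
  (forall t, 0 <= t < T -> q t <= q0) /\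
  filterlim q (at_left T) (locally 0).

(** The momenta are explicit in [q], so only [q1] remains: it is the integral of its prescribed
    velocity, and [q2 = q1 + q]. The equation for [q2] then holds because [speed] is the difference
    of the two velocities. *)
Lemma peakon_flow_exists (K A delta a : R) :
  let q0 := 2 * a in
  let z := A ^ 2 / 2 * root q0 in
  0 < K -> 0 < A -> 0 < delta -> 0 < a <= 1 / 4 ->
  K - 2 * z * (root q0 / (1 + Ec q0)) = delta ^ 2 ->
  exists (alpha T : R) (q1 q2 p1 p2 : R -> R),
    T <= 4 / ((cosh PI)^2 * slope) / (delta * A) /\
    q1 0 = - a /\ q2 0 = a /\ peakon_flow K z q0 alpha T q1 q2 p1 p2.
Proof.
  intros q0 z HK HA Hd Ha Heq.
  destruct (distance_solution K A delta q0 HK HA Hd) as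
    [alpha [T [q [HT [HTle [Hq0 [Hq [Hqle Hlim]]]]]]]].
  { unfold q0; lra. }
  { exact Heq. }
  fold z in Hq.
  assert (Hz : 0 < z).
  { unfold z. pose proof (root_pos q0 ltac:(unfold q0; lra)).
    assert (0 < A ^ 2) by (apply pow_lt; lra). nra. }
  set (p1 := fun s => (- Wq K z (q s) - Pq K z (q s)) / 2).
  set (p2 := fun s => (- Wq K z (q s) + Pq K z (q s)) / 2).
  set (v := fun t => (cosh PI)^2 * (p1 t + p2 t * Ec (q t))^2).
  set (q1 := fun t => - a + RInt v 0 t).
  assert (Hm : forall t, alpha < t < T ->
    is_derive p1 t
      ((cosh PI)^2 * (p1 t * p2 t * (p1 t + p2 t * Ec (q t)) * Es (q t))) /\
    is_derive p2 t
      (- ((cosh PI)^2 * (p1 t * p2 t * (p1 t * Ec (q t) + p2 t) * Es (q t))))).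
  { intros t Ht; destruct (Hq t Ht) as [Hx [HW HD]].
    exact (momenta_derive K z q t HK Hz Hx HW HD). }
  assert (Hv : forall t, alpha < t < T -> continuous v t).
  { intros t Ht; destruct (Hm t Ht) as [D1 D2]; destruct (Hq t Ht) as [_ [_ D3]].
    pose proof (is_derive_Ec (q t)).
    apply @ex_derive_continuous; unfold v; auto_derive.
    repeat split; eexists; eassumption. }
  assert (Hq1 : forall t, alpha < t < T -> is_derive q1 t (v t)).
  { intros t Ht. evar_last.
    - apply @is_derive_plus; [apply @is_derive_const |].
      apply (is_derive_RInt v (RInt v 0) 0); [| apply Hv, Ht].
      assert (Hdd : 0 < Rmin (t - alpha) (T - t)) by (apply Rmin_pos; lra).
      exists (mkposreal _ Hdd); intros y Hy.
      change (Rabs (y - t) < Rmin (t - alpha) (T - t)) in Hy.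
      pose proof (Rmin_l (t - alpha) (T - t)). pose proof (Rmin_r (t - alpha) (T - t)).
      apply Rabs_lt_between in Hy.
      apply @RInt_correct, @ex_RInt_continuous; intros s Hs; apply Hv.
      split; [eapply Rlt_le_trans; [| apply Hs]; apply Rmin_glb_lt; lra
             | eapply Rle_lt_trans; [apply Hs |]; apply Rmax_lub_lt; lra].
    - unfold plus, zero; simpl; ring. }
  assert (Hdiff : forall t, q1 t + q t - q1 t = q t) by (intros; ring).
  exists alpha, T, q1, (fun t => q1 t + q t), p1, p2.
  split; [exact HTle |].
  assert (H10 : q1 0 = - a).
  { unfold q1; rewrite RInt_point; unfold zero; simpl; ring. }
  split; [exact H10 |].
  split; [rewrite H10, Hq0; unfold q0; ring |].
  unfold peakon_flow; cbv beta zeta.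
  split; [exact HT |]. split; [rewrite Hdiff; exact Hq0 |]. split; [| split].
  - intros t Ht; destruct (Hq t Ht) as [Hx [HW HD]]; rewrite Hdiff.
    split; [exact Hx |]. split; [exact HW |].
    split.
    { apply (is_derive_ext q); [intros; symmetry; apply Hdiff | exact HD]. }
    split; [unfold p1, p2; lra |]. split; [unfold p1, p2; lra |].
    unfold peakon_ode; rewrite !Hdiff.
    destruct (Hm t Ht) as [D1 D2].
    split; [apply Hq1, Ht |]. split; [| split; assumption].
    evar_last; [apply @is_derive_plus; [apply Hq1, Ht | exact HD] |].
    unfold plus; simpl; unfold speed, v.
    rewrite (root_sq _ Hx); unfold p1, p2; simpl; field.
  - intros t Ht; rewrite Hdiff; exact (Hqle t Ht).
  - eapply filterlim_ext; [intros; symmetry; apply Hdiff | exact Hlim].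
Qed.

(** * Behaviour of p and w near the collision *)

Lemma root_le (x : R) : 0 < x <= 1 -> root x <= 2 * sqrt x /\ root x <= 1.
Proof.
  intros Hx; pose proof (Ec_bounds x ltac:(lra)); pose proof (Ec_pos x).
  pose proof (Ec_lt_1 x Hx).
  split.
  - replace 2 with (sqrt 4).
    + rewrite <- sqrt_mult by lra. apply sqrt_le_1_alt. nra.
    + replace 4 with (2 ^ 2) by ring. apply sqrt_pow2; lra.
  - rewrite <- sqrt_1. apply sqrt_le_1_alt. nra.
Qed.

Lemma Pq_sq_ge (K z x : R) : 0 < K -> 0 < z -> 0 < x <= 1 ->
  z / sqrt x <= Pq K z x ^ 2.
Proof.
  intros HK Hz Hx; rewrite Pq_sq by assumption.
  destruct (root_le x Hx) as [Hr _]; pose proof (root_pos x Hx); pose proof (Ec_pos x).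
  pose proof (sqrt_lt_R0 x ltac:(lra)).
  assert (/ (2 * sqrt x) <= / root x) by (apply Rinv_le_contravar; lra).
  assert (0 < / root x) by (apply Rinv_0_lt_compat; lra).
  replace (z / sqrt x) with (2 * z * / (2 * sqrt x)) by (field; lra).
  unfold Rdiv.
  assert (2 * z * / (2 * sqrt x) <= 2 * z * / root x) by (apply Rmult_le_compat_l; lra).
  assert (0 <= 2 * z * (Ec x * / root x)).
  { apply Rmult_le_pos; [lra |]. apply Rmult_le_pos; lra. }
  lra.
Qed.

Lemma Pq_ge_fourth_root (K z x : R) : 0 < K -> 0 < z -> 0 < x <= 1 ->
  sqrt z * / fourth_root x <= Pq K z x.
Proof.
  intros HK Hz Hx.
  pose proof (Pq_sq_ge K z x HK Hz Hx) as H.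
  pose proof (Pq_pos K z x HK Hz Hx).
  rewrite <- (sqrt_pow2 (Pq K z x)) by lra.
  unfold fourth_root. rewrite <- sqrt_inv, <- sqrt_mult.
  - apply sqrt_le_1_alt, H.
  - lra.
  - apply Rlt_le, Rinv_0_lt_compat, sqrt_lt_R0; lra.
Qed.

(** On (0, 1] the constant [K] is absorbed by 1 <= 1 / sqrt x, while 1 + E <= 2 and [root_ge] bound
    the singular term. *)
Lemma Pq_le_fourth_root (K z x : R) : 0 < K -> 0 < z -> 0 < x <= 1 ->
  Pq K z x <= sqrt (K + 4 * z / sqrt slope) * / fourth_root x.
Proof.
  intros HK Hz Hx.
  pose proof slope_pos. pose proof (sqrt_lt_R0 slope slope_pos) as Hs.
  pose proof (sqrt_lt_R0 x ltac:(lra)) as Hsx.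
  assert (0 < 4 * z / sqrt slope) by (apply Rdiv_lt_0_compat; lra).
  unfold fourth_root, Pq. rewrite <- sqrt_inv, <- sqrt_mult.
  2: lra. 2: apply Rlt_le, Rinv_0_lt_compat; lra.
  apply sqrt_le_1_alt.
  pose proof (root_ge x Hx). pose proof (Ec_lt_1 x Hx). pose proof (Ec_pos x).
  pose proof (root_pos x Hx).
  assert (0 < sqrt slope * sqrt x) by (apply Rmult_lt_0_compat; lra).
  assert (/ root x <= / (sqrt slope * sqrt x)) by (apply Rinv_le_contravar; lra).
  assert (1 <= / sqrt x).
  { rewrite <- Rinv_1. apply Rinv_le_contravar; [lra |].
    rewrite <- sqrt_1. apply sqrt_le_1_alt; lra. }
  replace ((K + 4 * z / sqrt slope) * / sqrt x)
    with (K * / sqrt x + 2 * z * (2 * / (sqrt slope * sqrt x))) by (field; lra).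
  assert (0 < / root x) by (apply Rinv_0_lt_compat; lra).
  apply Rplus_le_compat; [nra |].
  apply Rmult_le_compat_l; [lra |].
  unfold Rdiv. nra.
Qed.

(** The difference of P and W must not be lost to cancellation. From (P - W) (P + W) = 4 z / root
    and W < P follows p2 P >= z / root, and P^2 root <= K + 4 z turns this into a fixed fraction of
    P. *)
Lemma p2_ge (K z x : R) : 0 < K -> 0 < z -> 0 < x <= 1 ->
  0 < K - 2 * z * (root x / (1 + Ec x)) ->
  z / (K + 4 * z) * Pq K z x <= (Pq K z x - Wq K z x) / 2.
Proof.
  intros HK Hz Hx HW.
  pose proof (Pq_Wq_sq K z x HK Hz Hx HW) as Hprod.
  pose proof (Pq_pos K z x HK Hz Hx) as HP.
  pose proof (sqrt_lt_R0 _ HW) as HWp; fold (Wq K z x) in HWp.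
  pose proof (root_pos x Hx) as Hr. pose proof (Ec_lt_1 x Hx). pose proof (Ec_pos x).
  destruct (root_le x Hx) as [_ Hr1].
  assert (HPr : Pq K z x ^ 2 * root x <= K + 4 * z).
  { rewrite Pq_sq by assumption.
    replace ((K + 2 * z * ((1 + Ec x) / root x)) * root x)
      with (K * root x + 2 * z * (1 + Ec x)) by (field; lra). nra. }
  assert (Hzr : z / root x * root x = z) by (field; lra).
  assert (0 < z / root x) by (apply Rdiv_lt_0_compat; lra).
  set (P := Pq K z x) in *. set (W := Wq K z x) in *.
  assert (HWP : W < P) by nra.
  assert (Hzp : 2 * z / root x <= P * (P - W)).
  { replace (2 * z / root x) with (2 * (z / root x)) by (field; lra). nra. }
  apply (Rmult_le_reg_r (K + 4 * z)); [lra |].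
  replace (z / (K + 4 * z) * P * (K + 4 * z)) with (z * P) by (field; lra).
  apply Rle_trans with ((P - W) / 2 * (P ^ 2 * root x)).
  - assert (z <= P * (P - W) / 2 * root x).
    { rewrite <- Hzr at 1. apply Rmult_le_compat_r; [lra |].
      replace (2 * z / root x) with (2 * (z / root x)) in Hzp by (field; lra). lra. }
    replace ((P - W) / 2 * (P ^ 2 * root x)) with (P * (P - W) / 2 * root x * P) by field.
    apply Rmult_le_compat_r; lra.
  - apply Rmult_le_compat_l; lra.
Qed.

Lemma Pq_lim (K z : R) (F : (R -> Prop) -> Prop) (FF : Filter F) (q : R -> R) :
  0 < K -> 0 < z -> F (fun t => 0 < q t <= 1) -> filterlim q F (locally 0) ->
  filterlim (fun t => Pq K z (q t)) F (Rbar_locally p_infty).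
Proof.
  intros HK Hz Hq Hlim P [M HM].
  assert (HM1 : 0 < z / (M ^ 2 + 1)).
  { apply Rdiv_lt_0_compat; [lra |]. pose proof (pow2_ge_0 M); lra. }
  assert (Hd : 0 < (z / (M ^ 2 + 1)) ^ 2) by (apply pow_lt; exact HM1).
  pose proof (proj1 (filterlim_locally _ _) Hlim (mkposreal _ Hd)) as Hsmall.
  unfold filtermap.
  generalize (filter_and _ _ Hq Hsmall); apply filter_imp.
  intros t [Ht Hb]; apply HM.
  change (Rabs (q t - 0) < (z / (M ^ 2 + 1)) ^ 2) in Hb.
  rewrite Rminus_0_r, Rabs_right in Hb by lra.
  pose proof (Pq_sq_ge K z (q t) HK Hz Ht) as HP.
  pose proof (Pq_pos K z (q t) HK Hz Ht).
  assert (Hs : sqrt (q t) < z / (M ^ 2 + 1)).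
  { rewrite <- (sqrt_pow2 (z / (M ^ 2 + 1))) by lra. apply sqrt_lt_1_alt; lra. }
  pose proof (sqrt_lt_R0 (q t) ltac:(lra)) as Hs0.
  assert (M ^ 2 + 1 < z / sqrt (q t)).
  { apply Rlt_div_r; [exact Hs0 |].
    pose proof (pow2_ge_0 M).
    apply (Rmult_lt_compat_l (M ^ 2 + 1)) in Hs; [| lra].
    replace ((M ^ 2 + 1) * (z / (M ^ 2 + 1))) with z in Hs by (field; lra). exact Hs. }
  nra.
Qed.

(** [root] is not differentiable at 0, so continuity is obtained by composition with [sqrt]. The
    value there is the modulus of w_T. *)
Lemma Wq_continuous_0 (K z : R) : 0 < K -> continuous (Wq K z) 0 /\ Wq K z 0 = sqrt K.
Proof.
  intros HK.
  assert (Hr0 : root 0 = 0) by (unfold root; rewrite Ec_0, <- sqrt_0; f_equal; ring).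
  assert (HcE : continuous Ec 0) by exact (is_derive_cont _ _ _ (is_derive_Ec 0)).
  assert (Hcr : continuous root 0).
  { unfold root. apply (continuous_comp (fun x => 1 - Ec x ^ 2) sqrt).
    - pose proof (is_derive_Ec 0). apply @ex_derive_continuous. auto_derive.
      eexists; eassumption.
    - apply continuous_sqrt. }
  split.
  - unfold Wq. apply (continuous_comp (fun x => K - 2 * z * (root x / (1 + Ec x))) sqrt);
      [| apply continuous_sqrt].
    apply @continuous_minus; [apply continuous_const |].
    apply @continuous_mult; [apply continuous_const |].
    apply @continuous_mult; [exact Hcr |].
    apply (continuous_comp (fun x => 1 + Ec x) Rinv).
    + apply @continuous_plus; [apply continuous_const | exact HcE].
    + apply continuous_Rinv. rewrite Ec_0; lra.
  - unfold Wq. rewrite Hr0, Ec_0. f_equal. field.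
Qed.

(* With p1 = - (Wq + Pq) / 2 and p2 = (Pq - Wq) / 2 these expressions are 2 (p1 E + p2),
   whose sign is opposite to that of p2'. *)
Lemma p2_rate_increasing (K z x y : R) : 0 < K -> 0 < z -> 0 < x -> x < y -> y <= 1 ->
  0 < K - 2 * z * (root y / (1 + Ec y)) ->
  Pq K z x * (1 - Ec x) - Wq K z x * (1 + Ec x)
    < Pq K z y * (1 - Ec y) - Wq K z y * (1 + Ec y).
Proof.
  intros HK Hz Hx Hxy Hy HWy.
  assert (Hx1 : 0 < x <= 1) by lra. assert (Hy1 : 0 < y <= 1) by lra.
  pose proof (root_ratio_increasing x y Hx Hxy Hy) as Ht.
  pose proof (Ec_decreasing x y ltac:(lra) Hxy Hy) as He.
  pose proof (Ec_pos x); pose proof (Ec_pos y).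
  pose proof (Ec_lt_1 x Hx1); pose proof (Ec_lt_1 y Hy1).
  pose proof (root_increasing x y Hx Hxy Hy) as Hr.
  pose proof (root_pos x Hx1). pose proof (root_pos y Hy1).
  assert (HW : Wq K z y < Wq K z x).
  { apply sqrt_lt_1_alt; split; [lra | nra]. }
  pose proof (sqrt_lt_R0 _ HWy) as HWp; fold (Wq K z y) in HWp.
  (* Squaring removes the singular factor: (1 - E)^2 (1 + E) / root = root (1 - E), so both terms
     increase with the distance. *)
  assert (HP : forall u, 0 < u <= 1 ->
     (Pq K z u * (1 - Ec u)) ^ 2 = K * (1 - Ec u) ^ 2 + 2 * z * (root u * (1 - Ec u))).
  { intros u Hu. rewrite Rpow_mult_distr, Pq_sq by assumption.
    pose proof (root_pos u Hu). pose proof (root_sq u Hu) as Hs.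
    replace (root u * (1 - Ec u)) with (root u ^ 2 * (1 - Ec u) / root u) by (field; lra).
    rewrite Hs. field. lra. }
  assert (HPxy : Pq K z x * (1 - Ec x) < Pq K z y * (1 - Ec y)).
  { pose proof (Pq_pos K z x HK Hz Hx1). pose proof (Pq_pos K z y HK Hz Hy1).
    pose proof (HP x Hx1) as Hxx. pose proof (HP y Hy1) as Hyy.
    assert ((1 - Ec x) ^ 2 <= (1 - Ec y) ^ 2) by nra.
    assert (root x * (1 - Ec x) < root y * (1 - Ec y)).
    { apply Rmult_le_0_lt_compat; lra. }
    assert ((Pq K z x * (1 - Ec x)) ^ 2 < (Pq K z y * (1 - Ec y)) ^ 2) by nra.
    assert (0 < Pq K z y * (1 - Ec y)) by (apply Rmult_lt_0_compat; lra).
    assert (0 < Pq K z x * (1 - Ec x)) by (apply Rmult_lt_0_compat; lra).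
    nra. }
  assert (Wq K z y * (1 + Ec y) < Wq K z x * (1 + Ec x)).
  { apply Rmult_le_0_lt_compat; lra. }
  lra.
Qed.

(** As the distance tends to 0, 1 - E vanishes faster than P blows up, while W (1 + E) stays above
    [delta]. *)
Lemma p2_rate_negative_near_0 (K z q0 delta : R) :
  0 < K -> 0 < z -> 0 < delta -> 0 < q0 <= 1 ->
  K - 2 * z * (root q0 / (1 + Ec q0)) = delta ^ 2 ->
  exists d, 0 < d /\ forall x, 0 < x < d -> x <= q0 ->
    Pq K z x * (1 - Ec x) - Wq K z x * (1 + Ec x) < 0.
Proof.
  intros HK Hz Hd Hq0 Heq.
  assert (Hd2 : 0 < delta ^ 2) by (apply pow_lt; lra).
  (* By (1 - E)^2 <= x and root (1 - E) <= x, the square of P (1 - E) is at most (K + 2 z) x, which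
     is below delta^2 for x under this threshold. *)
  exists (delta ^ 2 / (K + 2 * z)). split; [apply Rdiv_lt_0_compat; lra |].
  intros x Hx Hxq.
  assert (Hx1 : 0 < x <= 1) by lra.
  destruct (Wq_ge K z x q0 delta) as [_ HW]; try lra.
  pose proof (Ec_pos x). pose proof (Ec_bounds x ltac:(lra)) as [_ Hb].
  pose proof (Ec_lt_1 x Hx1). pose proof (root_pos x Hx1).
  destruct (root_le x Hx1) as [_ Hr1].
  pose proof (Pq_pos K z x HK Hz Hx1).
  assert (HP : (Pq K z x * (1 - Ec x)) ^ 2
               = K * (1 - Ec x) ^ 2 + 2 * z * (root x * (1 - Ec x))).
  { rewrite Rpow_mult_distr, Pq_sq by assumption.
    pose proof (root_sq x Hx1) as Hs.
    replace (root x * (1 - Ec x)) with (root x ^ 2 * (1 - Ec x) / root x) by (field; lra).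
    rewrite Hs. field. lra. }
  assert ((K + 2 * z) * x < delta ^ 2).
  { rewrite Rmult_comm; apply Rlt_div_r; lra. }
  assert ((1 - Ec x) ^ 2 <= x) by nra.
  assert (root x * (1 - Ec x) <= x) by nra.
  assert ((Pq K z x * (1 - Ec x)) ^ 2 < delta ^ 2) by nra.
  assert (0 < Pq K z x * (1 - Ec x)) by (apply Rmult_lt_0_compat; lra).
  assert (Pq K z x * (1 - Ec x) < delta) by nra.
  nra.
Qed.

(** * Signs and monotonicity along the flow *)

Lemma flow_signs (K z q0 alpha T : R) (q1 q2 p1 p2 : R -> R) (t : R) :
  0 < K -> 0 < z -> peakon_flow K z q0 alpha T q1 q2 p1 p2 -> alpha < t < T ->
  let q := q2 t - q1 t in
  0 < q <= 1 /\ 0 < Ec q < 1 /\ Es q < 0 /\ p1 t < 0 /\ 0 < p2 t /\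
  0 < Pq K z q /\ 0 < Wq K z q /\
  p2 t - p1 t = Pq K z q /\ p1 t + p2 t = - Wq K z q /\
  peakon_ode q1 q2 p1 p2 t /\
  is_derive (fun s => q2 s - q1 s) t (- speed K z q) /\ 0 < speed K z q.
Proof.
  intros HK Hz [_ [_ [Hf _]]] Ht q.
  destruct (Hf t Ht) as [Hx [HW [HD [Hp [Hw Hode]]]]]. fold q in Hx, HW, HD, Hp, Hw.
  pose proof (Pq_pos K z q HK Hz Hx) as HP.
  pose proof (sqrt_lt_R0 _ HW) as HWp; fold (Wq K z q) in HWp.
  pose proof (Pq_Wq_sq K z q HK Hz Hx HW) as Hprod.
  pose proof (root_pos q Hx).
  assert (0 < z / root q) by (apply Rdiv_lt_0_compat; lra).
  pose proof (Es_bounds q ltac:(lra)). pose proof slope_pos.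
  pose proof (Ec_pos q). pose proof (Ec_lt_1 q Hx).
  assert (Wq K z q < Pq K z q).
  { apply (Rmult_lt_reg_r (Pq K z q + Wq K z q)); lra. }
  split; [exact Hx |]. split; [lra |]. split; [lra |]. split; [lra |].
  split; [lra |]. split; [exact HP |]. split; [exact HWp |].
  split; [exact Hp |]. split; [exact Hw |]. split; [exact Hode |].
  split; [exact HD |].
  unfold speed. pose proof (cosh_pos PI).
  apply Rmult_lt_0_compat; [apply pow_lt; lra |].
  apply Rmult_lt_0_compat; [apply Rmult_lt_0_compat; lra | apply pow_lt; lra].
Qed.

Lemma flow_ode (K z q0 alpha T : R) (q1 q2 p1 p2 : R -> R) (t : R) :
  peakon_flow K z q0 alpha T q1 q2 p1 p2 -> alpha < t < T ->
  peakon_ode q1 q2 p1 p2 t.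
Proof. intros [_ [_ [Hf _]]] Ht; apply (Hf t Ht). Qed.

(** The sign is asked only after [t0], so the derivative may vanish at [t0] itself; this covers the
    equality case of the criterion for [p2]. *)
Lemma increasing_on_derive (t0 T : R) (f g : R -> R) :
  (forall t, t0 <= t < T -> is_derive f t (g t)) ->
  (forall t, t0 < t < T -> 0 < g t) ->
  increasing_on (fun t => t0 <= t < T) f.
Proof.
  intros Hf Hg s t Hs Ht Hst.
  apply (is_derive_increasing f g s t Hst).
  - intros x Hx; apply Hf; lra.
  - intros x Hx; apply Hg; lra.
Qed.

Lemma decreasing_on_derive (T : R) (f g : R -> R) :
  (forall t, 0 <= t < T -> is_derive f t (g t)) ->
  (forall t, 0 < t < T -> g t < 0) -> decreasing_on (Ico T) f.
Proof.
  intros Hf Hg s t Hs Ht Hst.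
  enough (- f s < - f t) by lra.
  apply (increasing_on_derive 0 T (fun t => - f t) (fun t => - g t)); try assumption.
  - intros x Hx; apply @is_derive_opp, Hf, Hx.
  - intros x Hx; specialize (Hg x Hx); lra.
Qed.

Lemma flow_q_decreasing (K z q0 alpha T : R) (q1 q2 p1 p2 : R -> R) :
  0 < K -> 0 < z -> peakon_flow K z q0 alpha T q1 q2 p1 p2 ->
  decreasing_on (Ico T) (fun t => q2 t - q1 t).
Proof.
  intros HK Hz HF. assert (HT : alpha < 0) by apply HF.
  apply (decreasing_on_derive T _ (fun t => - speed K z (q2 t - q1 t))).
  - intros t Ht.
    destruct HF as [_ [_ [Hf _]]]; destruct (Hf t ltac:(lra)) as [_ [_ [HD _]]]; exact HD.
  - intros t Ht.
    destruct (flow_signs K z q0 alpha T q1 q2 p1 p2 t HK Hz HF ltac:(lra))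
      as [_ [_ [_ [_ [_ [_ [_ [_ [_ [_ [_ Hs]]]]]]]]]]]. lra.
Qed.

(** All three factors of p1' are negative: p1 p2, E'(q), and p1 + p2 E = w - p2 (1 - E). *)
Lemma flow_p1_decreasing (K z q0 alpha T : R) (q1 q2 p1 p2 : R -> R) :
  0 < K -> 0 < z -> peakon_flow K z q0 alpha T q1 q2 p1 p2 ->
  decreasing_on (Ico T) p1.
Proof.
  intros HK Hz HF. assert (HT : alpha < 0) by apply HF.
  pose proof (cosh_pos PI). assert (0 < cosh PI ^ 2) by (apply pow_lt; lra).
  eapply decreasing_on_derive.
  - intros t Ht.
    destruct (flow_ode K z q0 alpha T q1 q2 p1 p2 t HF ltac:(lra)) as [_ [_ [D1 D2]]].
    exact D1.
  - intros t Ht; cbv beta.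
    destruct (flow_signs K z q0 alpha T q1 q2 p1 p2 t HK Hz HF ltac:(lra))
      as [_ [He [Hs [H1 [H2 [HP [HW [Hp [Hw _]]]]]]]]].
    set (e := Ec (q2 t - q1 t)) in *. set (f := Es (q2 t - q1 t)) in *.
    assert (0 < p2 t * (1 - e)) by (apply Rmult_lt_0_compat; lra).
    assert (p1 t + p2 t * e < 0) by lra.
    apply Rmult_pos_neg; [assumption |]. apply Rmult_pos_neg; [| assumption].
    apply Rmult_neg_neg; [| assumption]. apply Rmult_neg_pos; assumption.
Qed.

(** The two momentum equations add up to w' = - cosh(pi)^2 p1 p2 E' p (1 - E), in which p1 p2 E' >
    0. *)
Lemma flow_w_decreasing (K z q0 alpha T : R) (q1 q2 p1 p2 : R -> R) :
  0 < K -> 0 < z -> peakon_flow K z q0 alpha T q1 q2 p1 p2 ->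
  decreasing_on (Ico T) (fun t => p1 t + p2 t).
Proof.
  intros HK Hz HF. assert (HT : alpha < 0) by apply HF.
  pose proof (cosh_pos PI). assert (0 < cosh PI ^ 2) by (apply pow_lt; lra).
  eapply decreasing_on_derive.
  - intros t Ht.
    destruct (flow_ode K z q0 alpha T q1 q2 p1 p2 t HF ltac:(lra)) as [_ [_ [D1 D2]]].
    exact (is_derive_plus _ _ _ _ _ D1 D2).
  - intros t Ht; cbv beta.
    destruct (flow_signs K z q0 alpha T q1 q2 p1 p2 t HK Hz HF ltac:(lra))
      as [_ [He [Hs [H1 [H2 [HP [HW [Hp [Hw _]]]]]]]]].
    unfold plus; simpl plus.
    set (e := Ec (q2 t - q1 t)) in *. set (f := Es (q2 t - q1 t)) in *.
    assert (p1 t * p2 t < 0) by (apply Rmult_neg_pos; assumption).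
    assert (0 < cosh PI ^ 2 * ((p1 t * p2 t * f) * ((p2 t - p1 t) * (1 - e)))).
    { apply Rmult_lt_0_compat; [assumption |].
      apply Rmult_lt_0_compat; [apply Rmult_neg_neg; assumption |].
      apply Rmult_lt_0_compat; lra. }
    match goal with |- ?X < 0 => replace X with
      (- (cosh PI ^ 2 * ((p1 t * p2 t * f) * ((p2 t - p1 t) * (1 - e))))) end.
    + lra.
    + simpl; ring.
Qed.

(** The distance decreases in time, and p1 E + p2 increases with the distance. Once nonpositive, it
    is negative at every later time. *)
Lemma flow_p2_increasing (K z q0 alpha T t0 : R) (q1 q2 p1 p2 : R -> R) :
  0 < K -> 0 < z -> peakon_flow K z q0 alpha T q1 q2 p1 p2 -> Ico T t0 ->
  p1 t0 * Ec (q2 t0 - q1 t0) + p2 t0 <= 0 ->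
  increasing_on (fun t => t0 <= t < T) p2.
Proof.
  intros HK Hz HF Ht0 HN. assert (HT : alpha < 0) by apply HF.
  pose proof (cosh_pos PI). assert (0 < cosh PI ^ 2) by (apply pow_lt; lra).
  unfold Ico in Ht0.
  eapply increasing_on_derive.
  - intros t Ht.
    destruct (flow_ode K z q0 alpha T q1 q2 p1 p2 t HF ltac:(lra)) as [_ [_ [D1 D2]]].
    exact D2.
  - intros t Ht; cbv beta.
    destruct (flow_signs K z q0 alpha T q1 q2 p1 p2 t HK Hz HF ltac:(lra))
      as [Hx [He [Hs [H1 [H2 [HP [HW [Hp [Hw _]]]]]]]]].
    destruct (flow_signs K z q0 alpha T q1 q2 p1 p2 t0 HK Hz HF ltac:(lra))
      as [Hx0 [_ [_ [_ [_ [_ [_ [Hp0 [Hw0 _]]]]]]]]].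
    pose proof (flow_q_decreasing K z q0 alpha T q1 q2 p1 p2 HK Hz HF t0 t
      ltac:(unfold Ico; lra) ltac:(unfold Ico; lra) ltac:(lra)) as Hqd. cbv beta in Hqd.
    assert (HN2 : p1 t * Ec (q2 t - q1 t) + p2 t < 0).
    { pose proof (p2_rate_increasing K z (q2 t - q1 t) (q2 t0 - q1 t0) HK Hz ltac:(lra) Hqd
        ltac:(lra)) as HNi.
      assert (Hval : forall s e P W, p2 s - p1 s = P -> p1 s + p2 s = - W ->
        P * (1 - e) - W * (1 + e) = 2 * (p1 s * e + p2 s)).
      { intros s e P W <- HWs. replace W with (- (p1 s + p2 s)) by lra. ring. }
      rewrite (Hval t _ _ _ Hp Hw), (Hval t0 _ _ _ Hp0 Hw0) in HNi.
      destruct HF as [_ [_ [Hf _]]].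
      destruct (Hf t0 ltac:(lra)) as [_ [HWp _]]. specialize (HNi HWp). lra. }
    set (e := Ec (q2 t - q1 t)) in *. set (f := Es (q2 t - q1 t)) in *.
    apply Ropp_0_gt_lt_contravar.
    apply Rmult_pos_neg; [assumption |]. apply Rmult_pos_neg; [| assumption].
    apply Rmult_neg_neg; [| assumption]. apply Rmult_neg_pos; assumption.
Qed.

Lemma is_derive_neg_not_increasing (T : R) (f : R -> R) (l : R) :
  0 < T -> is_derive f 0 l -> l < 0 -> ~ increasing_on (Ico T) f.
Proof.
  intros HT Hf Hl Hinc.
  apply is_derive_Reals in Hf.
  destruct (Hf (- l) ltac:(lra)) as [d Hd].
  set (h := Rmin (d / 2) (T / 2)).
  pose proof (cond_pos d).
  assert (h <= d / 2) by apply Rmin_l. assert (h <= T / 2) by apply Rmin_r.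
  assert (0 < h) by (apply Rmin_pos; lra).
  specialize (Hd h ltac:(lra) ltac:(apply Rabs_lt_between; lra)).
  rewrite Rplus_0_l in Hd. apply Rabs_lt_between in Hd.
  assert (Hh : (f h - f 0) / h < 0) by lra.
  specialize (Hinc 0 h ltac:(unfold Ico; lra) ltac:(unfold Ico; lra) ltac:(lra)).
  assert (0 < (f h - f 0) / h) by (apply Rdiv_lt_0_compat; lra). lra.
Qed.

(** If the quantity is positive at t = 0, then p2'(0) < 0 and [p2] decreases at first; otherwise
    [flow_p2_increasing] applies from time 0. *)
Lemma flow_p2_increasing_iff (K z q0 alpha T : R) (q1 q2 p1 p2 : R -> R) :
  0 < K -> 0 < z -> peakon_flow K z q0 alpha T q1 q2 p1 p2 ->
  (increasing_on (Ico T) p2 <-> p1 0 * Ec q0 + p2 0 <= 0).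
Proof.
  intros HK Hz HF. assert (HT : alpha < 0 < T) by apply HF.
  assert (Hq0 : q2 0 - q1 0 = q0) by apply HF.
  split.
  - intros Hinc. destruct (Rle_dec (p1 0 * Ec q0 + p2 0) 0); [assumption | exfalso].
    destruct (flow_signs K z q0 alpha T q1 q2 p1 p2 0 HK Hz HF ltac:(lra))
      as [Hx [He [Hs [H1 [H2 [HP [HW [Hp [Hw [[_ [_ [_ Hd]]] _]]]]]]]]]].
    apply (is_derive_neg_not_increasing T p2 _ ltac:(lra) Hd); [| exact Hinc].
    rewrite Hq0 in *.
    pose proof (cosh_pos PI). assert (0 < cosh PI ^ 2) by (apply pow_lt; lra).
    apply Ropp_lt_gt_0_contravar.
    apply Rmult_lt_0_compat; [assumption |]. apply Rmult_neg_neg; [| assumption].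
    apply Rmult_neg_pos; [apply Rmult_neg_pos; assumption | lra].
  - intros HN. rewrite <- Hq0 in HN.
    apply (flow_p2_increasing K z q0 alpha T 0 q1 q2 p1 p2 HK Hz HF); [| exact HN].
    unfold Ico; lra.
Qed.

(** The distance tends to 0, so it enters the range of [p2_rate_negative_near_0] before [T]. *)
Lemma flow_p2_eventually_increasing (K z q0 delta alpha T : R) (q1 q2 p1 p2 : R -> R) :
  0 < K -> 0 < z -> 0 < delta -> 0 < q0 <= 1 ->
  K - 2 * z * (root q0 / (1 + Ec q0)) = delta ^ 2 ->
  peakon_flow K z q0 alpha T q1 q2 p1 p2 ->
  exists t0, Ico T t0 /\ increasing_on (fun t => t0 <= t < T) p2.
Proof.
  intros HK Hz Hd Hq0 Heq HF. assert (HT : alpha < 0 < T) by apply HF.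
  destruct (p2_rate_negative_near_0 K z q0 delta HK Hz Hd Hq0 Heq) as [d [Hd0 HN]].
  assert (Hlim : filterlim (fun t => q2 t - q1 t) (at_left T) (locally 0)) by apply HF.
  pose proof (proj1 (filterlim_locally _ _) Hlim (mkposreal d Hd0)) as Hs.
  assert (HT0 : at_left T (fun t => 0 < t < T)).
  { exists (mkposreal T (proj2 HT)). intros y Hy HyT.
    change (Rabs (y - T) < T) in Hy; apply Rabs_lt_between in Hy. lra. }
  destruct (filter_ex _ (filter_and _ _ Hs HT0)) as [t0 [Hb Ht0]].
  change (Rabs (q2 t0 - q1 t0 - 0) < d) in Hb.
  destruct (flow_signs K z q0 alpha T q1 q2 p1 p2 t0 HK Hz HF ltac:(lra))
      as [Hx [He [_ [_ [_ [_ [_ [Hp [Hw _]]]]]]]]].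
  rewrite Rminus_0_r, Rabs_right in Hb by lra.
  exists t0; split; [unfold Ico; lra |].
  apply (flow_p2_increasing K z q0 alpha T t0 q1 q2 p1 p2 HK Hz HF).
  { unfold Ico; lra. }
  specialize (HN (q2 t0 - q1 t0) ltac:(lra)).
  assert (Hle : q2 t0 - q1 t0 <= q0) by (apply HF; lra).
  specialize (HN Hle). rewrite <- Hp in HN.
  replace (Wq K z (q2 t0 - q1 t0)) with (- (p1 t0 + p2 t0)) in HN by lra. lra.
Qed.

(** * Uniqueness and lifespan *)

(** [E] and [E'] are known to agree with [Ec] and [Es] while the separation lies in (0, 2 pi), and a
    competing solution is not yet known to stay there. The smooth system is therefore conditional,
    whereas continuity is available at once. *)
Lemma ivp_ext (a b delta S : R) (r1 r2 m1 m2 : R -> R) :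
  peakon_ivp a b delta S r1 r2 m1 m2 ->
  exists R1 R2 M1 M2 : R -> R,
    (forall t, 0 <= t -> R1 t = r1 t /\ R2 t = r2 t /\ M1 t = m1 t /\ M2 t = m2 t) /\
    forall t, Ico S t ->
      (0 < R2 t - R1 t < 2 * PI -> peakon_ode R1 R2 M1 M2 t) /\
      continuous R1 t /\ continuous R2 t /\ continuous M1 t.
Proof.
  intros [_ Hd]. cbv zeta in Hd.
  set (g1 := fun t => (cosh PI)^2 * (m1 t + m2 t * E (r2 t - r1 t))^2).
  set (g2 := fun t => (cosh PI)^2 * (m1 t * E (r2 t - r1 t) + m2 t)^2).
  set (g3 := fun t => (cosh PI)^2 *
    (m1 t * m2 t * (m1 t + m2 t * E (r2 t - r1 t)) * E' (r2 t - r1 t))).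
  set (g4 := fun t => - ((cosh PI)^2 *
    (m1 t * m2 t * (m1 t * E (r2 t - r1 t) + m2 t) * E' (r2 t - r1 t)))).
  assert (D1 : forall t, Ico S t -> is_derive (tangent_ext (g1 0) r1) t (g1 t)).
  { apply is_derive_tangent_ext; intros t Ht; apply (Hd t Ht). }
  assert (D2 : forall t, Ico S t -> is_derive (tangent_ext (g2 0) r2) t (g2 t)).
  { apply is_derive_tangent_ext; intros t Ht; apply (Hd t Ht). }
  assert (D3 : forall t, Ico S t -> is_derive (tangent_ext (g3 0) m1) t (g3 t)).
  { apply is_derive_tangent_ext; intros t Ht; apply (Hd t Ht). }
  assert (D4 : forall t, Ico S t -> is_derive (tangent_ext (g4 0) m2) t (g4 t)).
  { apply is_derive_tangent_ext; intros t Ht; apply (Hd t Ht). }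
  exists (tangent_ext (g1 0) r1), (tangent_ext (g2 0) r2),
    (tangent_ext (g3 0) m1), (tangent_ext (g4 0) m2).
  split.
  { intros t Ht; rewrite !tangent_ext_ge0 by exact Ht; repeat split. }
  intros t Ht.
  split; [| split; [| split]].
  - rewrite !(tangent_ext_ge0 _ _ t) by apply Ht. intros Hr.
    specialize (D1 t Ht). specialize (D2 t Ht). specialize (D3 t Ht). specialize (D4 t Ht).
    unfold peakon_ode; rewrite !(tangent_ext_ge0 _ _ t) by apply Ht.
    rewrite <- E_Ec, <- E'_Es by lra.
    split; [exact D1 |]. split; [exact D2 |]. split; [exact D3 | exact D4].
  - exact (is_derive_cont _ _ _ (D1 t Ht)).
  - exact (is_derive_cont _ _ _ (D2 t Ht)).
  - exact (is_derive_cont _ _ _ (D3 t Ht)).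
Qed.

Lemma continuous_agree (f g : R -> R) (t : R) :
  0 < t -> continuous f t -> continuous g t ->
  (forall s, 0 <= s < t -> f s = g s) -> f t = g t.
Proof.
  intros Ht Hf Hg Hfg.
  assert (Hl : forall h : R -> R, continuous h t -> filterlim h (at_left t) (locally (h t))).
  { intros h Hh. eapply filterlim_filter_le_1; [| exact Hh]. apply filter_le_within. }
  apply (filterlim_locally_unique (F := at_left t) f).
  - apply Hl, Hf.
  - apply (filterlim_ext_loc g); [| apply Hl, Hg].
    exists (mkposreal t Ht); intros y Hy HyT.
    change (Rabs (y - t) < t) in Hy; apply Rabs_lt_between in Hy.
    symmetry; apply Hfg; lra.
Qed.

(** The polynomial state sees the positions only through their separation. Its uniqueness gives
    equal momenta and equal velocities; the positions agree because their derivatives and initial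
    values do. *)
Lemma peakon_ode_unique (t1 : R) (q1 q2 p1 p2 r1 r2 m1 m2 : R -> R) :
  0 <= t1 ->
  (forall t, 0 <= t <= t1 -> peakon_ode q1 q2 p1 p2 t) ->
  (forall t, 0 <= t <= t1 -> peakon_ode r1 r2 m1 m2 t) ->
  q1 0 = r1 0 -> q2 0 = r2 0 -> p1 0 = m1 0 -> p2 0 = m2 0 ->
  q1 t1 = r1 t1 /\ q2 t1 = r2 t1 /\ p1 t1 = m1 t1 /\ p2 t1 = m2 t1.
Proof.
  intros Ht1 Hq Hr H1 H2 H3 H4.
  assert (HU : forall t, 0 <= t <= t1 -> forall i,
    peakon_state q1 q2 p1 p2 i t = peakon_state r1 r2 m1 m2 i t).
  { apply (psolves_unique peakon_field); [exact Ht1 | | |].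
    - intros t Ht; apply peakon_ode_psolves, Hq, Ht.
    - intros t Ht; apply peakon_ode_psolves, Hr, Ht.
    - intros [| | |]; simpl; rewrite ?H1, ?H2; trivial. }
  assert (Hconst : forall f g l k : R -> R, f 0 = g 0 ->
    (forall t, 0 <= t <= t1 -> is_derive f t (l t)) ->
    (forall t, 0 <= t <= t1 -> is_derive g t (k t)) ->
    (forall t, 0 <= t <= t1 -> l t = k t) -> f t1 = g t1).
  { intros f g l k H0 Hf Hg Hlk.
    assert (f t1 - g t1 <= f 0 - g 0).
    { apply (is_derive_nonincreasing (fun t => f t - g t) (fun t => l t - k t)); [lra | |].
      - intros t Ht; exact (is_derive_minus _ _ _ _ _ (Hf t Ht) (Hg t Ht)).
      - intros t Ht; rewrite Hlk by exact Ht; lra. }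
    assert (g t1 - f t1 <= g 0 - f 0).
    { apply (is_derive_nonincreasing (fun t => g t - f t) (fun t => k t - l t)); [lra | |].
      - intros t Ht; exact (is_derive_minus _ _ _ _ _ (Hg t Ht) (Hf t Ht)).
      - intros t Ht; rewrite Hlk by exact Ht; lra. }
    lra. }
  split; [| split; [| split]].
  - apply (Hconst q1 r1 _ _ H1 (fun t Ht => proj1 (Hq t Ht)) (fun t Ht => proj1 (Hr t Ht))).
    intros t Ht. pose proof (HU t Ht X1) as E1. pose proof (HU t Ht X2) as E2.
    pose proof (HU t Ht X3) as E3. simpl in *. rewrite E1, E2, E3. reflexivity.
  - apply (Hconst q2 r2 _ _ H2 (fun t Ht => proj1 (proj2 (Hq t Ht)))
            (fun t Ht => proj1 (proj2 (Hr t Ht)))).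
    intros t Ht. pose proof (HU t Ht X1) as E1. pose proof (HU t Ht X2) as E2.
    pose proof (HU t Ht X3) as E3. simpl in *. rewrite E1, E2, E3. reflexivity.
  - exact (HU t1 ltac:(lra) X1).
  - exact (HU t1 ltac:(lra) X2).
Qed.

(** As long as the competitor stays in the region [A] it equals the constructed flow, whose
    separation lies in (0, 1], well inside [A]. Continuity carries this to the next time, and
    openness of [A] beyond it. *)
Lemma flow_unique (K z a b delta q0 alpha T S : R) (q1 q2 p1 p2 r1 r2 m1 m2 : R -> R) :
  0 < K -> 0 < z -> peakon_flow K z q0 alpha T q1 q2 p1 p2 ->
  q1 0 = - a -> q2 0 = a -> p1 0 = - (b + delta) -> p2 0 = b ->
  filterlim p1 (at_left T) (Rbar_locally m_infty) ->
  0 < S -> peakon_ivp a b delta S r1 r2 m1 m2 ->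
  S <= T /\ forall t, Ico S t ->
    r1 t = q1 t /\ r2 t = q2 t /\ m1 t = p1 t /\ m2 t = p2 t.
Proof.
  intros HK Hz HF I1 I2 I3 I4 Hlim HS Hivp.
  assert (HT : alpha < 0 < T) by apply HF.
  destruct (ivp_ext _ _ _ _ _ _ _ _ Hivp) as [R1 [R2 [M1 [M2 [Hext HR]]]]].
  destruct Hivp as [[J1 [J2 [J3 J4]]] _].
  destruct (Hext 0 (Rle_refl 0)) as [X10 [X20 [X30 X40]]].
  assert (Hq : forall t, 0 <= t < T -> 0 < q2 t - q1 t <= 1 /\ peakon_ode q1 q2 p1 p2 t).
  { intros t Ht.
    destruct (flow_signs K z q0 alpha T q1 q2 p1 p2 t HK Hz HF ltac:(lra))
      as [Hx [_ [_ [_ [_ [_ [_ [_ [_ [Ho _]]]]]]]]]]. split; assumption. }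
  pose proof PI_gt_3.
  set (A := fun s => 0 < R2 s - R1 s < 2 * PI).
  assert (Hagree : forall t, 0 <= t -> t < S -> t < T -> (forall s, 0 <= s <= t -> A s) ->
    q1 t = R1 t /\ q2 t = R2 t /\ p1 t = M1 t /\ p2 t = M2 t).
  { intros t Ht HtS HtT HA. apply peakon_ode_unique; try congruence; trivial.
    - intros s Hs; apply Hq; lra.
    - intros s Hs; apply HR; [unfold Ico; lra | apply HA, Hs]. }
  assert (HA : forall t0, 0 <= t0 -> t0 < S -> t0 < T -> forall t, 0 <= t <= t0 -> A t).
  { intros t0 Ht0 HtS HtT. apply real_induction; [exact Ht0 | |].
    - intros t Ht Hlt.
      enough (E : R1 t = q1 t /\ R2 t = q2 t).
      { destruct E as [E1 E2]. unfold A. rewrite E1, E2.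
        destruct (Hq t ltac:(lra)) as [Hx _]. lra. }
      destruct (Req_dec t 0) as [-> | Hne]; [split; congruence |].
      destruct (Hq t ltac:(lra)) as [_ [D1 [D2 _]]].
      destruct (HR t ltac:(unfold Ico; lra)) as [_ [C1 [C2 _]]].
      split; apply continuous_agree; try lra; try assumption.
      + exact (is_derive_cont _ _ _ D1).
      + intros s Hs. symmetry. apply Hagree; try lra. intros; apply Hlt; lra.
      + exact (is_derive_cont _ _ _ D2).
      + intros s Hs. symmetry. apply Hagree; try lra. intros; apply Hlt; lra.
    - intros t Ht HAt.
      destruct (HR t ltac:(unfold Ico; lra)) as [_ [C1 [C2 _]]].
      assert (C : continuous (fun s => R2 s - R1 s) t) by exact (continuous_minus _ _ _ C2 C1).
      apply (C (fun y => 0 < y < 2 * PI)).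
      apply (open_and (fun y => 0 < y) (fun y => y < 2 * PI)); [apply open_gt | apply open_lt | exact HAt]. }
  assert (HE : forall t, 0 <= t -> t < S -> t < T ->
    r1 t = q1 t /\ r2 t = q2 t /\ m1 t = p1 t /\ m2 t = p2 t).
  { intros t Ht HtS HtT.
    destruct (Hagree t Ht HtS HtT (HA t Ht HtS HtT)) as [A1 [A2 [A3 A4]]].
    destruct (Hext t Ht) as [B1 [B2 [B3 B4]]].
    repeat split; congruence. }
  assert (HST : S <= T).
  (* If [T < S], then [M1] is continuous at [T], yet coincides before [T] with [p1], which tends to
     minus infinity. *)
  { destruct (Rle_dec S T); [assumption | exfalso].
    destruct (HR T ltac:(unfold Ico; lra)) as [_ [_ [_ C]]].
    assert (CL : filterlim M1 (at_left T) (locally (M1 T))).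
    { eapply filterlim_filter_le_1; [| exact C]. apply filter_le_within. }
    pose proof (proj1 (filterlim_locally _ _) CL (mkposreal 1 Rlt_0_1)) as HC.
    assert (HL : at_left T (fun t => p1 t < M1 T - 1)).
    { apply (Hlim (fun y => y < M1 T - 1)). exists (M1 T - 1). intros; assumption. }
    assert (HT0 : at_left T (fun t => 0 < t < T)).
    { exists (mkposreal T (proj2 HT)). intros y Hy HyT.
      change (Rabs (y - T) < T) in Hy; apply Rabs_lt_between in Hy. lra. }
    destruct (filter_ex _ (filter_and _ _ HT0 (filter_and _ _ HC HL))) as [t [Ht [Hb Hlt]]].
    change (Rabs (M1 t - M1 T) < 1) in Hb. apply Rabs_lt_between in Hb.
    destruct (HE t ltac:(lra) ltac:(lra) ltac:(lra)) as [_ [_ [E3 _]]].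
    destruct (Hext t ltac:(lra)) as [_ [_ [E3' _]]]. lra. }
  split; [exact HST |].
  intros t Ht; unfold Ico in Ht; apply HE; lra.
Qed.

(** * Integration of periodic functions *)

Lemma wrap_periodic : periodic wrap.
Proof.
  intros x; pose proof PI_gt_3.
  destruct (base_Int_part (x / (2 * PI))) as [H1 H2].
  set (k := Int_part (x / (2 * PI))) in *.
  assert (Hx : x / (2 * PI) * (2 * PI) = x) by (field; lra).
  rewrite (wrap_eq x k) by nra.
  rewrite (wrap_eq (x + 2 * PI) (k + 1)); rewrite plus_IZR; [ring | nra].
Qed.

Lemma periodic_minus (f : R -> R) : periodic f -> forall x, f (x - 2 * PI) = f x.
Proof. intros Hf x; rewrite <- (Hf (x - 2 * PI)); f_equal; ring. Qed.

Lemma is_RInt_translate (f : R -> R) (a b v l : R) :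
  is_RInt f a b l -> is_RInt (fun y => f (y + v)) (a - v) (b - v) l.
Proof.
  intros H.
  apply (is_RInt_ext (fun y => scal 1 (f (1 * y + v)))).
  { intros x _; unfold scal; simpl; unfold mult; simpl.
    rewrite !Rmult_1_l; reflexivity. }
  apply (is_RInt_comp_lin f 1 v (a - v) (b - v)).
  replace (1 * (a - v) + v) with a by ring. replace (1 * (b - v) + v) with b by ring.
  exact H.
Qed.

(** Integrability is known over one period only and [f] may be discontinuous, so translations spread
    it to all intervals. Chasles' relation then leaves two equal pieces that cancel. *)
Lemma periodic_is_RInt (f : R -> R) (c d l : R) :
  periodic f -> is_RInt f c (c + 2 * PI) l -> is_RInt f d (d + 2 * PI) l.
Proof.
  intros Hp Hl; pose proof PI_gt_3.
  assert (Hup : forall a b k, is_RInt f a b k -> is_RInt f (a + 2 * PI) (b + 2 * PI) k).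
  { intros a b k H0.
    apply (is_RInt_ext (fun y => f (y + - (2 * PI)))).
    { intros x _. apply (periodic_minus f Hp). }
    replace (a + 2 * PI) with (a - - (2 * PI)) by ring.
    replace (b + 2 * PI) with (b - - (2 * PI)) by ring.
    apply is_RInt_translate, H0. }
  assert (Hdn : forall a b k, is_RInt f a b k -> is_RInt f (a - 2 * PI) (b - 2 * PI) k).
  { intros a b k H0.
    apply (is_RInt_ext (fun y => f (y + 2 * PI))).
    { intros x _. apply Hp. }
    apply is_RInt_translate, H0. }
  assert (Hex : forall n : nat, ex_RInt f (c - 2 * PI * INR n) (c + 2 * PI * INR n)).
  { assert (Hr : forall n : nat, ex_RInt f (c + 2 * PI * INR n) (c + 2 * PI * INR n + 2 * PI)).
    { induction n as [| n [k IH]].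
      - exists l. simpl INR. rewrite Rmult_0_r, Rplus_0_r. exact Hl.
      - exists k. rewrite S_INR. specialize (Hup _ _ _ IH).
        replace (c + 2 * PI * (INR n + 1)) with (c + 2 * PI * INR n + 2 * PI) by ring.
        exact Hup. }
    assert (Hs : forall n : nat, ex_RInt f (c - 2 * PI * INR n) (c - 2 * PI * INR n + 2 * PI)).
    { induction n as [| n [k IH]].
      - exists l. simpl INR. rewrite Rmult_0_r, Rminus_0_r. exact Hl.
      - exists k. rewrite S_INR. specialize (Hdn _ _ _ IH).
        replace (c - 2 * PI * (INR n + 1)) with (c - 2 * PI * INR n - 2 * PI) by ring.
        replace (c - 2 * PI * INR n - 2 * PI + 2 * PI)
          with (c - 2 * PI * INR n + 2 * PI - 2 * PI) by ring.
        exact Hdn. }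
    induction n as [| n IH].
    - simpl INR. rewrite Rmult_0_r, Rminus_0_r, Rplus_0_r. apply ex_RInt_point.
    - rewrite S_INR.
      apply ex_RInt_Chasles with (c - 2 * PI * INR n);
        [| apply ex_RInt_Chasles with (c + 2 * PI * INR n); [exact IH |]].
      + specialize (Hs (S n)). rewrite S_INR in Hs.
        replace (c - 2 * PI * INR n) with (c - 2 * PI * (INR n + 1) + 2 * PI) by ring.
        exact Hs.
      + replace (c + 2 * PI * (INR n + 1)) with (c + 2 * PI * INR n + 2 * PI) by ring.
        apply Hr. }
  assert (Hany : forall a b, a <= b -> ex_RInt f a b).
  { intros a b Hab.
    (* Since 1 <= 2 pi, [n + 1] periods on either side of [c] cover both [a] and [b]. *)
    destruct (nfloor_ex (Rabs (a - c) + Rabs (b - c))) as [n [_ Hn]].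
    { pose proof (Rabs_pos (a - c)). pose proof (Rabs_pos (b - c)). lra. }
    specialize (Hex (S n)). rewrite S_INR in Hex.
    pose proof (Rabs_pos (a - c)). pose proof (Rabs_pos (b - c)).
    pose proof (Rle_abs (b - c)). pose proof (Rabs_maj2 (a - c)).
    pose proof (pos_INR n).
    assert (INR n + 1 <= 2 * PI * (INR n + 1)) by nra.
    apply (ex_RInt_Chasles_1 f a b (c + 2 * PI * (INR n + 1))); [lra |].
    apply (ex_RInt_Chasles_2 f (c - 2 * PI * (INR n + 1))); [lra | exact Hex]. }
  assert (Hany' : forall a b, ex_RInt f a b).
  { intros a b; destruct (Rle_dec a b); [apply Hany; lra |].
    apply ex_RInt_swap, Hany; lra. }
  assert (E : RInt f d (d + 2 * PI) = l).
  { rewrite <- (RInt_Chasles f d c) by apply Hany'.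
    rewrite <- (RInt_Chasles f c (c + 2 * PI) (d + 2 * PI)) by apply Hany'.
    rewrite (is_RInt_unique _ _ _ _ Hl).
    assert (E1 : RInt f (c + 2 * PI) (d + 2 * PI) = RInt f c d).
    { apply is_RInt_unique, Hup, (@RInt_correct R_CompleteNormedModule), Hany'. }
    rewrite E1, <- (opp_RInt_swap f c d) by apply Hany'.
    unfold plus, opp; simpl; ring. }
  rewrite <- E. apply (@RInt_correct R_CompleteNormedModule), Hany'.
Qed.

(** Nothing is asked at the peaks themselves, where the slope of the peakon jumps. Starting the
    period at a peak leaves two pieces instead of three. *)
Lemma piecewise_is_RInt (f f1 f2 : R -> R) (x0 m I1 I2 : R) :
  periodic f -> x0 < m < x0 + 2 * PI ->
  (forall x, x0 < x < m -> f x = f1 x) ->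
  (forall x, m < x < x0 + 2 * PI -> f x = f2 x) ->
  is_RInt f1 x0 m I1 -> is_RInt f2 m (x0 + 2 * PI) I2 ->
  is_RInt f 0 (2 * PI) (I1 + I2).
Proof.
  intros Hp Hm H1 H2 HI1 HI2.
  replace (2 * PI) with (0 + 2 * PI) by ring.
  apply (periodic_is_RInt f x0); [exact Hp |].
  apply (is_RInt_Chasles f x0 m).
  - apply (is_RInt_ext f1); [| exact HI1].
    rewrite Rmin_left, Rmax_right by lra. intros x Hx; symmetry; apply H1, Hx.
  - apply (is_RInt_ext f2); [| exact HI2].
    rewrite Rmin_left, Rmax_right by lra. intros x Hx; symmetry; apply H2, Hx.
Qed.

(** Up to the factor 2 sinh(pi) this is the Green function of 1 - d^2/dx^2 on the circle. [gker'] is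
    its derivative off the multiples of 2 pi, and at those the derivative from the right. *)
Definition gker (x : R) : R := cosh (wrap x - PI).
Definition gker' (x : R) : R := sinh (wrap x - PI).

Lemma wrap_left (x c : R) : c - 2 * PI <= x < c -> wrap (x - c) = x - c + 2 * PI.
Proof. intros Hx; rewrite (wrap_eq (x - c) (-1)); lra. Qed.

Lemma wrap_right (x c : R) : c <= x < c + 2 * PI -> wrap (x - c) = x - c.
Proof. intros Hx; rewrite wrap_id; lra. Qed.

Lemma gker_left (x c : R) : c - 2 * PI <= x < c -> gker (x - c) = cosh (x - c + PI).
Proof. intros Hx; unfold gker; rewrite wrap_left by exact Hx; f_equal; ring. Qed.

Lemma gker_right (x c : R) : c <= x < c + 2 * PI -> gker (x - c) = cosh (x - c - PI).
Proof. intros Hx; unfold gker; rewrite wrap_right by exact Hx; reflexivity. Qed.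

Lemma gker'_left (x c : R) : c - 2 * PI <= x < c -> gker' (x - c) = sinh (x - c + PI).
Proof. intros Hx; unfold gker'; rewrite wrap_left by exact Hx; f_equal; ring. Qed.

Lemma gker'_right (x c : R) : c <= x < c + 2 * PI -> gker' (x - c) = sinh (x - c - PI).
Proof. intros Hx; unfold gker'; rewrite wrap_right by exact Hx; reflexivity. Qed.

Lemma periodic_shift (f : R -> R) (c : R) : periodic f -> periodic (fun x => f (x - c)).
Proof.
  intros Hf x; replace (x + 2 * PI - c) with (x - c + 2 * PI) by ring; apply Hf.
Qed.

Lemma gker_periodic : periodic gker.
Proof. intros x; unfold gker; rewrite wrap_periodic; reflexivity. Qed.

Lemma gker'_periodic : periodic gker'.
Proof. intros x; unfold gker'; rewrite wrap_periodic; reflexivity. Qed.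

Lemma continuous_cosh_comp (f : R -> R) (x : R) :
  continuous f x -> continuous (fun y => cosh (f y)) x.
Proof.
  intros H; apply (continuous_comp f cosh); [exact H |].
  exact (is_derive_cont _ _ _ (is_derive_cosh (f x))).
Qed.

Lemma continuous_sinh_comp (f : R -> R) (x : R) :
  continuous f x -> continuous (fun y => sinh (f y)) x.
Proof.
  intros H; apply (continuous_comp f sinh); [exact H |].
  exact (is_derive_cont _ _ _ (is_derive_sinh (f x))).
Qed.

Lemma continuous_ex_RInt (f : R -> R) (a b : R) :
  (forall x, continuous f x) -> ex_RInt f a b.
Proof. intros H; apply (@ex_RInt_continuous R_CompleteNormedModule); intros; apply H. Qed.

Lemma continuous_is_RInt (f : R -> R) (a b : R) :
  (forall x, continuous f x) -> is_RInt f a b (RInt f a b).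
Proof.
  intros H; apply (@RInt_correct R_CompleteNormedModule), continuous_ex_RInt, H.
Qed.

(** Translation moves the peak out of the kernel and into [chi]; with c = q_i(t) the kernel on the
    right no longer depends on time. *)
Lemma gker_is_RInt (chi : R -> R) (c : R) :
  periodic chi -> (forall x, continuous chi x) ->
  is_RInt (fun x => gker (x - c) * chi x) 0 (2 * PI)
    (RInt (fun y => cosh (y - PI) * chi (y + c)) 0 (2 * PI)).
Proof.
  intros Hp Hc; pose proof PI_gt_3.
  replace (2 * PI) with (0 + 2 * PI) at 1 by ring.
  apply (periodic_is_RInt _ c).
  { intros x. rewrite Hp. f_equal. apply (periodic_shift gker c gker_periodic). }
  apply (is_RInt_ext (fun x => cosh (x + - c - PI) * chi (x + - c + c))).
  { rewrite Rmin_left, Rmax_right by lra. intros x Hx.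
    rewrite gker_right by lra. f_equal; f_equal; ring. }
  assert (H0 : is_RInt (fun y => cosh (y - PI) * chi (y + c)) 0 (2 * PI)
    (RInt (fun y => cosh (y - PI) * chi (y + c)) 0 (2 * PI))).
  { apply continuous_is_RInt. intros x.
    apply @continuous_mult.
    - apply continuous_cosh_comp. apply @continuous_minus; [apply continuous_id | apply continuous_const].
    - apply (continuous_comp (fun y => y + c) chi); [| apply Hc].
      apply @continuous_plus; [apply continuous_id | apply continuous_const]. }
  apply (is_RInt_translate _ _ _ (- c)) in H0.
  replace (0 - - c) with c in H0 by ring.
  replace (2 * PI - - c) with (c + 2 * PI) in H0 by ring.
  exact H0.
Qed.

(** * The nonlocal terms *)

(** Convolution over a part of the circle. The shift is [k = PI] where [y] lies to the left of [x]
    and [k = - PI] where it lies to the right: the two branches of [gker (x - y)]. *)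
Definition conv_c (k : R) (f : R -> R) (a b x : R) : R :=
  RInt (fun y => cosh (x - y - k) * f y) a b.
Definition conv_s (k : R) (f : R -> R) (a b x : R) : R :=
  RInt (fun y => sinh (x - y - k) * f y) a b.

Lemma cosh_minus (x y : R) : cosh (x - y) = cosh x * cosh y - sinh x * sinh y.
Proof.
  unfold cosh, sinh.
  replace (- (x - y)) with (- x + y) by ring. unfold Rminus.
  rewrite !exp_plus. field.
Qed.

Lemma sinh_minus (x y : R) : sinh (x - y) = sinh x * cosh y - cosh x * sinh y.
Proof.
  unfold cosh, sinh.
  replace (- (x - y)) with (- x + y) by ring. unfold Rminus.
  rewrite !exp_plus. field.
Qed.

Lemma continuous_cosh (x : R) : continuous cosh x.
Proof. exact (is_derive_cont _ _ _ (is_derive_cosh x)). Qed.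

Lemma continuous_sinh (x : R) : continuous sinh x.
Proof. exact (is_derive_cont _ _ _ (is_derive_sinh x)). Qed.

Lemma continuous_Rmult (f g : R -> R) (x : R) :
  continuous f x -> continuous g x -> continuous (fun y => f y * g y) x.
Proof. intros Hf Hg; exact (continuous_mult f g x Hf Hg). Qed.

Lemma is_RInt_lin2 (f g : R -> R) (p q a b I J : R) :
  is_RInt f a b I -> is_RInt g a b J ->
  is_RInt (fun y => p * f y - q * g y) a b (p * I - q * J).
Proof.
  intros Hf Hg.
  exact (is_RInt_minus _ _ _ _ _ _ (is_RInt_scal _ _ _ p _ Hf) (is_RInt_scal _ _ _ q _ Hg)).
Qed.

(** The addition formulas separate [x] from [y], so derivatives in [x], also with moving end points,
    reduce to the fundamental theorem of calculus. *)
Lemma conv_expand (k : R) (f : R -> R) (a b x : R) : (forall y, continuous f y) ->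
  conv_c k f a b x = cosh (x - k) * RInt (fun y => cosh y * f y) a b
                     - sinh (x - k) * RInt (fun y => sinh y * f y) a b /\
  conv_s k f a b x = sinh (x - k) * RInt (fun y => cosh y * f y) a b
                     - cosh (x - k) * RInt (fun y => sinh y * f y) a b.
Proof.
  intros Hf.
  assert (Hc : is_RInt (fun y => cosh y * f y) a b (RInt (fun y => cosh y * f y) a b)).
  { apply continuous_is_RInt; intros y. apply continuous_Rmult; [apply continuous_cosh | apply Hf]. }
  assert (Hs : is_RInt (fun y => sinh y * f y) a b (RInt (fun y => sinh y * f y) a b)).
  { apply continuous_is_RInt; intros y. apply continuous_Rmult; [apply continuous_sinh | apply Hf]. }
  split; apply is_RInt_unique.
  - eapply is_RInt_ext; [| exact (is_RInt_lin2 _ _ (cosh (x - k)) (sinh (x - k)) _ _ _ _ Hc Hs)].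
    intros y _; simpl. replace (x - y - k) with (x - k - y) by ring. rewrite (cosh_minus (x - k) y). ring.
  - eapply is_RInt_ext; [| exact (is_RInt_lin2 _ _ (sinh (x - k)) (cosh (x - k)) _ _ _ _ Hc Hs)].
    intros y _; simpl. replace (x - y - k) with (x - k - y) by ring. rewrite (sinh_minus (x - k) y). ring.
Qed.

Lemma is_derive_hyp_comb (k x C S c s : R) (fc fs : R -> R) :
  is_derive fc x c -> is_derive fs x s -> fc x = C -> fs x = S ->
  is_derive (fun y => cosh (y - k) * fc y - sinh (y - k) * fs y) x
    ((sinh (x - k) * C - cosh (x - k) * S) + (cosh (x - k) * c - sinh (x - k) * s)).
Proof.
  intros Hc Hs <- <-.
  assert (Hk : is_derive (fun y => y - k) x 1) by (auto_derive; [exact I | ring]).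
  evar_last.
  - apply @is_derive_minus; apply @is_derive_mult.
    + apply is_derive_cosh_comp, Hk.
    + exact Hc.
    + intros; apply Rmult_comm.
    + apply is_derive_sinh_comp, Hk.
    + exact Hs.
    + intros; apply Rmult_comm.
  - unfold minus, plus, opp, mult; simpl. unfold mult; simpl. ring.
Qed.

Lemma is_derive_RInt_upper (f : R -> R) (a x : R) :
  (forall y, continuous f y) -> is_derive (fun b => RInt f a b) x (f x).
Proof.
  intros Hf; apply (is_derive_RInt f (fun b => RInt f a b) a x); [| apply Hf].
  apply filter_forall; intros b; apply continuous_is_RInt, Hf.
Qed.

Lemma is_derive_RInt_lower (f : R -> R) (b x : R) :
  (forall y, continuous f y) -> is_derive (fun a => RInt f a b) x (- f x).
Proof.
  intros Hf; apply (is_derive_RInt' f (fun a => RInt f a b) x b); [| apply Hf].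
  apply filter_forall; intros a; apply continuous_is_RInt, Hf.
Qed.

Lemma is_derive_conv_c (k : R) (f : R -> R) (a b x : R) : (forall y, continuous f y) ->
  is_derive (conv_c k f a b) x (conv_s k f a b x).
Proof.
  intros Hf.
  eapply is_derive_ext; [intros y; symmetry; apply (conv_expand k f a b y Hf) |].
  evar_last; [eapply is_derive_hyp_comb; [| | reflexivity | reflexivity]; apply @is_derive_const |].
  rewrite (proj2 (conv_expand k f a b x Hf)). unfold zero; simpl; ring.
Qed.

Lemma is_derive_conv_c_upper (k : R) (f : R -> R) (a x : R) : (forall y, continuous f y) ->
  is_derive (fun y => conv_c k f a y y) x (conv_s k f a x x + cosh k * f x).
Proof.
  intros Hf.
  eapply is_derive_ext; [intros y; symmetry; apply (conv_expand k f a y y Hf) |].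
  evar_last.
  - eapply is_derive_hyp_comb; [| | reflexivity | reflexivity]; apply is_derive_RInt_upper;
      intros y; apply continuous_Rmult; auto using continuous_cosh, continuous_sinh.
  - rewrite (proj2 (conv_expand k f a x x Hf)).
    replace (cosh k) with (cosh (x - k - x)).
    + rewrite (cosh_minus (x - k) x); ring.
    + rewrite <- cosh_opp; f_equal; ring.
Qed.

Lemma is_derive_conv_c_lower (k : R) (f : R -> R) (b x : R) : (forall y, continuous f y) ->
  is_derive (fun y => conv_c k f y b y) x (conv_s k f x b x - cosh k * f x).
Proof.
  intros Hf.
  eapply is_derive_ext; [intros y; symmetry; apply (conv_expand k f y b y Hf) |].
  evar_last.
  - eapply is_derive_hyp_comb; [| | reflexivity | reflexivity]; apply is_derive_RInt_lower;
      intros y; apply continuous_Rmult; auto using continuous_cosh, continuous_sinh.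
  - rewrite (proj2 (conv_expand k f x b x Hf)).
    replace (cosh k) with (cosh (x - k - x)).
    + rewrite (cosh_minus (x - k) x); ring.
    + rewrite <- cosh_opp; f_equal; ring.
Qed.

Lemma conv_c_point (k : R) (f : R -> R) (a x : R) : conv_c k f a a x = 0.
Proof. unfold conv_c; apply @RInt_point. Qed.

(* For f equal to f1 on (x0, m) and to f2 on (m, x0 + 2 pi), these are the values
   of 2 sinh(pi) (1 - d^2/dx^2)^{-1} f on the two intervals. *)
Definition green1 (f1 f2 : R -> R) (x0 m x : R) : R :=
  conv_c PI f1 x0 x x + conv_c (- PI) f1 x m x + conv_c (- PI) f2 m (x0 + 2 * PI) x.
Definition green2 (f1 f2 : R -> R) (x0 m x : R) : R :=
  conv_c PI f1 x0 m x + conv_c PI f2 m x x + conv_c (- PI) f2 x (x0 + 2 * PI) x.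

Definition dgreen1 (f1 f2 : R -> R) (x0 m x : R) : R :=
  conv_s PI f1 x0 x x + conv_s (- PI) f1 x m x + conv_s (- PI) f2 m (x0 + 2 * PI) x.
Definition dgreen2 (f1 f2 : R -> R) (x0 m x : R) : R :=
  conv_s PI f1 x0 m x + conv_s PI f2 m x x + conv_s (- PI) f2 x (x0 + 2 * PI) x.

(** The moving end point contributes cosh(pi) f1(x) from the left and - cosh(- pi) f1(x) from the
    right; these cancel because the kernel is continuous at its peak. *)
Lemma is_derive_green1 (f1 f2 : R -> R) (x0 m x : R) :
  (forall y, continuous f1 y) -> (forall y, continuous f2 y) ->
  is_derive (green1 f1 f2 x0 m) x (dgreen1 f1 f2 x0 m x).
Proof.
  intros H1 H2. evar_last.
  - apply @is_derive_plus; [apply @is_derive_plus |].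
    + apply is_derive_conv_c_upper, H1.
    + apply is_derive_conv_c_lower, H1.
    + apply is_derive_conv_c, H2.
  - unfold dgreen1, plus; simpl. rewrite cosh_opp. ring.
Qed.

Lemma is_derive_green2 (f1 f2 : R -> R) (x0 m x : R) :
  (forall y, continuous f1 y) -> (forall y, continuous f2 y) ->
  is_derive (green2 f1 f2 x0 m) x (dgreen2 f1 f2 x0 m x).
Proof.
  intros H1 H2. evar_last.
  - apply @is_derive_plus; [apply @is_derive_plus |].
    + apply is_derive_conv_c, H1.
    + apply is_derive_conv_c_upper, H2.
    + apply is_derive_conv_c_lower, H2.
  - unfold dgreen2, plus; simpl. rewrite cosh_opp. ring.
Qed.

(** Together with [green_period] this is the continuity of the nonlocal term across both peaks,
    which makes its boundary contributions cancel when the arcs are added. *)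
Lemma green_match (f1 f2 : R -> R) (x0 m : R) :
  green1 f1 f2 x0 m m = green2 f1 f2 x0 m m.
Proof. unfold green1, green2; rewrite !conv_c_point; ring. Qed.

Lemma green_period (f1 f2 : R -> R) (x0 m : R) :
  green2 f1 f2 x0 m (x0 + 2 * PI) = green1 f1 f2 x0 m x0.
Proof.
  unfold green1, green2; rewrite !conv_c_point.
  assert (H : forall f a b, conv_c PI f a b (x0 + 2 * PI) = conv_c (- PI) f a b x0).
  { intros f a b; unfold conv_c; apply RInt_ext; intros y _. f_equal; f_equal; ring. }
  rewrite !H; ring.
Qed.

Lemma conv_c_is_RInt (k : R) (f : R -> R) (a b x : R) : (forall y, continuous f y) ->
  is_RInt (fun y => cosh (x - y - k) * f y) a b (conv_c k f a b x).
Proof.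
  intros Hf; apply continuous_is_RInt; intros y; apply continuous_Rmult; [| apply Hf].
  apply continuous_cosh_comp.
  apply @ex_derive_continuous; auto_derive; exact I.
Qed.

Lemma gker_conv_right (k : R) (f g : R -> R) (a b x : R) : (forall y, continuous f y) ->
  a <= b -> (forall y, a < y < b -> g y = f y) -> b <= x -> x <= a + 2 * PI ->
  is_RInt (fun y => gker (x - y) * g y) a b (conv_c PI f a b x).
Proof.
  intros Hf Hab Hg Hb Ha.
  apply (is_RInt_ext (fun y => cosh (x - y - PI) * f y)); [| apply conv_c_is_RInt, Hf].
  rewrite Rmin_left, Rmax_right by lra; intros y Hy.
  rewrite gker_right by lra. rewrite Hg by lra. reflexivity.
Qed.

Lemma gker_conv_left (k : R) (f g : R -> R) (a b x : R) : (forall y, continuous f y) ->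
  a <= b -> (forall y, a < y < b -> g y = f y) -> x <= a -> b <= x + 2 * PI ->
  is_RInt (fun y => gker (x - y) * g y) a b (conv_c (- PI) f a b x).
Proof.
  intros Hf Hab Hg Hb Ha.
  apply (is_RInt_ext (fun y => cosh (x - y - - PI) * f y)); [| apply conv_c_is_RInt, Hf].
  rewrite Rmin_left, Rmax_right by lra; intros y Hy.
  rewrite gker_left by lra. rewrite Hg by lra. f_equal; f_equal; ring.
Qed.

Lemma gker_reflect_periodic (f : R -> R) (x : R) :
  periodic f -> periodic (fun y => gker (x - y) * f y).
Proof.
  intros Hf y. rewrite Hf. f_equal.
  replace (x - (y + 2 * PI)) with (x - y - 2 * PI) by ring.
  apply (periodic_minus gker gker_periodic).
Qed.

Lemma helmholtz_green1 (f f1 f2 : R -> R) (x0 m x : R) :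
  periodic f -> m < x0 + 2 * PI ->
  (forall y, continuous f1 y) -> (forall y, continuous f2 y) ->
  (forall y, x0 < y < m -> f y = f1 y) ->
  (forall y, m < y < x0 + 2 * PI -> f y = f2 y) ->
  x0 < x < m ->
  helmholtz_inv f x = / (2 * sinh PI) * green1 f1 f2 x0 m x.
Proof.
  intros Hp Hm H1 H2 E1 E2 Hx.
  unfold helmholtz_inv; f_equal; apply is_RInt_unique.
  replace (2 * PI) with (0 + 2 * PI) by ring.
  apply (periodic_is_RInt (fun y => gker (x - y) * f y) x0 0).
  { apply gker_reflect_periodic, Hp. }
  unfold green1.
  apply (is_RInt_Chasles (V := R_NormedModule) _ x0 m (x0 + 2 * PI));
    [apply (is_RInt_Chasles (V := R_NormedModule) _ x0 x m) |].
  - apply gker_conv_right; auto; try lra. intros; apply E1; lra.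
  - apply gker_conv_left; auto; try lra. intros; apply E1; lra.
  - apply gker_conv_left; auto; lra.
Qed.

Lemma helmholtz_green2 (f f1 f2 : R -> R) (x0 m x : R) :
  periodic f -> x0 < m ->
  (forall y, continuous f1 y) -> (forall y, continuous f2 y) ->
  (forall y, x0 < y < m -> f y = f1 y) ->
  (forall y, m < y < x0 + 2 * PI -> f y = f2 y) ->
  m < x < x0 + 2 * PI ->
  helmholtz_inv f x = / (2 * sinh PI) * green2 f1 f2 x0 m x.
Proof.
  intros Hp Hm H1 H2 E1 E2 Hx.
  unfold helmholtz_inv; f_equal; apply is_RInt_unique.
  replace (2 * PI) with (0 + 2 * PI) by ring.
  apply (periodic_is_RInt (fun y => gker (x - y) * f y) x0 0).
  { apply gker_reflect_periodic, Hp. }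
  unfold green2.
  apply (is_RInt_Chasles (V := R_NormedModule) _ x0 x (x0 + 2 * PI));
    [apply (is_RInt_Chasles (V := R_NormedModule) _ x0 m x) |].
  - apply gker_conv_right; auto; lra.
  - apply gker_conv_right; auto; try lra. intros; apply E2; lra.
  - apply gker_conv_left; auto; try lra. intros; apply E2; lra.
Qed.

Definition flux (u v : R -> R) (y : R) : R := (u y)^3 + 3 / 2 * u y * (v y)^2.
Definition source (v : R -> R) (y : R) : R := 1 / 2 * (v y)^3.

(** With g(y) = cosh(x - y - k), so that g'(y) = - sinh(x - y - k), this is - u^2 v g' + 1/2 u v^2
    g. *)
Definition Phi (k : R) (u v : R -> R) (x y : R) : R :=
  (u y)^2 * v y * sinh (x - y - k) + 1 / 2 * u y * (v y)^2 * cosh (x - y - k).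

(* Where u'' = u, the combination of the two nonlocal terms is an exact derivative. *)
Lemma conv_exact (k : R) (u v : R -> R) (a b x : R) :
  (forall y, is_derive u y (v y)) -> (forall y, is_derive v y (u y)) ->
  conv_s k (flux u v) a b x + conv_c k (source v) a b x
  = Phi k u v x b - Phi k u v x a.
Proof.
  intros Hu Hv.
  assert (Cu : forall y, continuous u y) by (intros y; exact (is_derive_cont _ _ _ (Hu y))).
  assert (Cv : forall y, continuous v y) by (intros y; exact (is_derive_cont _ _ _ (Hv y))).
  assert (Hk : forall y, is_derive (fun y => x - y - k) y (-1)).
  { intros y; auto_derive; [exact I | ring]. }
  set (g := fun y => sinh (x - y - k) * flux u v y + cosh (x - y - k) * source v y).
  assert (Hg : is_RInt g a b (Phi k u v x b - Phi k u v x a)).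
  { apply (is_RInt_derive (Phi k u v x) g a b).
    - intros y _.
      pose proof (is_derive_sinh_comp _ y _ (Hk y)) as Ds.
      pose proof (is_derive_cosh_comp _ y _ (Hk y)) as Dc.
      unfold Phi, g, flux, source.
      set (sh := fun y => sinh (x - y - k)) in *.
      set (ch := fun y => cosh (x - y - k)) in *.
      apply (is_derive_ext (fun y => (u y)^2 * v y * sh y + 1 / 2 * u y * (v y)^2 * ch y)).
      { reflexivity. }
      specialize (Hu y). specialize (Hv y).
      auto_derive.
      + repeat split; eexists; eassumption.
      + replace (Derive (fun x0 => u x0) y) with (v y) by (symmetry; exact (is_derive_unique _ _ _ Hu)).
        replace (Derive (fun x0 => v x0) y) with (u y) by (symmetry; exact (is_derive_unique _ _ _ Hv)).
        replace (Derive (fun x0 => sh x0) y) with (-1 * cosh (x - y - k))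
          by (symmetry; exact (is_derive_unique _ _ _ Ds)).
        replace (Derive (fun x0 => ch x0) y) with (-1 * sinh (x - y - k))
          by (symmetry; exact (is_derive_unique _ _ _ Dc)).
        unfold sh, ch; field.
    - intros y _. apply @ex_derive_continuous.
      pose proof (is_derive_sinh_comp _ y _ (Hk y)) as Ds.
      pose proof (is_derive_cosh_comp _ y _ (Hk y)) as Dc.
      unfold g, flux, source.
      set (sh := fun y => sinh (x - y - k)) in *.
      set (ch := fun y => cosh (x - y - k)) in *.
      apply (ex_derive_ext (fun y => sh y * ((u y)^3 + 3 / 2 * u y * (v y)^2)
                                     + ch y * (1 / 2 * (v y)^3))).
      { reflexivity. }
      specialize (Hu y). specialize (Hv y).
      auto_derive. repeat split; eexists; eassumption. }
  assert (Hfl : forall y, continuous (flux u v) y).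
  { intros y. specialize (Hu y). specialize (Hv y). apply @ex_derive_continuous.
    unfold flux; auto_derive. repeat split; eexists; eassumption. }
  assert (Hso : forall y, continuous (source v) y).
  { intros y. specialize (Hv y). apply @ex_derive_continuous.
    unfold source; auto_derive. eexists; eassumption. }
  rewrite <- (is_RInt_unique _ _ _ _ Hg). unfold conv_s, conv_c, g.
  symmetry. apply (RInt_plus (V := R_CompleteNormedModule)).
  - apply continuous_ex_RInt; intros y; apply continuous_Rmult; [| apply Hfl].
    apply continuous_sinh_comp. exact (is_derive_cont _ _ _ (Hk y)).
  - apply continuous_ex_RInt; intros y; apply continuous_Rmult; [| apply Hso].
    apply continuous_cosh_comp. exact (is_derive_cont _ _ _ (Hk y)).
Qed.

(** * The Novikov equation at a fixed time *)

(** [D] is an antiderivative of the weak integrand on one arc. [LA] and [LB] stand for [2 * s] times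
    the nonlocal terms, with s = sinh(pi); [G] and [H] carry the kernels at the peaks, weighted by
    p_i u(q_i)^2 and p_i', so that the last two terms are what the motion of the peaks contributes
    to the derivative of the pairing. *)
Lemma piece_antiderivative
    (LA MA LB u v G G' H psi dpsi : R -> R) (s a b : R) :
  (forall x, is_derive LA x (MA x)) -> (forall x, continuous LB x) ->
  (forall x, is_derive G x (G' x)) -> (forall x, continuous H x) ->
  (forall x, continuous u x) -> (forall x, continuous v x) ->
  (forall x, is_derive psi x (dpsi x)) -> (forall x, continuous dpsi x) ->
  s <> 0 ->
  (forall x, MA x + LB x = 2 * s * (- ((u x)^2 * v x) + G' x - H x)) ->
  let D := fun x => (G x - / (2 * s) * LA x) * psi x in
  is_RInt (fun x => (u x)^2 * v x * psi x - / (2 * s) * LA x * dpsi x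
             + / (2 * s) * LB x * psi x + H x * psi x + G x * dpsi x)
    a b (D b - D a).
Proof.
  intros DLA CLB DG CH Cu Cv Dpsi Cdpsi Hs Heq D.
  assert (CLA : forall x, continuous LA x) by (intros x; exact (is_derive_cont _ _ _ (DLA x))).
  assert (CG : forall x, continuous G x) by (intros x; exact (is_derive_cont _ _ _ (DG x))).
  assert (Cpsi : forall x, continuous psi x) by (intros x; exact (is_derive_cont _ _ _ (Dpsi x))).
  apply (is_RInt_derive D).
  - intros x _. unfold D.
    specialize (DLA x). specialize (DG x). specialize (Dpsi x). specialize (Heq x).
    auto_derive.
    + repeat split; eexists; eassumption.
    + replace (Derive (fun x0 => G x0) x) with (G' x) by (symmetry; exact (is_derive_unique _ _ _ DG)).
      replace (Derive (fun x0 => LA x0) x) with (MA x) by (symmetry; exact (is_derive_unique _ _ _ DLA)).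
      replace (Derive (fun x0 => psi x0) x) with (dpsi x) by (symmetry; exact (is_derive_unique _ _ _ Dpsi)).
      replace (MA x) with (2 * s * (- ((u x)^2 * v x) + G' x - H x) - LB x) by lra.
      field. exact Hs.
  - intros x _.
    assert (Hsum : forall f g : R -> R, continuous f x -> continuous g x ->
      continuous (fun y => f y + g y) x) by (intros f g Hf Hg; exact (continuous_plus f g x Hf Hg)).
    apply Hsum; [apply Hsum; [apply Hsum |] |].
    + apply @continuous_minus.
      * apply continuous_Rmult; [| apply Cpsi]. apply continuous_Rmult; [| apply Cv].
        apply (continuous_comp u (fun z => z ^ 2)); [apply Cu |].
        apply @ex_derive_continuous; auto_derive; exact I.
      * apply continuous_Rmult; [| apply Cdpsi].
        apply continuous_Rmult; [apply continuous_const | apply CLA].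
    + apply continuous_Rmult; [| apply Cpsi].
      apply continuous_Rmult; [apply continuous_const | apply CLB].
    + apply continuous_Rmult; auto.
    + apply continuous_Rmult; auto.
Qed.

(** The formulas of u and u_x on one arc, continued to the whole line: [k = - PI] between [x0] and
    [m], [k = PI] between [m] and [x0 + 2 * PI]. *)
Definition piece_u (p1 p2 x0 m k x : R) : R :=
  p1 * cosh (x - x0 - PI) + p2 * cosh (x - m - k).
Definition piece_v (p1 p2 x0 m k x : R) : R :=
  p1 * sinh (x - x0 - PI) + p2 * sinh (x - m - k).

Lemma is_derive_piece_u (p1 p2 x0 m k x : R) :
  is_derive (piece_u p1 p2 x0 m k) x (piece_v p1 p2 x0 m k x).
Proof.
  assert (H0 : is_derive (fun y => y - x0 - PI) x 1) by (auto_derive; [exact I | ring]).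
  assert (Hm : is_derive (fun y => y - m - k) x 1) by (auto_derive; [exact I | ring]).
  evar_last.
  - apply @is_derive_plus; apply is_derive_scal;
      [exact (is_derive_cosh_comp _ _ _ H0) | exact (is_derive_cosh_comp _ _ _ Hm)].
  - unfold piece_v, plus; simpl; ring.
Qed.

Lemma is_derive_piece_v (p1 p2 x0 m k x : R) :
  is_derive (piece_v p1 p2 x0 m k) x (piece_u p1 p2 x0 m k x).
Proof.
  assert (H0 : is_derive (fun y => y - x0 - PI) x 1) by (auto_derive; [exact I | ring]).
  assert (Hm : is_derive (fun y => y - m - k) x 1) by (auto_derive; [exact I | ring]).
  evar_last.
  - apply @is_derive_plus; apply is_derive_scal;
      [exact (is_derive_sinh_comp _ _ _ H0) | exact (is_derive_sinh_comp _ _ _ Hm)].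
  - unfold piece_u, plus; simpl; ring.
Qed.

Lemma piece_u_cont (p1 p2 x0 m k x : R) : continuous (piece_u p1 p2 x0 m k) x.
Proof. exact (is_derive_cont _ _ _ (is_derive_piece_u p1 p2 x0 m k x)). Qed.

Lemma piece_v_cont (p1 p2 x0 m k x : R) : continuous (piece_v p1 p2 x0 m k) x.
Proof. exact (is_derive_cont _ _ _ (is_derive_piece_v p1 p2 x0 m k x)). Qed.

Lemma piece_flux_cont (p1 p2 x0 m k x : R) :
  continuous (flux (piece_u p1 p2 x0 m k) (piece_v p1 p2 x0 m k)) x.
Proof.
  pose proof (is_derive_piece_u p1 p2 x0 m k x). pose proof (is_derive_piece_v p1 p2 x0 m k x).
  apply @ex_derive_continuous; unfold flux; auto_derive. repeat split; eexists; eassumption.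
Qed.

Lemma piece_source_cont (p1 p2 x0 m k x : R) :
  continuous (source (piece_v p1 p2 x0 m k)) x.
Proof.
  pose proof (is_derive_piece_v p1 p2 x0 m k x).
  apply @ex_derive_continuous; unfold source; auto_derive. eexists; eassumption.
Qed.

(* Velocities and momentum derivatives of the peaks, in the form in which they
   arise as jumps: q_i' = u(q_i)^2 and p_i' = - p_i u(q_i) {u_x(q_i)}, with
   {u_x} the average of the one-sided slopes. *)
Definition speed_at (p1 p2 d : R) : R := (p1 * cosh PI + p2 * cosh d)^2.
Definition force_at (p1 p2 d : R) : R := - (p1 * (p1 * cosh PI + p2 * cosh d) * (p2 * sinh d)).

Lemma cosh_sinh_eq (x y : R) : x = y -> cosh x = cosh y /\ sinh x = sinh y.
Proof. intros ->; split; reflexivity. Qed.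

Lemma cosh_sinh_opp (x y : R) : x = - y -> cosh x = cosh y /\ sinh x = - sinh y.
Proof. intros ->; rewrite cosh_opp, sinh_opp; split; reflexivity. Qed.

(** At each peak u is continuous, the left slope minus the right slope is 2 p_i sinh(pi), and the
    average of the two slopes comes from the other peak alone. *)
Lemma piece_endpoints (p1 p2 x0 m : R) :
  let d := x0 - m + PI in
  let u1 := piece_u p1 p2 x0 m (- PI) in let v1 := piece_v p1 p2 x0 m (- PI) in
  let u2 := piece_u p1 p2 x0 m PI in let v2 := piece_v p1 p2 x0 m PI in
  (u1 x0 = p1 * cosh PI + p2 * cosh d /\ v1 x0 = - (p1 * sinh PI) + p2 * sinh d) /\
  (u1 m = p1 * cosh d + p2 * cosh PI /\ v1 m = - (p1 * sinh d) + p2 * sinh PI) /\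
  (u2 m = p1 * cosh d + p2 * cosh PI /\ v2 m = - (p1 * sinh d) - p2 * sinh PI) /\
  (u2 (x0 + 2 * PI) = p1 * cosh PI + p2 * cosh d /\
   v2 (x0 + 2 * PI) = p1 * sinh PI + p2 * sinh d).
Proof.
  intros d; unfold piece_u, piece_v; cbv zeta.
  destruct (cosh_sinh_opp (x0 - x0 - PI) PI ltac:(ring)) as [-> ->].
  destruct (cosh_sinh_eq (x0 - m - - PI) d ltac:(unfold d; ring)) as [-> ->].
  destruct (cosh_sinh_opp (m - x0 - PI) d ltac:(unfold d; ring)) as [-> ->].
  destruct (cosh_sinh_eq (m - m - - PI) PI ltac:(ring)) as [-> ->].
  destruct (cosh_sinh_opp (m - m - PI) PI ltac:(ring)) as [-> ->].
  destruct (cosh_sinh_eq (x0 + 2 * PI - x0 - PI) PI ltac:(ring)) as [-> ->].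
  destruct (cosh_sinh_eq (x0 + 2 * PI - m - PI) d ltac:(unfold d; ring)) as [-> ->].
  repeat split; ring.
Qed.

(** [conv_exact] leaves only end values. At y = x the two branches of the kernel produce - 2
    sinh(pi) u^2 v. At the peaks the jump of v produces the terms p_i u(q_i)^2, and the jump of v^2,
    which is the jump of v times twice its average, produces the forces. *)
Lemma green_identity1 (p1 p2 x0 m x : R) :
  let d := x0 - m + PI in
  let u1 := piece_u p1 p2 x0 m (- PI) in let v1 := piece_v p1 p2 x0 m (- PI) in
  let u2 := piece_u p1 p2 x0 m PI in let v2 := piece_v p1 p2 x0 m PI in
  dgreen1 (flux u1 v1) (flux u2 v2) x0 m x + green1 (source v1) (source v2) x0 m x
  = 2 * sinh PI * (- ((u1 x)^2 * v1 x)
      + (p1 * speed_at p1 p2 d * sinh (x - x0 - PI)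
         + p2 * speed_at p2 p1 d * sinh (x - m - - PI))
      - (force_at p1 p2 d * cosh (x - x0 - PI)
         + force_at p2 p1 (- d) * cosh (x - m - - PI))).
Proof.
  intros d u1 v1 u2 v2.
  transitivity
    (Phi PI u1 v1 x x - Phi PI u1 v1 x x0 + (Phi (- PI) u1 v1 x m - Phi (- PI) u1 v1 x x)
     + (Phi (- PI) u2 v2 x (x0 + 2 * PI) - Phi (- PI) u2 v2 x m)).
  { unfold dgreen1, green1.
    rewrite <- !conv_exact by
      (intros y; first [apply is_derive_piece_u | apply is_derive_piece_v]).
    ring. }
  destruct (piece_endpoints p1 p2 x0 m) as [[A1 A2] [[B1 B2] [[C1 C2] [D1 D2]]]].
  fold u1 in A1, B1. fold v1 in A2, B2. fold u2 in C1, D1. fold v2 in C2, D2. fold d in A1, A2, B1, B2, C1, C2, D1, D2.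
  unfold Phi; rewrite A1, A2, B1, B2, C1, C2, D1, D2.
  clear A1 A2 B1 B2 C1 C2 D1 D2.
  generalize (u1 x) (v1 x); intros ux vx.
  unfold speed_at, force_at; rewrite (cosh_opp d), (sinh_opp d).
  destruct (cosh_sinh_opp (x - x - PI) PI ltac:(ring)) as [-> ->].
  destruct (cosh_sinh_eq (x - x - - PI) PI ltac:(ring)) as [-> ->].
  destruct (cosh_sinh_eq (x - (x0 + 2 * PI) - - PI) (x - x0 - PI) ltac:(ring)) as [-> ->].
  field.
Qed.

Lemma green_identity2 (p1 p2 x0 m x : R) :
  let d := x0 - m + PI in
  let u1 := piece_u p1 p2 x0 m (- PI) in let v1 := piece_v p1 p2 x0 m (- PI) in
  let u2 := piece_u p1 p2 x0 m PI in let v2 := piece_v p1 p2 x0 m PI in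
  dgreen2 (flux u1 v1) (flux u2 v2) x0 m x + green2 (source v1) (source v2) x0 m x
  = 2 * sinh PI * (- ((u2 x)^2 * v2 x)
      + (p1 * speed_at p1 p2 d * sinh (x - x0 - PI)
         + p2 * speed_at p2 p1 d * sinh (x - m - PI))
      - (force_at p1 p2 d * cosh (x - x0 - PI)
         + force_at p2 p1 (- d) * cosh (x - m - PI))).
Proof.
  intros d u1 v1 u2 v2.
  transitivity
    (Phi PI u1 v1 x m - Phi PI u1 v1 x x0 + (Phi PI u2 v2 x x - Phi PI u2 v2 x m)
     + (Phi (- PI) u2 v2 x (x0 + 2 * PI) - Phi (- PI) u2 v2 x x)).
  { unfold dgreen2, green2.
    rewrite <- !conv_exact by
      (intros y; first [apply is_derive_piece_u | apply is_derive_piece_v]).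
    ring. }
  destruct (piece_endpoints p1 p2 x0 m) as [[A1 A2] [[B1 B2] [[C1 C2] [D1 D2]]]].
  fold u1 in A1, B1. fold v1 in A2, B2. fold u2 in C1, D1. fold v2 in C2, D2. fold d in A1, A2, B1, B2, C1, C2, D1, D2.
  unfold Phi; rewrite A1, A2, B1, B2, C1, C2, D1, D2.
  clear A1 A2 B1 B2 C1 C2 D1 D2.
  generalize (u2 x) (v2 x); intros ux vx.
  unfold speed_at, force_at; rewrite (cosh_opp d), (sinh_opp d).
  destruct (cosh_sinh_opp (x - x - PI) PI ltac:(ring)) as [-> ->].
  destruct (cosh_sinh_eq (x - x - - PI) PI ltac:(ring)) as [-> ->].
  destruct (cosh_sinh_eq (x - (x0 + 2 * PI) - - PI) (x - x0 - PI) ltac:(ring)) as [-> ->].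
  field.
Qed.

Definition peakon_u (p1 p2 x0 m x : R) : R := p1 * gker (x - x0) + p2 * gker (x - m).
Definition peakon_v (p1 p2 x0 m x : R) : R := p1 * gker' (x - x0) + p2 * gker' (x - m).

Lemma peakon_piece1 (p1 p2 x0 m x : R) : m < x0 + 2 * PI -> x0 < x < m ->
  peakon_u p1 p2 x0 m x = piece_u p1 p2 x0 m (- PI) x /\
  peakon_v p1 p2 x0 m x = piece_v p1 p2 x0 m (- PI) x.
Proof.
  intros Hm Hx; unfold peakon_u, peakon_v, piece_u, piece_v.
  rewrite (gker_right x x0), (gker_left x m), (gker'_right x x0), (gker'_left x m) by lra.
  replace (x - m - - PI) with (x - m + PI) by ring; split; reflexivity.
Qed.

Lemma peakon_piece2 (p1 p2 x0 m x : R) : x0 < m -> m < x < x0 + 2 * PI ->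
  peakon_u p1 p2 x0 m x = piece_u p1 p2 x0 m PI x /\
  peakon_v p1 p2 x0 m x = piece_v p1 p2 x0 m PI x.
Proof.
  intros Hm Hx; unfold peakon_u, peakon_v, piece_u, piece_v.
  rewrite (gker_right x x0), (gker_right x m), (gker'_right x x0), (gker'_right x m) by lra.
  split; reflexivity.
Qed.

Lemma peakon_periodic (p1 p2 x0 m : R) :
  periodic (peakon_u p1 p2 x0 m) /\ periodic (peakon_v p1 p2 x0 m).
Proof.
  split; intros x; unfold peakon_u, peakon_v.
  - rewrite (periodic_shift gker x0 gker_periodic), (periodic_shift gker m gker_periodic).
    reflexivity.
  - rewrite (periodic_shift gker' x0 gker'_periodic), (periodic_shift gker' m gker'_periodic).
    reflexivity.
Qed.

Lemma helmholtz_periodic (f : R -> R) : periodic (helmholtz_inv f).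
Proof.
  intros x; unfold helmholtz_inv; f_equal; apply RInt_ext; intros y _.
  change (gker (x + 2 * PI - y) * f y = gker (x - y) * f y).
  rewrite (periodic_shift gker y gker_periodic); reflexivity.
Qed.

Lemma derivative_periodic (f df : R -> R) :
  periodic f -> (forall x, is_derive f x (df x)) -> periodic df.
Proof.
  intros Hp Hd x.
  rewrite <- (is_derive_unique _ _ _ (Hd x)).
  symmetry; apply is_derive_unique.
  apply (is_derive_ext (fun y => f (y + 2 * PI))); [intros; apply Hp |].
  evar_last.
  - apply (is_derive_comp f (fun y => y + 2 * PI)); [apply Hd |].
    instantiate (1 := 1). auto_derive; [exact I | ring].
  - unfold scal; simpl; unfold mult; simpl; ring.
Qed.

(** Both arcs contribute an exact derivative, and the boundary terms cancel around the circle since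
    the kernels, the nonlocal term of the flux and [psi] are continuous across the peaks. *)
Lemma peakon_weak_identity (p1 p2 x0 m : R) (psi dpsi : R -> R) :
  x0 < m < x0 + 2 * PI ->
  periodic psi -> (forall x, is_derive psi x (dpsi x)) -> (forall x, continuous dpsi x) ->
  let d := x0 - m + PI in
  let u := peakon_u p1 p2 x0 m in
  let v := peakon_v p1 p2 x0 m in
  is_RInt (fun x => (u x)^2 * v x * psi x - helmholtz_inv (flux u v) x * dpsi x
      + helmholtz_inv (source v) x * psi x
      + (force_at p1 p2 d * gker (x - x0) + force_at p2 p1 (- d) * gker (x - m)) * psi x
      + (p1 * speed_at p1 p2 d * gker (x - x0)
         + p2 * speed_at p2 p1 d * gker (x - m)) * dpsi x)
    0 (2 * PI) 0.
Proof.
  intros Hm Hp Hpsi Hdpsi d u v.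
  pose proof PI_gt_3. assert (Hs : 0 < sinh PI) by (apply sinh_pos; lra).
  pose proof (derivative_periodic psi dpsi Hp Hpsi) as Hdp.
  destruct (peakon_periodic p1 p2 x0 m) as [Pu Pv]. fold u in Pu. fold v in Pv.
  set (u1 := piece_u p1 p2 x0 m (- PI)). set (v1 := piece_v p1 p2 x0 m (- PI)).
  set (u2 := piece_u p1 p2 x0 m PI). set (v2 := piece_v p1 p2 x0 m PI).
  assert (E1 : forall x, x0 < x < m -> u x = u1 x /\ v x = v1 x).
  { intros x Hx; apply peakon_piece1; lra. }
  assert (E2 : forall x, m < x < x0 + 2 * PI -> u x = u2 x /\ v x = v2 x).
  { intros x Hx; apply peakon_piece2; lra. }
  set (A1 := flux u1 v1). set (A2 := flux u2 v2).
  set (B1 := source v1). set (B2 := source v2).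
  assert (CA1 : forall y, continuous A1 y) by (intros; apply piece_flux_cont).
  assert (CA2 : forall y, continuous A2 y) by (intros; apply piece_flux_cont).
  assert (CB1 : forall y, continuous B1 y) by (intros; apply piece_source_cont).
  assert (CB2 : forall y, continuous B2 y) by (intros; apply piece_source_cont).
  assert (PA : periodic (flux u v)) by (intros x; unfold flux; rewrite Pu, Pv; reflexivity).
  assert (PB : periodic (source v)) by (intros x; unfold source; rewrite Pv; reflexivity).
  assert (EA1 : forall x, x0 < x < m -> flux u v x = A1 x).
  { intros x Hx; destruct (E1 x Hx) as [Eu Ev]; unfold flux, A1; rewrite Eu, Ev; reflexivity. }
  assert (EA2 : forall x, m < x < x0 + 2 * PI -> flux u v x = A2 x).
  { intros x Hx; destruct (E2 x Hx) as [Eu Ev]; unfold flux, A2; rewrite Eu, Ev; reflexivity. }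
  assert (EB1 : forall x, x0 < x < m -> source v x = B1 x).
  { intros x Hx; destruct (E1 x Hx) as [Eu Ev]; unfold source, B1; rewrite Ev; reflexivity. }
  assert (EB2 : forall x, m < x < x0 + 2 * PI -> source v x = B2 x).
  { intros x Hx; destruct (E2 x Hx) as [Eu Ev]; unfold source, B2; rewrite Ev; reflexivity. }
  (* The kernel combinations with forces or with velocities as coefficients are again of the form
     [piece_u]. *)
  assert (HI : forall k,
    (forall x, continuous (piece_u (force_at p1 p2 d) (force_at p2 p1 (- d)) x0 m k) x) /\
    (forall x, is_derive (piece_u (p1 * speed_at p1 p2 d) (p2 * speed_at p2 p1 d) x0 m k) x
       (piece_v (p1 * speed_at p1 p2 d) (p2 * speed_at p2 p1 d) x0 m k x))).
  { intros k; split; intros x; [apply piece_u_cont | apply is_derive_piece_u]. }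
  pose proof (piece_antiderivative (green1 A1 A2 x0 m) (dgreen1 A1 A2 x0 m) (green1 B1 B2 x0 m)
    u1 v1 _ _ _ psi dpsi (sinh PI) x0 m
    (fun x => is_derive_green1 A1 A2 x0 m x CA1 CA2)
    (fun x => is_derive_cont _ _ _ (is_derive_green1 B1 B2 x0 m x CB1 CB2))
    (proj2 (HI (- PI))) (proj1 (HI (- PI)))
    (piece_u_cont _ _ _ _ _) (piece_v_cont _ _ _ _ _) Hpsi Hdpsi ltac:(lra)
    (green_identity1 p1 p2 x0 m)) as I1.
  pose proof (piece_antiderivative (green2 A1 A2 x0 m) (dgreen2 A1 A2 x0 m) (green2 B1 B2 x0 m)
    u2 v2 _ _ _ psi dpsi (sinh PI) m (x0 + 2 * PI)
    (fun x => is_derive_green2 A1 A2 x0 m x CA1 CA2)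
    (fun x => is_derive_cont _ _ _ (is_derive_green2 B1 B2 x0 m x CB1 CB2))
    (proj2 (HI PI)) (proj1 (HI PI))
    (piece_u_cont _ _ _ _ _) (piece_v_cont _ _ _ _ _) Hpsi Hdpsi ltac:(lra)
    (green_identity2 p1 p2 x0 m)) as I2.
  cbv zeta in I1, I2.
  evar_last.
  - eapply piecewise_is_RInt; [| exact Hm | | | exact I1 | exact I2].
    + intros x. rewrite !helmholtz_periodic, Pu, Pv, Hp, Hdp.
      rewrite (periodic_shift gker x0 gker_periodic), (periodic_shift gker m gker_periodic).
      reflexivity.
    + intros x Hx. destruct (E1 x Hx) as [Eu Ev].
      rewrite (helmholtz_green1 _ A1 A2 x0 m x PA (proj2 Hm) CA1 CA2 EA1 EA2 Hx).
      rewrite (helmholtz_green1 _ B1 B2 x0 m x PB (proj2 Hm) CB1 CB2 EB1 EB2 Hx).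
      rewrite Eu, Ev. unfold piece_u at 1 2.
      rewrite (gker_right x x0), (gker_left x m) by lra.
      replace (x - m - - PI) with (x - m + PI) by ring. reflexivity.
    + intros x Hx. destruct (E2 x Hx) as [Eu Ev].
      rewrite (helmholtz_green2 _ A1 A2 x0 m x PA (proj1 Hm) CA1 CA2 EA1 EA2 Hx).
      rewrite (helmholtz_green2 _ B1 B2 x0 m x PB (proj1 Hm) CB1 CB2 EB1 EB2 Hx).
      rewrite Eu, Ev. unfold piece_u at 1 2.
      rewrite (gker_right x x0), (gker_right x m) by lra. reflexivity.
  - cbv beta. rewrite green_period, green_match, (Hp x0).
    unfold piece_u.
    destruct (cosh_sinh_opp (m - m - PI) PI ltac:(ring)) as [-> _].
    destruct (cosh_sinh_eq (m - m - - PI) PI ltac:(ring)) as [-> _].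
    destruct (cosh_sinh_eq (x0 + 2 * PI - x0 - PI) PI ltac:(ring)) as [-> _].
    destruct (cosh_sinh_opp (x0 - x0 - PI) PI ltac:(ring)) as [-> _].
    destruct (cosh_sinh_eq (x0 + 2 * PI - m - PI) (x0 - m - - PI) ltac:(ring)) as [-> _].
    ring.
Qed.

(** Integration by parts on the two arcs; the boundary terms cancel because u has no jump. *)
Lemma peakon_weak_derivative (p1 p2 x0 m : R) : x0 < m < x0 + 2 * PI ->
  weak_derivative (peakon_u p1 p2 x0 m) (peakon_v p1 p2 x0 m).
Proof.
  intros Hm; pose proof PI_gt_3.
  destruct (peakon_periodic p1 p2 x0 m) as [Pu Pv].
  assert (Hpair : forall chi1 chi2 : R -> R, periodic chi1 -> periodic chi2 ->
    (forall x, continuous chi1 x) -> (forall x, continuous chi2 x) ->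
    is_RInt (fun x => peakon_u p1 p2 x0 m x * chi1 x) 0 (2 * PI)
      (RInt (fun x => piece_u p1 p2 x0 m (- PI) x * chi1 x) x0 m
       + RInt (fun x => piece_u p1 p2 x0 m PI x * chi1 x) m (x0 + 2 * PI)) /\
    is_RInt (fun x => peakon_v p1 p2 x0 m x * chi2 x) 0 (2 * PI)
      (RInt (fun x => piece_v p1 p2 x0 m (- PI) x * chi2 x) x0 m
       + RInt (fun x => piece_v p1 p2 x0 m PI x * chi2 x) m (x0 + 2 * PI))).
  { intros chi1 chi2 P1 P2 C1 C2.
    split; eapply piecewise_is_RInt; try exact Hm.
    - intros x; rewrite Pu, P1; reflexivity.
    - intros x Hx. cbv beta. rewrite (proj1 (peakon_piece1 p1 p2 x0 m x ltac:(lra) Hx)); reflexivity.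
    - intros x Hx. cbv beta. rewrite (proj1 (peakon_piece2 p1 p2 x0 m x ltac:(lra) Hx)); reflexivity.
    - apply continuous_is_RInt; intros x; apply continuous_Rmult; [apply piece_u_cont | apply C1].
    - apply continuous_is_RInt; intros x; apply continuous_Rmult; [apply piece_u_cont | apply C1].
    - intros x; rewrite Pv, P2; reflexivity.
    - intros x Hx. cbv beta. rewrite (proj2 (peakon_piece1 p1 p2 x0 m x ltac:(lra) Hx)); reflexivity.
    - intros x Hx. cbv beta. rewrite (proj2 (peakon_piece2 p1 p2 x0 m x ltac:(lra) Hx)); reflexivity.
    - apply continuous_is_RInt; intros x; apply continuous_Rmult; [apply piece_v_cont | apply C2].
    - apply continuous_is_RInt; intros x; apply continuous_Rmult; [apply piece_v_cont | apply C2]. }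
  split; [| split].
  (* Pairing with the constant 1 gives the integrability of u itself, and below that of v. *)
  - destruct (Hpair (fun _ => 1) (fun _ => 1)) as [Hu _];
      try (intros x; reflexivity); try (intros x; apply continuous_const).
    eapply ex_RInt_ext; [| eexists; exact Hu]. intros x _; apply Rmult_1_r.
  - destruct (Hpair (fun _ => 1) (fun _ => 1)) as [_ Hv];
      try (intros x; reflexivity); try (intros x; apply continuous_const).
    eapply ex_RInt_ext; [| eexists; exact Hv]. intros x _; apply Rmult_1_r.
  - intros psi Hs Hp.
    assert (Hd : forall x, is_derive psi x (Derive psi x)).
    { intros x; apply Derive_correct. exact (Hs 1%nat x). }
    assert (Hc : forall x, continuous (Derive psi) x).
    { intros x; apply @ex_derive_continuous. exact (Hs 2%nat x). }
    assert (Hcp : forall x, continuous psi x) by (intros x; exact (is_derive_cont _ _ _ (Hd x))).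
    destruct (Hpair (Derive psi) psi (derivative_periodic _ _ Hp Hd) Hp Hc Hcp) as [Hu Hv].
    rewrite (is_RInt_unique _ _ _ _ Hu), (is_RInt_unique _ _ _ _ Hv).
    assert (HD : forall k a b,
      RInt (fun x => piece_u p1 p2 x0 m k x * Derive psi x) a b
      + RInt (fun x => piece_v p1 p2 x0 m k x * psi x) a b
      = piece_u p1 p2 x0 m k b * psi b - piece_u p1 p2 x0 m k a * psi a).
    { intros k a b.
      rewrite <- (RInt_plus (V := R_CompleteNormedModule)).
      - apply is_RInt_unique.
        apply (is_RInt_derive (fun x => piece_u p1 p2 x0 m k x * psi x)).
        + intros x _. evar_last.
          * apply (is_derive_mult (piece_u p1 p2 x0 m k) psi x);
              [apply is_derive_piece_u | apply Hd | intros; apply Rmult_comm].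
          * unfold plus, mult; simpl; ring.
        + intros x _. apply @continuous_plus; apply continuous_Rmult; auto;
            [apply piece_u_cont | apply piece_v_cont].
      - apply continuous_ex_RInt; intros x; apply continuous_Rmult; [apply piece_u_cont | apply Hc].
      - apply continuous_ex_RInt; intros x; apply continuous_Rmult; [apply piece_v_cont | apply Hcp]. }
    pose proof (HD (- PI) x0 m) as H1. pose proof (HD PI m (x0 + 2 * PI)) as H2.
    rewrite (Hp x0) in H2.
    destruct (piece_endpoints p1 p2 x0 m) as [[A _] [[B _] [[C _] [D _]]]].
    rewrite A, B in H1. rewrite C, D in H2. lra.
Qed.

(** * Integration in time *)

Definition partials (F : nat -> nat -> R -> R -> R) : Prop :=
  forall m n t x,
    continuity_2d_pt (F m n) t x /\
    is_derive (fun s => F m n s x) t (F (S m) n t x) /\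
    is_derive (fun y => F m n t y) x (F m (S n) t x).

(** Continuity of the partial derivatives gives joint differentiability, hence the chain rule at a
    moving point. *)
Lemma partials_chain (F : nat -> nat -> R -> R -> R) (m n : nat) (f : R -> R) (t l : R) :
  partials F -> is_derive f t l ->
  is_derive (fun s => F m n s (f s)) t (F (S m) n t (f t) + l * F m (S n) t (f t)).
Proof.
  intros HF Hf.
  assert (Hd : differentiable_pt_lim (F m n) t (f t) (F (S m) n t (f t)) (F m (S n) t (f t))).
  { apply filterdiff_differentiable_pt_lim.
    apply (is_derive_filterdiff (F m n) t (f t) (F (S m) n)).
    - apply filter_forall; intros u; apply HF.
    - apply HF.
    - apply (proj1 (continuity_2d_pt_filterlim (F (S m) n) t (f t))), HF. }
  apply is_derive_Reals.
  replace (F (S m) n t (f t) + l * F m (S n) t (f t))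
    with (F (S m) n t (f t) * 1 + F m (S n) t (f t) * l) by ring.
  apply (derivable_pt_lim_comp_2d (F m n) (fun s => s) f); [exact Hd | |].
  - apply derivable_pt_lim_id.
  - apply is_derive_Reals, Hf.
Qed.

(** The integral of F(t, x) against a peak at q(t), after translation: the corner of the kernel
    stays fixed, so differentiation under the integral sign is possible. *)
Definition moving_int (F : nat -> nat -> R -> R -> R) (m n : nat) (q : R -> R) (t : R) : R :=
  RInt (fun y => cosh (y - PI) * F m n t (y + q t)) 0 (2 * PI).

Lemma partials_cont_x (F : nat -> nat -> R -> R -> R) (m n : nat) (t x : R) :
  partials F -> continuous (F m n t) x.
Proof. intros HF; exact (is_derive_cont _ _ _ (proj2 (proj2 (HF m n t x)))). Qed.

Lemma cosh_shift_cont (x : R) : continuous (fun y => cosh (y - PI)) x.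
Proof.
  apply continuous_cosh_comp, @ex_derive_continuous; auto_derive; exact I.
Qed.

Lemma shift_cont (f : R -> R) (c x : R) :
  (forall y, continuous f y) -> continuous (fun y => f (y + c)) x.
Proof.
  intros Hf; apply (continuous_comp (fun y => y + c) f); [| apply Hf].
  apply @ex_derive_continuous; auto_derive; exact I.
Qed.

Lemma is_derive_moving_int (F : nat -> nat -> R -> R -> R) (m n : nat)
    (q dq : R -> R) (alpha T t : R) :
  partials F ->
  (forall s, alpha < s < T -> is_derive q s (dq s) /\ continuous dq s) ->
  alpha < t < T ->
  is_derive (moving_int F m n q) t
    (moving_int F (S m) n q t + dq t * moving_int F m (S n) q t).
Proof.
  intros HF Hq Ht.
  set (g := fun s y => cosh (y - PI) * (F (S m) n s (y + q s) + dq s * F m (S n) s (y + q s))).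
  assert (Hd : forall s y, alpha < s < T ->
    is_derive (fun s => cosh (y - PI) * F m n s (y + q s)) s (g s y)).
  { intros s y Hs. apply is_derive_scal.
    apply (partials_chain F m n (fun s => y + q s)); [exact HF |].
    evar_last; [apply @is_derive_plus; [apply @is_derive_const | apply Hq, Hs] |].
    unfold plus, zero; simpl; ring. }
  assert (Hloc : forall s, alpha < s < T -> locally s (fun r => alpha < r < T)).
  { intros s Hs. apply (open_and (fun r => alpha < r) (fun r => r < T));
      [apply open_gt | apply open_lt | exact Hs]. }
  evar_last.
  - apply (is_derive_RInt_param (fun s y => cosh (y - PI) * F m n s (y + q s)) 0 (2 * PI) t).
    + eapply filter_imp; [| exact (Hloc t Ht)].
      intros s Hs y _. eexists; apply Hd, Hs.
    + intros y _.
      apply (continuity_2d_pt_ext_loc g).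
      { destruct (Hloc t Ht) as [d Hdd]. exists d; intros u v Hu _.
        symmetry; apply is_derive_unique, Hd, Hdd, Hu. }
      apply continuity_2d_pt_filterlim.
      assert (Ct : continuous (fun z : R * R => fst z) (t, y)) by apply continuous_fst.
      assert (Cy : continuous (fun z : R * R => snd z) (t, y)) by apply continuous_snd.
      assert (Cq : forall f : R -> R, continuous f t -> continuous (fun z : R * R => f (fst z)) (t, y)).
      { intros f Hf. apply (continuous_comp (fun z : R * R => fst z) f); [exact Ct | exact Hf]. }
      assert (CF : forall m n, continuous (fun z : R * R => F m n (fst z) (snd z + q (fst z))) (t, y)).
      { intros m' n'. apply (continuous_comp_2 (fun z : R * R => fst z)
            (fun z : R * R => snd z + q (fst z)) (F m' n')).
        - exact Ct.
        - apply @continuous_plus; [exact Cy |]. apply Cq.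
          exact (is_derive_cont _ _ _ (proj1 (Hq t Ht))).
        - apply (proj1 (continuity_2d_pt_filterlim (F m' n') _ _)), HF. }
      assert (Hmul : forall f h : R * R -> R, continuous f (t, y) -> continuous h (t, y) ->
        continuous (fun z => f z * h z) (t, y)).
      { intros f h Hf Hh. exact (continuous_mult f h (t, y) Hf Hh). }
      unfold g.
      change (continuous (fun z : R * R => cosh (snd z - PI) *
        (F (S m) n (fst z) (snd z + q (fst z))
         + dq (fst z) * F m (S n) (fst z) (snd z + q (fst z)))) (t, y)).
      apply Hmul.
      * apply (continuous_comp (fun z : R * R => snd z) (fun x => cosh (x - PI)));
          [exact Cy | apply cosh_shift_cont].
      * apply @continuous_plus; [apply CF |].
        apply Hmul; [apply Cq, Hq, Ht | apply CF].
    + apply filter_forall; intros s.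
      apply continuous_ex_RInt; intros y; apply continuous_Rmult; [apply cosh_shift_cont |].
      apply shift_cont; intros; apply partials_cont_x, HF.
  - rewrite (RInt_ext _ (g t)).
    2: { intros y _. apply is_derive_unique, Hd, Ht. }
    apply is_RInt_unique.
    unfold moving_int.
    assert (HI : forall m n, is_RInt (fun y => cosh (y - PI) * F m n t (y + q t)) 0 (2 * PI)
              (RInt (fun y => cosh (y - PI) * F m n t (y + q t)) 0 (2 * PI))).
    { intros m' n'. apply continuous_is_RInt; intros y. apply continuous_Rmult; [apply cosh_shift_cont |].
      apply shift_cont; intros; apply partials_cont_x, HF. }
    eapply is_RInt_ext;
      [| exact (is_RInt_plus _ _ _ _ _ _ (HI (S m) n) (is_RInt_scal _ _ _ (dq t) _ (HI m (S n))))].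
    intros y _. unfold g, plus, scal; simpl; unfold mult; simpl; ring.
Qed.

(** For periodic F this is, by [gker_is_RInt], the integral of u(t, x) F(t, x) over the circle. *)
Definition pairing (F : nat -> nat -> R -> R -> R) (q1 q2 p1 p2 : R -> R) (t : R) : R :=
  p1 t * moving_int F 0 0 q1 t + p2 t * moving_int F 0 0 q2 t.

Definition dpairing (F : nat -> nat -> R -> R -> R)
    (q1 q2 p1 p2 dq1 dq2 dp1 dp2 : R -> R) (t : R) : R :=
  dp1 t * moving_int F 0 0 q1 t
  + p1 t * (moving_int F 1 0 q1 t + dq1 t * moving_int F 0 1 q1 t)
  + (dp2 t * moving_int F 0 0 q2 t
     + p2 t * (moving_int F 1 0 q2 t + dq2 t * moving_int F 0 1 q2 t)).

Definition C1_on (alpha T : R) (f df : R -> R) : Prop :=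
  forall s, alpha < s < T -> is_derive f s (df s) /\ continuous df s.

Lemma is_derive_pairing (F : nat -> nat -> R -> R -> R)
    (q1 q2 p1 p2 dq1 dq2 dp1 dp2 : R -> R) (alpha T t : R) :
  partials F -> C1_on alpha T q1 dq1 -> C1_on alpha T q2 dq2 ->
  C1_on alpha T p1 dp1 -> C1_on alpha T p2 dp2 -> alpha < t < T ->
  is_derive (pairing F q1 q2 p1 p2) t (dpairing F q1 q2 p1 p2 dq1 dq2 dp1 dp2 t) /\
  continuous (dpairing F q1 q2 p1 p2 dq1 dq2 dp1 dp2) t.
Proof.
  intros HF Hq1 Hq2 Hp1 Hp2 Ht.
  pose proof (fun m n => is_derive_moving_int F m n q1 dq1 alpha T t HF Hq1 Ht) as D1.
  pose proof (fun m n => is_derive_moving_int F m n q2 dq2 alpha T t HF Hq2 Ht) as D2.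
  destruct (Hq1 t Ht) as [A1 B1]. destruct (Hq2 t Ht) as [A2 B2].
  destruct (Hp1 t Ht) as [A3 B3]. destruct (Hp2 t Ht) as [A4 B4].
  split.
  - unfold pairing, dpairing. apply @is_derive_plus.
    + apply (is_derive_mult p1 _ t _ _ A3 (D1 0%nat 0%nat)); intros; apply Rmult_comm.
    + apply (is_derive_mult p2 _ t _ _ A4 (D2 0%nat 0%nat)); intros; apply Rmult_comm.
  - assert (C1 : forall m n, continuous (moving_int F m n q1) t)
      by (intros m n; exact (is_derive_cont _ _ _ (D1 m n))).
    assert (C2 : forall m n, continuous (moving_int F m n q2) t)
      by (intros m n; exact (is_derive_cont _ _ _ (D2 m n))).
    pose proof (is_derive_cont _ _ _ A3) as C3. pose proof (is_derive_cont _ _ _ A4) as C4.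
    assert (Hsum : forall f g : R -> R, continuous f t -> continuous g t ->
      continuous (fun y => f y + g y) t) by (intros f g Hf Hg; exact (continuous_plus f g t Hf Hg)).
    unfold dpairing.
    apply Hsum; apply Hsum.
    + apply continuous_Rmult; [exact B3 | apply C1].
    + apply continuous_Rmult; [exact C3 |]. apply Hsum; [apply C1 |].
      apply continuous_Rmult; [exact B1 | apply C1].
    + apply continuous_Rmult; [exact B4 | apply C2].
    + apply continuous_Rmult; [exact C4 |]. apply Hsum; [apply C2 |].
      apply continuous_Rmult; [exact B2 | apply C2].
Qed.

(** By the equations of motion, the terms with [force_at] and [speed_at] in [peakon_weak_identity]
    are the parts of [dpairing] due to p_i' and q_i'; the term in u phi_t is the remaining part. *)
Lemma novikov_inner (F : nat -> nat -> R -> R -> R)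
    (q1 q2 p1 p2 dq1 dq2 dp1 dp2 : R -> R) (t : R) :
  partials F -> (forall s, periodic (F 0%nat 0%nat s)) ->
  q1 t < q2 t < q1 t + 2 * PI ->
  let d := q1 t - q2 t + PI in
  dq1 t = speed_at (p1 t) (p2 t) d -> dq2 t = speed_at (p2 t) (p1 t) d ->
  dp1 t = force_at (p1 t) (p2 t) d -> dp2 t = force_at (p2 t) (p1 t) (- d) ->
  let u := peakon_u (p1 t) (p2 t) (q1 t) (q2 t) in
  let v := peakon_v (p1 t) (p2 t) (q1 t) (q2 t) in
  is_RInt (fun x => - (u x * F 1%nat 0%nat t x) + (u x)^2 * v x * F 0%nat 0%nat t x
     - helmholtz_inv (flux u v) x * F 0%nat 1%nat t x
     + helmholtz_inv (source v) x * F 0%nat 0%nat t x) 0 (2 * PI)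
   (- dpairing F q1 q2 p1 p2 dq1 dq2 dp1 dp2 t).
Proof.
  intros HF Hper Hq d E1 E2 E3 E4 u v.
  assert (P01 : periodic (F 0%nat 1%nat t)).
  { apply (derivative_periodic (F 0%nat 0%nat t)); [apply Hper | intros x; apply HF]. }
  assert (P10 : periodic (F 1%nat 0%nat t)).
  { intros x.
    rewrite <- (is_derive_unique _ _ _ (proj1 (proj2 (HF 0%nat 0%nat t x)))).
    symmetry; apply is_derive_unique.
    apply (is_derive_ext (fun s => F 0%nat 0%nat s (x + 2 * PI))).
    - intros s; apply Hper.
    - apply HF. }
  pose proof (peakon_weak_identity (p1 t) (p2 t) (q1 t) (q2 t) (F 0%nat 0%nat t) (F 0%nat 1%nat t)
    Hq (Hper t) (fun x => proj2 (proj2 (HF 0%nat 0%nat t x)))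
    (fun x => partials_cont_x F 0 1 t x HF)) as I0.
  cbv zeta in I0. fold d u v in I0.
  pose proof (fun c => gker_is_RInt (F 0%nat 0%nat t) c (Hper t) (fun x => partials_cont_x F 0 0 t x HF)) as I00.
  pose proof (fun c => gker_is_RInt (F 0%nat 1%nat t) c P01 (fun x => partials_cont_x F 0 1 t x HF)) as I01.
  pose proof (fun c => gker_is_RInt (F 1%nat 0%nat t) c P10 (fun x => partials_cont_x F 1 0 t x HF)) as I10.
  pose proof (is_RInt_plus _ _ _ _ _ _
    (is_RInt_plus _ _ _ _ _ _ (is_RInt_scal _ _ _ (dp1 t) _ (I00 (q1 t)))
      (is_RInt_scal _ _ _ (dp2 t) _ (I00 (q2 t))))
    (is_RInt_plus _ _ _ _ _ _ (is_RInt_scal _ _ _ (p1 t * dq1 t) _ (I01 (q1 t)))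
      (is_RInt_scal _ _ _ (p2 t * dq2 t) _ (I01 (q2 t))))) as J1.
  pose proof (is_RInt_plus _ _ _ _ _ _ (is_RInt_scal _ _ _ (p1 t) _ (I10 (q1 t)))
      (is_RInt_scal _ _ _ (p2 t) _ (I10 (q2 t)))) as J2.
  pose proof (is_RInt_minus _ _ _ _ _ _ (is_RInt_minus _ _ _ _ _ _ I0 J1) J2) as J.
  evar_last.
  - eapply is_RInt_ext; [| exact J].
    intros x _. unfold minus, plus, opp, scal; simpl; unfold mult; simpl.
    rewrite E1, E2, E3, E4. 
    replace (u x * F 1%nat 0%nat t x)
      with ((p1 t * gker (x - q1 t) + p2 t * gker (x - q2 t)) * F 1%nat 0%nat t x)
      by reflexivity. ring.
  - unfold dpairing, moving_int, minus, plus, opp, scal; simpl; unfold mult; simpl. ring.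
Qed.

(** A test function vanishes from some time before [T] on, so the integration never meets the
    blow-up at [T]; [alpha < 0] makes the derivative of the pairing available at t = 0. *)
Lemma novikov_peakon (alpha T : R) (u0 : R -> R)
    (q1 q2 p1 p2 dq1 dq2 dp1 dp2 : R -> R) :
  alpha < 0 < T ->
  C1_on alpha T q1 dq1 -> C1_on alpha T q2 dq2 ->
  C1_on alpha T p1 dp1 -> C1_on alpha T p2 dp2 ->
  (forall t, 0 < t < T -> q1 t < q2 t < q1 t + 2 * PI /\
    let d := q1 t - q2 t + PI in
    dq1 t = speed_at (p1 t) (p2 t) d /\ dq2 t = speed_at (p2 t) (p1 t) d /\
    dp1 t = force_at (p1 t) (p2 t) d /\ dp2 t = force_at (p2 t) (p1 t) (- d)) ->
  (forall x, two_peakon q1 q2 p1 p2 0 x = u0 x) ->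
  novikov_solution T u0 (two_peakon q1 q2 p1 p2).
Proof.
  intros HT Hq1 Hq2 Hp1 Hp2 Hode Hu0.
  split; [exact Hu0 |]. split.
  { intros t Ht. exact (proj1 (peakon_periodic (p1 t) (p2 t) (q1 t) (q2 t))). }
  exists (fun t => peakon_v (p1 t) (p2 t) (q1 t) (q2 t)).
  split.
  { intros t Ht. destruct (Hode t Ht) as [Hq _].
    exact (peakon_weak_derivative (p1 t) (p2 t) (q1 t) (q2 t) Hq). }
  intros phi [[F [HF0 HF]] [Hper [t1 [Ht1 Hzero]]]].
  assert (HP : partials F) by exact HF.
  assert (HPer : forall s, periodic (F 0%nat 0%nat s)).
  { intros s x. rewrite !HF0. apply Hper. }
  assert (Dt : forall t x, Derive (fun s => phi s x) t = F 1%nat 0%nat t x).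
  { intros t x. apply is_derive_unique.
    apply (is_derive_ext (fun s => F 0%nat 0%nat s x)); [intros; apply HF0 | apply HF]. }
  assert (Dx : forall t x, Derive (phi t) x = F 0%nat 1%nat t x).
  { intros t x. apply is_derive_unique.
    apply (is_derive_ext (fun y => F 0%nat 0%nat t y)); [intros; apply HF0 | apply HF]. }
  set (J := pairing F q1 q2 p1 p2).
  set (dJ := dpairing F q1 q2 p1 p2 dq1 dq2 dp1 dp2).
  (* The time [t1] may be negative, hence the maximum with 0. *)
  set (t2 := Rmax 0 t1).
  assert (Ht2 : 0 <= t2 /\ t1 <= t2 /\ t2 < T).
  { unfold t2. split; [apply Rmax_l |]. split; [apply Rmax_r |]. apply Rmax_lub_lt; lra. }
  assert (HJ2 : J t2 = 0).
  { unfold J, pairing, moving_int.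
    assert (Hz : forall c, RInt (fun y => cosh (y - PI) * F 0%nat 0%nat t2 (y + c)) 0 (2 * PI) = 0).
    { intros c. rewrite (RInt_ext _ (fun _ => 0)).
      - rewrite RInt_const. unfold scal; simpl; unfold mult; simpl; ring.
      - intros y _. rewrite HF0, Hzero by lra. apply Rmult_0_r. }
    rewrite !Hz. ring. }
  assert (HJ0 : RInt (fun x => u0 x * phi 0 x) 0 (2 * PI) = J 0).
  { apply is_RInt_unique.
    pose proof (fun c => gker_is_RInt (F 0%nat 0%nat 0) c (HPer 0) (fun x => partials_cont_x F 0 0 0 x HP)) as I00.
    eapply is_RInt_ext; [| exact (is_RInt_plus _ _ _ _ _ _ (is_RInt_scal _ _ _ (p1 0) _ (I00 (q1 0)))
      (is_RInt_scal _ _ _ (p2 0) _ (I00 (q2 0))))].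
    intros x _. rewrite <- Hu0, <- HF0. unfold two_peakon, gker, plus, scal; simpl; unfold mult; simpl.
    ring. }
  rewrite HJ0.
  (* The fundamental theorem gives the contribution of [0, t2]; on [t2, T] the integrand
     vanishes. *)
  replace (J 0) with (plus (minus (- J t2) (- J 0)) (scal (T - t2) 0)).
  2: { rewrite HJ2. unfold plus, minus, plus, opp, scal; simpl; unfold mult; simpl; ring. }
  apply (is_RInt_Chasles (V := R_NormedModule) _ 0 t2 T).
  - apply (is_RInt_ext (fun t => - dJ t)).
    { rewrite Rmin_left, Rmax_right by lra. intros t Ht. symmetry.
      apply is_RInt_unique.
      destruct (Hode t ltac:(lra)) as [Hq [E1 [E2 [E3 E4]]]].
      eapply is_RInt_ext;
        [| exact (novikov_inner F q1 q2 p1 p2 dq1 dq2 dp1 dp2 t HP HPer Hq E1 E2 E3 E4)].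
      intros x _. cbv beta. rewrite Dt, Dx, <- HF0. reflexivity. }
    apply (is_RInt_derive (fun t => - J t) (fun t => - dJ t)).
    + rewrite Rmin_left, Rmax_right by lra. intros t Ht.
      apply @is_derive_opp.
      apply (is_derive_pairing F q1 q2 p1 p2 dq1 dq2 dp1 dp2 alpha T t HP Hq1 Hq2 Hp1 Hp2); lra.
    + rewrite Rmin_left, Rmax_right by lra. intros t Ht.
      apply @continuous_opp.
      apply (is_derive_pairing F q1 q2 p1 p2 dq1 dq2 dp1 dp2 alpha T t HP Hq1 Hq2 Hp1 Hp2); lra.
  - apply (is_RInt_ext (fun _ => 0)); [| apply @is_RInt_const].
    rewrite Rmin_left, Rmax_right by lra. intros t Ht. symmetry.
    assert (Dt0 : forall x, Derive (fun s => phi s x) t = 0).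
    { intros x. rewrite (Derive_ext_loc _ (fun _ => 0)); [apply Derive_const |].
      assert (Hd : 0 < t - t1) by lra.
      exists (mkposreal _ Hd). intros s Hs. change (Rabs (s - t) < t - t1) in Hs.
      apply Rabs_lt_between in Hs. apply Hzero; lra. }
    assert (Dx0 : forall x, Derive (phi t) x = 0).
    { intros x. rewrite (Derive_ext _ (fun _ => 0)); [apply Derive_const |].
      intros y; apply Hzero; lra. }
    rewrite (RInt_ext _ (fun _ => 0)).
    + rewrite RInt_const. unfold scal; simpl; unfold mult; simpl; ring.
    + intros x _. rewrite Dt0, Dx0, Hzero by lra.
      match goal with |- ?a = ?b => change (@eq R a b) end; ring.
Qed.

(** * The initial data and the theorem *)

(** Both p0^2 - 2 z1 (1 + E) / sqrt(1 - E^2) and w0^2 + 2 z1 sqrt(1 - E^2) / (1 + E), with E taken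
    at q0, reduce to this value, which is w_T^2. *)
Definition Kconst (a b delta : R) : R := delta ^ 2 + 2 * b * (b + delta) * (1 - Ec (2 * a)).

Lemma z1_root (a b delta : R) : 0 < a <= 1 / 4 -> z1 a b delta = b * (b + delta) * root (2 * a).
Proof.
  intros Ha; pose proof PI_gt_3. unfold z1, root. rewrite E_Ec by lra. reflexivity.
Qed.

Lemma Kconst_pos (a b delta : R) : 0 < a <= 1 / 4 -> 0 < b -> 0 < delta -> 0 < Kconst a b delta.
Proof.
  intros Ha Hb Hd; unfold Kconst.
  pose proof (Ec_lt_1 (2 * a) ltac:(lra)).
  assert (0 < b * (b + delta)) by (apply Rmult_lt_0_compat; lra).
  assert (0 < b * (b + delta) * (1 - Ec (2 * a))) by (apply Rmult_lt_0_compat; lra).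
  assert (0 < delta ^ 2) by (apply pow_lt; lra). lra.
Qed.

Lemma p_formula_Pq (a b delta q : R) : 0 < a <= 1 / 4 -> 0 < q <= 1 ->
  p_formula a b delta q = Pq (Kconst a b delta) (z1 a b delta) q.
Proof.
  intros Ha Hq; pose proof PI_gt_3.
  unfold p_formula, Pq. rewrite !z1_root by exact Ha. rewrite !E_Ec by lra.
  fold (root q) (root (2 * a)). f_equal.
  pose proof (root_pos q Hq). pose proof (root_pos (2 * a) ltac:(lra)).
  unfold Kconst. field. lra.
Qed.

Lemma w_formula_Wq (a b delta q : R) : 0 < a <= 1 / 4 -> 0 < q <= 1 ->
  w_formula a b delta q = - Wq (Kconst a b delta) (z1 a b delta) q.
Proof.
  intros Ha Hq; pose proof PI_gt_3.
  unfold w_formula, Wq. rewrite !z1_root by exact Ha. rewrite !E_Ec by lra.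
  fold (root q) (root (2 * a)). do 2 f_equal.
  pose proof (root_pos (2 * a) ltac:(lra)). pose proof (root_sq (2 * a) ltac:(lra)) as Hr.
  pose proof (Ec_pos q). pose proof (Ec_pos (2 * a)).
  assert (E0 : root (2 * a) * (root (2 * a) / (1 + Ec (2 * a))) = 1 - Ec (2 * a)).
  { replace (root (2 * a) * (root (2 * a) / (1 + Ec (2 * a))))
      with (root (2 * a) ^ 2 / (1 + Ec (2 * a))) by (field; lra).
    rewrite Hr. field. lra. }
  unfold Kconst. rewrite <- E0. ring.
Qed.

Lemma Kconst_tn (a b delta : R) : 0 < a <= 1 / 4 ->
  Kconst a b delta - 2 * z1 a b delta * (root (2 * a) / (1 + Ec (2 * a))) = delta ^ 2.
Proof.
  intros Ha. rewrite z1_root by exact Ha.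
  pose proof (root_pos (2 * a) ltac:(lra)). pose proof (root_sq (2 * a) ltac:(lra)) as Hr.
  pose proof (Ec_pos (2 * a)).
  replace (2 * (b * (b + delta) * root (2 * a)) * (root (2 * a) / (1 + Ec (2 * a))))
    with (2 * b * (b + delta) * (root (2 * a) ^ 2 / (1 + Ec (2 * a)))) by (field; lra).
  rewrite Hr. unfold Kconst. field. lra.
Qed.

Lemma initial_momenta (a b delta : R) : 0 < a <= 1 / 4 -> 0 < b -> 0 < delta ->
  Pq (Kconst a b delta) (z1 a b delta) (2 * a) = 2 * b + delta /\
  Wq (Kconst a b delta) (z1 a b delta) (2 * a) = delta.
Proof.
  intros Ha Hb Hd; split.
  - rewrite <- p_formula_Pq by lra. unfold p_formula.
    rewrite Rminus_diag, Rmult_0_r, Rplus_0_r. apply sqrt_pow2; lra.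
  - unfold Wq. rewrite Kconst_tn by exact Ha. apply sqrt_pow2; lra.
Qed.

Lemma flow_novikov (K z q0 alpha T : R) (u0 : R -> R) (q1 q2 p1 p2 : R -> R) :
  peakon_flow K z q0 alpha T q1 q2 p1 p2 ->
  (forall x, two_peakon q1 q2 p1 p2 0 x = u0 x) ->
  novikov_solution T u0 (two_peakon q1 q2 p1 p2).
Proof.
  intros HF Hu0. pose proof PI_gt_3. pose proof (cosh_pos PI).
  assert (HT : alpha < 0 < T) by apply HF.
  pose proof (fun t => flow_ode K z q0 alpha T q1 q2 p1 p2 t HF) as Hode.
  (* Velocities and forces are polynomials in the state, which provides their continuity. *)
  set (V := fun i t => peval (fun j => peakon_state q1 q2 p1 p2 j t) i).
  assert (HV : forall e t, alpha < t < T -> continuous (V e) t).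
  { intros e t Ht. refine (is_derive_cont _ _ _ (is_derive_peval peakon_field _ t e _)).
    apply peakon_ode_psolves, Hode, Ht. }
  assert (HC : forall f e, (forall t, alpha < t < T -> is_derive f t (V e t)) -> C1_on alpha T f (V e)).
  { intros f e Hf t Ht; split; [apply Hf, Ht | apply HV, Ht]. }
  apply (novikov_peakon alpha T u0 q1 q2 p1 p2 (V speed1) (V speed2)
           (V (peakon_field X1)) (V (peakon_field X2))); try assumption; try apply HC.
  - intros t Ht. destruct (Hode t Ht) as [D1 [D2 [D3 D4]]].
    evar_last; [exact D1 | unfold V; simpl; ring].
  - intros t Ht. destruct (Hode t Ht) as [D1 [D2 [D3 D4]]].
    evar_last; [exact D2 | unfold V; simpl; ring].
  - intros t Ht. destruct (Hode t Ht) as [D1 [D2 [D3 D4]]].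
    evar_last; [exact D3 | unfold V; simpl; ring].
  - intros t Ht. destruct (Hode t Ht) as [D1 [D2 [D3 D4]]].
    evar_last; [exact D4 | unfold V; simpl; ring].
  - intros t Ht.
    assert (Hx : 0 < q2 t - q1 t <= 1).
    { destruct HF as [_ [_ [Hf _]]]. destruct (Hf t ltac:(lra)) as [Hx _]. exact Hx. }
    split; [lra |]. intros d.
    unfold speed_at, force_at, V. rewrite (cosh_opp d), (sinh_opp d).
    (* Since d = pi - q, the values cosh d and sinh d are E(q) and - E'(q) up to the factor
       cosh(pi). *)
    assert (Hc : cosh d = cosh PI * Ec (q2 t - q1 t)).
    { unfold Ec. rewrite <- cosh_opp. replace (- d) with (q2 t - q1 t - PI) by (unfold d; ring).
      field; lra. }
    assert (Hs : sinh d = - (cosh PI * Es (q2 t - q1 t))).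
    { unfold Es. replace d with (- (q2 t - q1 t - PI)) by (unfold d; ring). rewrite sinh_opp.
      field; lra. }
    rewrite Hc, Hs. simpl. repeat split; ring.
Qed.

Lemma flow_smooth (K z q0 alpha T : R) (q1 q2 p1 p2 : R -> R) :
  peakon_flow K z q0 alpha T q1 q2 p1 p2 ->
  smooth_on (Ico T) q1 /\ smooth_on (Ico T) q2 /\ smooth_on (Ico T) p1 /\ smooth_on (Ico T) p2.
Proof.
  intros HF.
  assert (HT : alpha < 0 < T) by apply HF.
  assert (Hode : forall t, Ico T t -> peakon_ode q1 q2 p1 p2 t).
  { intros t Ht. apply (flow_ode K z q0 alpha T q1 q2 p1 p2 t HF). unfold Ico in Ht; lra. }
  assert (Hs : forall f e, (forall t, Ico T t ->
      is_derive f t (peval (fun j => peakon_state q1 q2 p1 p2 j t) e)) -> smooth_on (Ico T) f).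
  { intros f e Hf. apply (smooth_on_antiderivative _ peakon_field (peakon_state q1 q2 p1 p2) f e).
    - intros t Ht; apply peakon_ode_psolves, Hode, Ht.
    - exact Hf. }
  split; [| split; [| split]].
  - apply (Hs _ speed1). intros t Ht. destruct (Hode t Ht) as [D1 [D2 [D3 D4]]].
    evar_last; [exact D1 | simpl; ring].
  - apply (Hs _ speed2). intros t Ht. destruct (Hode t Ht) as [D1 [D2 [D3 D4]]].
    evar_last; [exact D2 | simpl; ring].
  - apply (Hs _ (peakon_field X1)). intros t Ht. destruct (Hode t Ht) as [D1 [D2 [D3 D4]]].
    evar_last; [exact D3 | simpl; ring].
  - apply (Hs _ (peakon_field X2)). intros t Ht. destruct (Hode t Ht) as [D1 [D2 [D3 D4]]].
    evar_last; [exact D4 | simpl; ring].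
Qed.

Lemma flow_momenta_limits (K z q0 alpha T : R) (q1 q2 p1 p2 : R -> R) :
  0 < K -> 0 < z -> peakon_flow K z q0 alpha T q1 q2 p1 p2 ->
  filterlim p1 (at_left T) (Rbar_locally m_infty) /\
  filterlim p2 (at_left T) (Rbar_locally p_infty) /\
  filterlim (fun t => p1 t + p2 t) (at_left T) (locally (- sqrt K)).
Proof.
  intros HK Hz HF.
  assert (HT : alpha < 0 < T) by apply HF.
  assert (Hlim : filterlim (fun t => q2 t - q1 t) (at_left T) (locally 0)) by apply HF.
  assert (HT0 : at_left T (fun t => alpha < t < T)).
  { assert (Hd : 0 < T - alpha) by lra.
    exists (mkposreal _ Hd). intros y Hy HyT.
    change (Rabs (y - T) < T - alpha) in Hy; apply Rabs_lt_between in Hy. lra. }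
  assert (HP : filterlim (fun t => Pq K z (q2 t - q1 t)) (at_left T) (Rbar_locally p_infty)).
  { apply (Pq_lim K z (at_left T) _ (fun t => q2 t - q1 t) HK Hz); [| exact Hlim].
    eapply filter_imp; [| exact HT0].
    intros t Ht. apply (flow_signs K z q0 alpha T q1 q2 p1 p2 t HK Hz HF Ht). }
  split; [| split].
  - intros Q [M HM].
    (* Then p1 = - (P + W) / 2 < - P / 2 < M. *)
    assert (HL : at_left T (fun t => - 2 * M < Pq K z (q2 t - q1 t))).
    { apply (HP (fun y => - 2 * M < y)). exists (- 2 * M). intros; assumption. }
    unfold filtermap. generalize (filter_and _ _ HT0 HL); apply filter_imp.
    intros t [Ht Hlt]. apply HM.
    destruct (flow_signs K z q0 alpha T q1 q2 p1 p2 t HK Hz HF Ht)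
      as [_ [_ [_ [_ [_ [_ [HW [Hp [Hw _]]]]]]]]]. simpl. lra.
  - intros Q [M HM].
    assert (Hc : 0 < z / (K + 4 * z)) by (apply Rdiv_lt_0_compat; lra).
    assert (HL : at_left T (fun t => M / (z / (K + 4 * z)) < Pq K z (q2 t - q1 t))).
    { apply (HP (fun y => M / (z / (K + 4 * z)) < y)). exists (M / (z / (K + 4 * z))).
      intros; assumption. }
    unfold filtermap. generalize (filter_and _ _ HT0 HL); apply filter_imp.
    intros t [Ht Hlt]. apply HM.
    destruct (flow_signs K z q0 alpha T q1 q2 p1 p2 t HK Hz HF Ht)
      as [Hx [_ [_ [_ [_ [_ [_ [Hp [Hw _]]]]]]]]].
    destruct HF as [_ [_ [Hf _]]]. destruct (Hf t Ht) as [_ [HWp _]].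
    pose proof (p2_ge K z _ HK Hz Hx HWp) as Hm.
    apply (Rlt_div_l M) in Hlt; [| exact Hc]. simpl. lra.
  - destruct (Wq_continuous_0 K z HK) as [Hc Hv].
    apply (filterlim_ext_loc (fun t => - Wq K z (q2 t - q1 t))).
    + eapply filter_imp; [| exact HT0]. intros t Ht. symmetry.
      apply (flow_signs K z q0 alpha T q1 q2 p1 p2 t HK Hz HF Ht).
    + rewrite <- Hv.
      apply (filterlim_comp _ _ _ (fun t => q2 t - q1 t) (fun x => - Wq K z x)
        (at_left T) (locally 0) (locally (- Wq K z 0)) Hlim).
      exact (continuous_opp _ _ Hc).
Qed.

Lemma flow_comparable (K z q0 alpha T : R) (q1 q2 p1 p2 : R -> R) :
  0 < K -> 0 < z -> peakon_flow K z q0 alpha T q1 q2 p1 p2 ->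
  comparable_on (Ico T) (fun t => - p1 t) (fun t => p2 t - p1 t) /\
  comparable_on (Ico T) p2 (fun t => p2 t - p1 t) /\
  comparable_on (Ico T) (fun t => p2 t - p1 t) (fun t => Rpower (q2 t - q1 t) (- (1 / 4))).
Proof.
  intros HK Hz HF.
  assert (HT : alpha < 0 < T) by apply HF.
  pose proof slope_pos. pose proof (sqrt_lt_R0 slope slope_pos).
  split; [| split].
  (* From w < 0 follows - p1 >= p / 2, and from p2 > 0 follows - p1 <= p. *)
  - exists (1 / 2), 1. split; [lra |]. split; [lra |]. intros t Ht. unfold Ico in Ht.
    destruct (flow_signs K z q0 alpha T q1 q2 p1 p2 t HK Hz HF ltac:(lra))
      as [_ [_ [_ [Hp1 [Hp2 [HP [HW [Hp [Hw _]]]]]]]]]. lra.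
  - exists (z / (K + 4 * z)), 1.
    split; [apply Rdiv_lt_0_compat; lra |]. split; [lra |]. intros t Ht. unfold Ico in Ht.
    destruct (flow_signs K z q0 alpha T q1 q2 p1 p2 t HK Hz HF ltac:(lra))
      as [Hx [_ [_ [Hp1 [Hp2 [HP [HW [Hp [Hw _]]]]]]]]].
    destruct HF as [_ [_ [Hf _]]]. destruct (Hf t ltac:(lra)) as [_ [HWp _]].
    pose proof (p2_ge K z _ HK Hz Hx HWp) as Hm. rewrite Hp. split; lra.
  - exists (sqrt z), (sqrt (K + 4 * z / sqrt slope)).
    split; [apply sqrt_lt_R0, Hz |].
    split.
    { apply sqrt_lt_R0. assert (0 < 4 * z / sqrt slope) by (apply Rdiv_lt_0_compat; lra). lra. }
    intros t Ht. unfold Ico in Ht.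
    destruct (flow_signs K z q0 alpha T q1 q2 p1 p2 t HK Hz HF ltac:(lra))
      as [Hx [_ [_ [Hp1 [Hp2 [HP [HW [Hp [Hw _]]]]]]]]].
    rewrite Hp, Rpower_quarter by lra.
    split; [apply Pq_ge_fourth_root; assumption | apply Pq_le_fourth_root; assumption].
Qed.

Theorem theorem6 :
  exists C B : R, 0 < C /\
  forall a b delta : R, 0 < a <= 1 / 4 -> 1 < b -> B <= b -> 0 < delta ->
  exists (T : R) (q1 q2 p1 p2 : R -> R),
    let q := fun t => q2 t - q1 t in
    let p := fun t => p2 t - p1 t in
    let w := fun t => p1 t + p2 t in
    let q_pow := fun t => Rpower (q t) (- (1 / 4)) in
    let wT := - sqrt (delta ^ 2 + 2 * b * (b + delta) * (1 - E (2 * a))) in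
    0 < T /\
    (* smooth solution on [0, T) *)
    (peakon_ivp a b delta T q1 q2 p1 p2 /\
     smooth_on (Ico T) q1 /\ smooth_on (Ico T) q2 /\
     smooth_on (Ico T) p1 /\ smooth_on (Ico T) p2) /\
    (* uniqueness, and T is the lifespan *)
    (forall (S : R) (r1 r2 m1 m2 : R -> R),
       0 < S -> peakon_ivp a b delta S r1 r2 m1 m2 ->
       S <= T /\
       forall t, Ico S t ->
         r1 t = q1 t /\ r2 t = q2 t /\ m1 t = p1 t /\ m2 t = p2 t) /\
    (* T is the zero of q *)
    ((forall t, Ico T t -> 0 < q t) /\ filterlim q (at_left T) (locally 0)) /\
    T <= C / (delta * sqrt (2 * b * (b + delta))) /\
    (* formulas for p and w *)
    (forall t, Ico T t ->
       p t = p_formula a b delta (q t) /\ w t = w_formula a b delta (q t)) /\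
    (* (1) *)
    ((forall t, Ico T t -> p1 t = (w t - p t) / 2 /\ p1 t < 0) /\
     decreasing_on (Ico T) p1 /\
     filterlim p1 (at_left T) (Rbar_locally m_infty) /\
     comparable_on (Ico T) (fun t => - p1 t) p /\
     comparable_on (Ico T) p q_pow) /\
    (* (2) *)
    ((forall t, Ico T t -> p2 t = (w t + p t) / 2 /\ 0 < p2 t) /\
     (exists t0, Ico T t0 /\
        increasing_on (fun t => t0 <= t < T) p2) /\
     (increasing_on (Ico T) p2 <->
        b * (1 - E (2 * a)) <= delta * E (2 * a)) /\
     filterlim p2 (at_left T) (Rbar_locally p_infty) /\
     comparable_on (Ico T) p2 p /\
     comparable_on (Ico T) p q_pow) /\
    (* (3) *)
    (w 0 = - delta /\ decreasing_on (Ico T) w /\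
     filterlim w (at_left T) (locally wT)) /\
    (* the 2-peakon solves the Novikov equation *)
    novikov_solution T
      (fun x => - (b + delta) * cosh (wrap (x + a) - PI)
                + b * cosh (wrap (x - a) - PI))
      (two_peakon q1 q2 p1 p2).
Proof.
  pose proof slope_pos as Hsl. pose proof (cosh_pos PI) as Hch. pose proof PI_gt_3 as Hpi.
  (* The 4 comes from integrating x^(-3/4), [(cosh PI)^2] from the speed, and [slope] from the lower
     bound for sqrt(1 - E^2). *)
  exists (4 / ((cosh PI)^2 * slope)), 1. split.
  { apply Rdiv_lt_0_compat; [lra |]. apply Rmult_lt_0_compat; [apply pow_lt |]; lra. }
  intros a b delta Ha Hb _ Hd.
  set (K := Kconst a b delta).
  (* With this [A], [z1] is A^2 / 2 times [root (2 * a)], the form for which [distance_solution]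
     bounds [T] by a multiple of 1 / (delta A). *)
  set (A := sqrt (2 * b * (b + delta))).
  assert (HA2 : A ^ 2 = 2 * b * (b + delta)).
  { apply pow2_sqrt. assert (0 < b * (b + delta)) by (apply Rmult_lt_0_compat; lra). lra. }
  assert (HA : 0 < A).
  { apply sqrt_lt_R0. assert (0 < b * (b + delta)) by (apply Rmult_lt_0_compat; lra). lra. }
  assert (HK : 0 < K) by (apply Kconst_pos; lra).
  set (z := z1 a b delta).
  assert (Ez : A ^ 2 / 2 * root (2 * a) = z).
  { unfold z; rewrite z1_root by exact Ha. rewrite HA2. field. }
  assert (Hr0 : 0 < root (2 * a)) by (apply root_pos; lra).
  assert (Hz : 0 < z).
  { rewrite <- Ez. apply Rmult_lt_0_compat; [| exact Hr0].
    assert (0 < A ^ 2) by (apply pow_lt, HA). lra. }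
  pose proof (Kconst_tn a b delta Ha) as Htn. fold K z in Htn.
  destruct (peakon_flow_exists K A delta a HK HA Hd Ha) as
    [alpha [T [q1 [q2 [p1 [p2 [HTle [Hq10 [Hq20 HF]]]]]]]]].
  { rewrite Ez. exact Htn. }
  rewrite Ez in HF.
  assert (HT : alpha < 0 < T) by apply HF.
  pose proof (fun t => flow_signs K z (2 * a) alpha T q1 q2 p1 p2 t HK Hz HF) as Hs.
  destruct (initial_momenta a b delta Ha ltac:(lra) Hd) as [HP0 HW0]. fold K z in HP0, HW0.
  assert (Hq0 : q2 0 - q1 0 = 2 * a) by apply HF.
  assert (H0 : p1 0 = - (b + delta) /\ p2 0 = b).
  { destruct (Hs 0 ltac:(lra)) as [_ [_ [_ [_ [_ [_ [_ [Hp [Hw _]]]]]]]]].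
    rewrite Hq0, HP0 in Hp. rewrite Hq0, HW0 in Hw. lra. }
  destruct H0 as [Hp10 Hp20].
  assert (Hint : forall t, Ico T t -> alpha < t < T) by (intros t Ht; unfold Ico in Ht; lra).
  destruct (flow_momenta_limits K z (2 * a) alpha T q1 q2 p1 p2 HK Hz HF) as [L1 [L2 L3]].
  destruct (flow_comparable K z (2 * a) alpha T q1 q2 p1 p2 HK Hz HF) as [Cp1 [Cp2 Cp]].
  exists T, q1, q2, p1, p2. cbv zeta.
  split; [apply HT |].
  split.
  { split; [| exact (flow_smooth K z (2 * a) alpha T q1 q2 p1 p2 HF)].
    split; [repeat split; assumption |].
    intros t Ht; cbv zeta.
    destruct (Hs t (Hint t Ht)) as [Hx _].
    pose proof (flow_ode K z (2 * a) alpha T q1 q2 p1 p2 t HF (Hint t Ht)) as [D1 [D2 [D3 D4]]].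
    rewrite E_Ec, E'_Es by lra.
    split; [| split; [| split]]; apply is_derive_is_derive_on; assumption. }
  split.
  { intros S r1 r2 m1 m2 HS Hivp.
    exact (flow_unique K z a b delta (2 * a) alpha T S q1 q2 p1 p2 r1 r2 m1 m2
             HK Hz HF Hq10 Hq20 Hp10 Hp20 L1 HS Hivp). }
  split.
  { split; [| apply HF]. intros t Ht; apply (Hs t (Hint t Ht)). }
  split; [exact HTle |].
  split.
  { intros t Ht. destruct (Hs t (Hint t Ht)) as [Hx [_ [_ [_ [_ [_ [_ [Hp [Hw _]]]]]]]]].
    rewrite p_formula_Pq, w_formula_Wq by assumption. split; assumption. }
  split.
  { split.
    { intros t Ht. split; [field |]. apply (Hs t (Hint t Ht)). }
    split; [exact (flow_p1_decreasing K z (2 * a) alpha T q1 q2 p1 p2 HK Hz HF) |].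
    split; [exact L1 |]. split; [exact Cp1 | exact Cp]. }
  split.
  { split.
    { intros t Ht. split; [field |]. apply (Hs t (Hint t Ht)). }
    split.
    { apply (flow_p2_eventually_increasing K z (2 * a) delta alpha T q1 q2 p1 p2); try assumption.
      lra. }
    split.
    (* At t = 0 the criterion reads b - (b + delta) E(2a) <= 0. *)
    { rewrite (flow_p2_increasing_iff K z (2 * a) alpha T q1 q2 p1 p2 HK Hz HF).
      rewrite Hp10, Hp20, E_Ec by lra. split; intros Hi; lra. }
    split; [exact L2 |]. split; [exact Cp2 | exact Cp]. }
  split.
  { split; [rewrite Hp10, Hp20; ring |].
    split; [exact (flow_w_decreasing K z (2 * a) alpha T q1 q2 p1 p2 HK Hz HF) |].
    rewrite E_Ec by lra. exact L3. }
  apply (flow_novikov K z (2 * a) alpha T _ q1 q2 p1 p2 HF).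
  intros x. unfold two_peakon. rewrite Hq10, Hq20, Hp10, Hp20.
  replace (x - - a) with (x + a) by ring. reflexivity.
Qed.
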